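(* Let $\lambda\in\operatorname{Prob}(M)$ be a fixed background probability density and let $\alpha\in\mathbb R$. The Amari--Čencov $\alpha$-connection $\overline\nabla^{(\alpha)}$ on $\operatorname{Prob}(M)$ is the Levi-Civita connection of a Riemannian metric on $\operatorname{Prob}(M)$ if and only if $\alpha\in\{-1,0,1\}$. More precisely: (1) If $\alpha\in\{-1,0\}$, then $\overline\nabla^{(\alpha)}$ is the Levi-Civita connection of the restriction to $\operatorname{Prob}(M)$ of the $\alpha$-Fisher--Rao metric $G^\alpha$. (2) If $\alpha=1$, then $\overline\nabla^{(1)}$ is the Levi-Civita connection of the Riemannian metric $$\tilde G^1_\mu(a,b)=\int_M\frac{a}{\mu}\frac{b}{\mu}\,\lambda-\int_M\frac{a}{\mu}\,\lambda\int_M\frac{b}{\mu}\,\lambda .$$ (3) If $\alpha\notin\{-1,0,1\}$, then $\overline\nabla^{(\alpha)}$ is a non-metric affine connection, i.e. there is no Riemannian metric on $\operatorname{Prob}(M)$ with which $\overline\nabla^{(\alpha)}$ is compatible.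
   Context: $M$ is a closed, oriented, $n$-dimensional smooth manifold, $n\ge1$. $\operatorname{Dens}_+(M)=\{\mu\in\Omega^n(M):\mu>0\}$ is the Fr\'echet manifold of smooth positive densities, and $\operatorname{Prob}(M)=\{\mu\in\operatorname{Dens}_+(M):\int_M\mu=1\}$ the Fr\'echet manifold of smooth probability densities, with $T_\mu\operatorname{Prob}(M)=\{a\in\Omega^n(M):\int_M a=0\}$. For $a\in\Omega^n(M)$, $\frac{a}{\mu}\in C^\infty(M)$ is the Radon--Nikodym derivative, and $Db.a|_\mu=D_\mu b(a_\mu)$ is the directional derivative of a vector field $b$ in the direction $a_\mu$. The Amari--Čencov $\alpha$-connection on $\operatorname{Prob}(M)$ is $$\overline\nabla^{(\alpha)}_a b=Db.a-\frac{1+\alpha}{2}\left(\frac{a}{\mu}b-\left(\int_M\frac{a}{\mu}\frac{b}{\mu}\,\mu\right)\mu\right).$$ The $\alpha$-Fisher--Rao metric is $G^\alpha_\mu(a,b)=\int_M\left(\frac{\mu}{\lambda}\right)^{-\alpha-1}\frac{a}{\lambda}\frac{b}{\lambda}\,\lambda$. Riemannian metrics are understood in the (weak) sense appropriate for Fr\'echet manifolds: smooth families of positive definite symmetric bilinear forms on the tangent spaces. A connection $\nabla$ is compatible with a metric $g$ if $a\,g(b,c)=g(\nabla_a b,c)+g(b,\nabla_a c)$ for all vector fields $a,b,c$; the Levi-Civita connection of $g$ is the torsion-free connection compatible with $g$. *)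

(* Defs.v *)
From HB Require Import structures.
From mathcomp Require Import all_boot all_order all_algebra.
From mathcomp Require Import all_classical all_reals all_analysis.

Set Implicit Arguments.
Unset Strict Implicit.
Unset Printing Implicit Defensive.

Import Order.TTheory GRing.Theory Num.Theory.
Import numFieldNormedType.Exports.

Local Open Scope classical_set_scope.
Local Open Scope ring_scope.

Section SmoothOnRn.
Variables (R : realType) (n : nat).

Definition partial (i : 'I_n) (f : 'rV[R]_n -> R) : 'rV[R]_n -> R :=
  fun x => 'D_(delta_mx ord0 i) f x.

Definition partials (s : seq 'I_n) (f : 'rV[R]_n -> R) : 'rV[R]_n -> R :=
  foldr partial f s.

(* [U] is meant to be open. *)
Definition smooth_on (U : set 'rV[R]_n) (f : 'rV[R]_n -> R) : Prop :=
  forall s : seq 'I_n, forall x, U x ->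
    {for x, continuous (partials s f)} /\
    (forall i, derivable (partials s f) x (delta_mx ord0 i)).

Definition jac_mx (f : 'rV[R]_n -> 'rV[R]_n) (x : 'rV[R]_n) : 'M[R]_n :=
  \matrix_(i, j) partial j (fun y => f y ord0 i) x.

End SmoothOnRn.

(* A compact Hausdorff space with an atlas of charts [phi i : dom i -> R^n], with
   inverses [phinv i], whose changes of coordinates are smooth and orientation
   preserving.  Second countability is automatic by compactness. *)
Record closedOrientedManifold (R : realType) (n : nat) := ClosedOrientedManifold {
  carrier :> topologicalType;
  carrier_hausdorff : hausdorff_space carrier;
  carrier_compact : compact [set: carrier];
  index : choiceType;
  dom : index -> set carrier;
  phi : index -> carrier -> 'rV[R]_n;
  phinv : index -> 'rV[R]_n -> carrier;
  dom_open : forall i, open (dom i);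
  dom_cover : forall p, exists i, dom i p;
  phi_open : forall i, open (phi i @` dom i);
  phiK : forall i p, dom i p -> phinv i (phi i p) = p;
  phi_continuous : forall i, {within dom i, continuous (phi i)};
  phinv_continuous : forall i, {within phi i @` dom i, continuous (phinv i)};
  transition_smooth : forall i j (k : 'I_n),
    smooth_on (phi i @` (dom i `&` dom j))
      (fun x => phi j (phinv i x) ord0 k);
  transition_oriented : forall i j p, dom i p -> dom j p ->
    0 < \det (jac_mx (phi j \o phinv i) (phi i p))
}.

Section SmoothOnLinear.
Variables (R : realType) (n : nat) (U : set 'rV[R]_n).
Hypothesis U_open : open U.

Lemma partials_linear (c : R) (f g : 'rV[R]_n -> R) :
    smooth_on U f -> smooth_on U g ->
  forall s x, U x ->
    partials s (c \*: f + g) x = (c \*: partials s f + partials s g) x.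
Proof.
move=> fU gU; elim=> [//|i s IHs] x Ux; rewrite /= /partial.
have [_ /(_ i) df] := fU s x Ux; have [_ /(_ i) dg] := gU s x Ux.
rewrite (@near_eq_derive _ _ _ _ (c \*: partials s f + partials s g)); last first.
  by apply: filterS (open_nbhs_nbhs (conj U_open Ux)) => y; exact: IHs.
by rewrite deriveD ?deriveZ//; exact: derivableZ.
Qed.

Lemma smooth_on_linear (c : R) (f g : 'rV[R]_n -> R) :
  smooth_on U f -> smooth_on U g -> smooth_on U (c \*: f + g).
Proof.
move=> fU gU s x Ux.
have nearE : {near x, c \*: partials s f + partials s g
                        =1 partials s (c \*: f + g)}.
  apply: filterS (open_nbhs_nbhs (conj U_open Ux)) => y Uy.
  by rewrite partials_linear.
have [cf df] := fU s x Ux; have [cg dg] := gU s x Ux; split=> [|i].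
  apply: cvg_trans (near_eq_cvg nearE) _; rewrite partials_linear//.
  by apply: cvgD => //; apply: cvgZr.
apply: near_eq_derivable nearE _.
by apply: derivableD => //; exact: derivableZ.
Qed.

Lemma smooth_on0 : smooth_on U (fun=> 0).
Proof.
have E s : partials s (fun=> 0) = (fun=> 0) :> ('rV[R]_n -> R).
  by elim: s => //= i s ->; apply/funext => x; rewrite /partial derive_cst.
by move=> s x _; rewrite E; split=> [|i]; [exact: cst_continuous|exact: derivable_cst].
Qed.

End SmoothOnLinear.

Section Forms.
Variables (R : realType) (n : nat) (M : closedOrientedManifold R n).

Definition smooth_fun (f : M -> R) : Prop :=
  forall i : index M, smooth_on (phi i @` dom i) (f \o phinv i).

(* A top-degree form is given by its coefficients: on [dom i], with coordinates
   x = phi i, it is [w i *: dx_1 /\ ... /\ dx_n].  Off [dom i], where this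
   coefficient has no meaning, it is normalised to 0. *)
Definition is_nform (w : index M -> M -> R) : Prop :=
  [/\ forall i, smooth_on (phi i @` dom i) (w i \o phinv i),
      forall i j p, dom i p -> dom j p ->
        w i p = w j p * \det (jac_mx (phi j \o phinv i) (phi i p))
    & forall i p, ~ dom i p -> w i p = 0].

Definition nform_pred : {pred index M -> M -> R} := fun w => `[< is_nform w >].

Fact nform_submod : submod_closed nform_pred.
Proof.
split=> [|c u v /asboolP[uS uT u0] /asboolP[vS vT v0]]; apply/asboolP; split=> //.
- by move=> i; exact: smooth_on0.
- by move=> i j p _ _; rewrite mul0r.
- by move=> i; apply: smooth_on_linear (uS i) (vS i); exact: phi_open.
- move=> i j p pi pj /=.
  rewrite -[LHS]/(c * u i p + v i p) -[X in _ = X * _]/(c * u j p + v j p).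
  by rewrite (uT i j)// (vT i j)// mulrDl mulrA.
- move=> i p pi; rewrite -[LHS]/(c * u i p + v i p).
  by rewrite u0// v0// mulr0 addr0.
Qed.
HB.instance Definition _ := GRing.isSubmodClosed.Build R _ nform_pred nform_submod.

Record nform := NForm { coef :> index M -> M -> R; coefP : coef \in nform_pred }.
HB.instance Definition _ := [isSub for coef].
HB.instance Definition _ := [Choice of nform by <:].
HB.instance Definition _ := [SubChoice_isSubLmodule of nform by <:].

End Forms.

(* The Frechet topology of Omega^n(M): uniform convergence, on the compact
   subsets of each chart, of all partial derivatives of the coefficient. *)
Section CinftyTopology.
Variables (R : realType) (n : nat) (M : closedOrientedManifold R n).

Definition chart_compacts (i : index M) : set (set 'rV[R]_n) :=
  [set K | compact K /\ K `<=` phi i @` dom i].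

Definition jets (a : nform M) :
    prod_topology (fun k : index M * seq 'I_n =>
      {family chart_compacts k.1, 'rV[R]_n -> R}) :=
  fun k => partials k.2 (a k.1 \o phinv k.1).

HB.instance Definition _ := Topological.copy (nform M) (initial_topology jets).

End CinftyTopology.

HB.instance Definition _ (R : realType) (E F : preTopologicalLmodType R) :=
  Topological.on (E * F)%type.

(* Smoothness in the sense of Michal and Bastiani (equivalently, between
   Frechet spaces, of Hamilton), relative to a set [U] which is open in an affine
   subspace with direction space [T]: the directional derivatives along [T]
   exist on [U], are jointly continuous in the point and the direction, and
   so on recursively. *)
Section Calculus.
Variable R : realType.
Implicit Types E F : preTopologicalLmodType R.

Definition diff_quot E F (f : E -> F) (x h : E) : R -> F :=
  fun t => t^-1 *: (f (x + t *: h) - f x).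

Definition has_dderiv E F (f : E -> F) (x h : E) (d : F) : Prop :=
  diff_quot f x h t @[t --> 0^'] --> d.

Definition dderiv E F (f : E -> F) (x h : E) : F :=
  xget 0 [set d | has_dderiv f x h d].

Fixpoint Ck (k : nat) E F (U T : set E) (f : E -> F) : Prop :=
  {within U, continuous f} /\
  (if k is k'.+1 then
     (forall x h, U x -> T h -> exists d, has_dderiv f x h d) /\
     Ck k' (U `*` T) (T `*` T) (fun z : E * E => dderiv f z.1 z.2)
   else True).

Definition Csmooth E F (U T : set E) (f : E -> F) : Prop :=
  forall k, Ck k U T f.

End Calculus.

Section Integration.
Variable R : realType.

Fixpoint iter_int (n : nat) : ('rV[R]_n -> R) -> R :=
  match n with
  | 0 => fun f => f 0
  | m.+1 => fun f =>
      \int[lebesgue_measure]_t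
        iter_int (fun x : 'rV[R]_m => f (row_mx (t%:M : 'rV[R]_1) x))
  end.

Variables (n : nat) (M : closedOrientedManifold R n).

Definition is_partition_of_unity (s : seq (index M * (M -> R))) : Prop :=
  (forall k, k \in s ->
     [/\ smooth_fun k.2, forall p, 0 <= k.2 p
       & closure [set p | k.2 p != 0] `<=` dom k.1]) /\
  (forall p, \sum_(k <- s) k.2 p = 1).

(* Finite smooth partitions of unity exist since M is compact, and the integral
   below does not depend on which one is chosen. *)
Definition partition_of_unity : seq (index M * (M -> R)) :=
  xget [::] is_partition_of_unity.

Definition integral_form (a : nform M) : R :=
  \sum_(k <- partition_of_unity)
    iter_int ((fun x => k.2 (phinv k.1 x) * a k.1 (phinv k.1 x))
                \_ (phi k.1 @` dom k.1)).

End Integration.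

Section Densities.
Variables (R : realType) (n : nat) (M : closedOrientedManifold R n).
Implicit Types (a b c mu lambda : nform M).

Definition Dens : set (nform M) :=
  [set mu | forall i p, dom i p -> 0 < mu i p].

Definition Prob : set (nform M) :=
  [set mu | Dens mu /\ integral_form mu = 1].

(* T_mu Prob(M), the same space for every mu *)
Definition Tan : set (nform M) := [set a | integral_form a = 0].

(* The quotient of coefficients does not depend on the chart around the point. *)
Definition chart_at (p : M) : index M := sval (cid (dom_cover p)).

Definition RN a mu : M -> R := fun p => a (chart_at p) p / mu (chart_at p) p.

(* The form f a; the default value 0 of [insubd] is only used when f a is not
   smooth, hence never for smooth f. *)
Definition fmul (f : M -> R) a : nform M :=
  insubd 0 (fun i p => f p * a i p).

Definition integral_wrt (f : M -> R) mu : R := integral_form (fmul f mu).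

End Densities.

Section Geometry.
Variables (R : realType) (n : nat) (M : closedOrientedManifold R n).

Local Notation field := (nform M -> nform M).
Local Notation Prob := (@Prob R n M).
Local Notation Tan := (@Tan R n M).

Definition vector_field (a : field) : Prop :=
  (forall mu, Prob mu -> Tan (a mu)) /\ Csmooth Prob Tan a.

Definition smooth_scalar (f : nform M -> R) : Prop := Csmooth Prob Tan f.

Definition affine_connection (nabla : field -> field -> field) : Prop :=
  [/\ forall a b, vector_field a -> vector_field b -> vector_field (nabla a b),
      forall f a a' b, smooth_scalar f ->
        vector_field a -> vector_field a' -> vector_field b ->
        forall mu, Prob mu ->
        nabla (fun nu => f nu *: a nu + a' nu) b mu =
          f mu *: nabla a b mu + nabla a' b mu,
      forall a b b',
        vector_field a -> vector_field b -> vector_field b' ->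
        forall mu, Prob mu ->
        nabla a (fun nu => b nu + b' nu) mu = nabla a b mu + nabla a b' mu
    & forall f a b, smooth_scalar f -> vector_field a -> vector_field b ->
        forall mu, Prob mu ->
        nabla a (fun nu => f nu *: b nu) mu =
          dderiv f mu (a mu) *: b mu + f mu *: nabla a b mu].

(* The Lie bracket of a and b is Db.a - Da.b. *)
Definition torsion_free (nabla : field -> field -> field) : Prop :=
  forall a b, vector_field a -> vector_field b -> forall mu, Prob mu ->
    nabla a b mu - nabla b a mu = dderiv b mu (a mu) - dderiv a mu (b mu).

Definition riemannian_metric (g : nform M -> nform M -> nform M -> R) : Prop :=
  [/\ Csmooth (Prob `*` (Tan `*` Tan)) (Tan `*` (Tan `*` Tan))
        (fun z : nform M * (nform M * nform M) => g z.1 z.2.1 z.2.2),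
      forall mu (k : R) a b c, Prob mu -> Tan a -> Tan b -> Tan c ->
        g mu (k *: a + b) c = k * g mu a c + g mu b c,
      forall mu a b, Prob mu -> Tan a -> Tan b -> g mu a b = g mu b a
    & forall mu a, Prob mu -> Tan a -> a != 0 -> 0 < g mu a a].

Definition compatible (nabla : field -> field -> field)
    (g : nform M -> nform M -> nform M -> R) : Prop :=
  forall a b c, vector_field a -> vector_field b -> vector_field c ->
  forall mu, Prob mu ->
    dderiv (fun nu => g nu (b nu) (c nu)) mu (a mu) =
      g mu (nabla a b mu) (c mu) + g mu (b mu) (nabla a c mu).

Definition levi_civita (nabla : field -> field -> field)
    (g : nform M -> nform M -> nform M -> R) : Prop :=
  [/\ affine_connection nabla, torsion_free nabla & compatible nabla g].

Definition amari_cencov (alpha : R) (a b : field) : field := fun mu =>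
  dderiv b mu (a mu) -
  ((1 + alpha) / 2) *:
    (fmul (RN (a mu) mu) (b mu) -
     integral_wrt (fun p => RN (a mu) mu p * RN (b mu) mu p) mu *: mu).

Definition fisher_rao (lambda : nform M) (alpha : R) (mu a b : nform M) : R :=
  integral_wrt
    (fun p => RN mu lambda p `^ (- alpha - 1) * RN a lambda p * RN b lambda p)
    lambda.

Definition Gtilde (lambda mu a b : nform M) : R :=
  integral_wrt (fun p => RN a mu p * RN b mu p) lambda -
  integral_wrt (RN a mu) lambda * integral_wrt (RN b mu) lambda.

End Geometry.

(* Main.v *)
From HB Require Import structures.
Require Import Defs.
From mathcomp Require Import all_boot all_order all_algebra.
From mathcomp Require Import all_classical all_reals all_analysis.
From mathcomp Require Import ring lra.

(**
Put k = (1 + alpha) / 2 and, for a density mu and forms u, v, write uv/mu for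
the form (u / mu) v and <u, v> for its integral. The connection is
  nabla_a b = Db.a - k (ab/mu - <a, b> mu),
that is, the flat derivative minus k times the tangential part of ab/mu.

The three metrics. For alpha = -1 one has k = 0 and the connection is the flat
derivative, which is compatible with the constant metric u, v |-> <u, v> taken
at lambda. For alpha = 0 one has k = 1/2 and the metric is <u, v> at mu: the
derivative of 1/mu contributes minus the integral of abc/mu^2, of which each of
the two terms of compatibility supplies one half. For alpha = 1 the derivative
of b / mu along a is (nabla_a b) / mu up to a constant function, and the metric
is the covariance under lambda of u / mu and v / mu, which ignores constants;
its variance vanishes only for u proportional to mu, hence for u = 0 because u
has integral 0 ([fisher_compatible], [log_cov_compatible]).

The other values of alpha. Evaluated on constant vector fields, the curvature
is (k - k^2) (<u', v> u - <u, v> u') ([cst_nabla_nabla]). Compatibility with a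
metric g makes the curvature skew for g; as k - k^2 is not 0, this says
  <u, v> g(u', v) = <u', v> g(u, v)
at every mu ([curvature_identity]), so that g is pointwise a multiple of the
Fisher-Rao metric. The multiple is ruled out by differentiating
<b, b> g(c, b) = <c, b> g(b, b) at lambda in the direction a = bc/lambda, where
b and c are orthogonal at lambda: the two sides give -2k and -1 times the same
nonzero number, whence 2k = 1, that is, alpha = 0 ([compatible_metric_half]).
An orthogonal pair with bc not 0 is made from a smooth function with infinitely
many values ([exists_orthogonal_pair]), which needs a manifold of positive
dimension.

Two bodies of theory support this. The first is differential calculus in the
sense of Michal and Bastiani in spaces whose topology is given by families of
linear functionals. The real mean value theorem, applied through the
functionals, gives strict differentiability ([strict_dderiv]), hence the chain
rule and the smoothness of composites ([Ck_comp]); the symmetry of second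
derivatives ([dderiv_sym]) comes from the same theorem. The only nonlinear
operation on forms is inversion of a density ([Ck_qinv]), everything else being
continuous and multilinear. The second is that the integral is a continuous
positive linear functional. The existence of a partition of unity comes
with the probability density lambda: without one the integral would be an empty
sum, and lambda could not have integral 1 ([integral_neq0_partition]).
*)

Import Order.TTheory GRing.Theory Num.Theory.
Import numFieldNormedType.Exports.
Local Open Scope classical_set_scope.
Local Open Scope ring_scope.

Set Implicit Arguments.
Unset Strict Implicit.
Unset Printing Implicit Defensive.

(** * Topological vector spaces given by seminorms *)

(** Each index stands for the seminorm sup |l x| over the functionals l of its
    family. Functionals are kept, instead of seminorms only, because the real mean
    value theorem applies to [l \o f]; bounds uniform over a family then are bounds
    for the seminorm. *)
HB.mixin Record hasSeminormingFunctionals (R : realType) E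
    of PreTopologicalLmodule R E := {
  seminorm_index : Type;
  fnls : seminorm_index -> set (E -> R);
  fnls_linear : forall i l, fnls i l -> forall (c : R) x y,
    l (c *: x + y) = c * l x + l y;
  fnls_bounded : forall i x, exists C : R, forall l, fnls i l -> `|l x| <= C;
  fnls_separated : forall x, (forall i l, fnls i l -> l x = 0) -> x = 0;
  fnls_cvg : forall (G : set_system E) x, Filter G ->
    (G --> x <-> forall i (e : R), 0 < e ->
      \forall y \near G, forall l, fnls i l -> `|l (y - x)| <= e)
}.

HB.structure Definition Lcs (R : realType) :=
  {E of hasSeminormingFunctionals R E & PreTopologicalLmodule R E}.

Arguments fnls_linear {R s} [i l].
Arguments fnls_bounded {R s}.
Arguments fnls_separated {R s}.
Arguments fnls_cvg {R s} [G x].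

Section LcsTheory.
Variable R : realType.
Implicit Types E F : Lcs.type R.

Lemma fnl0 E i l : @fnls _ E i l -> l 0 = 0.
Proof.
move=> il; have := fnls_linear il (-1) 0 0.
by rewrite scaler0 addr0 mulN1r addNr.
Qed.

Lemma fnlD E i l : @fnls _ E i l -> forall x y, l (x + y) = l x + l y.
Proof. by move=> il x y; have := fnls_linear il 1 x y; rewrite scale1r mul1r. Qed.

Lemma fnlZ E i l : @fnls _ E i l -> forall (c : R) x, l (c *: x) = c * l x.
Proof.
by move=> il c x; have := fnls_linear il c x 0; rewrite !addr0 (fnl0 il) addr0.
Qed.

Lemma fnlB E i l : @fnls _ E i l -> forall x y, l (x - y) = l x - l y.
Proof.
by move=> il x y; rewrite (fnlD il) -scaleN1r (fnlZ il) mulN1r.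
Qed.

Section Limits.
Context {T : Type} (H : set_system T) {FH : Filter H}.

Lemma lcs_cvgP E (f : T -> E) x : f @ H --> x <->
  forall i (e : R), 0 < e -> \forall t \near H, forall l, @fnls _ E i l -> `|l (f t - x)| <= e.
Proof. exact: fnls_cvg. Qed.

Lemma lcs_cvgD E (f g : T -> E) x y :
  f @ H --> x -> g @ H --> y -> f t + g t @[t --> H] --> x + y.
Proof.
move=> /lcs_cvgP fx /lcs_cvgP gy; apply/lcs_cvgP => i e e0.
have e20 : 0 < e / 2 by rewrite divr_gt0.
near=> t => l il.
rewrite opprD addrACA (fnlD il) (le_trans (ler_normD _ _))//.
rewrite [leRHS]splitr lerD//.
- by move: l il; near: t; exact: fx.
- by move: l il; near: t; exact: gy.
Unshelve. all: by end_near. Qed.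

Lemma lcs_cvgZ E (c : T -> R) (f : T -> E) (k : R) (x : E) :
  c @ H --> k -> f @ H --> x -> c t *: f t @[t --> H] --> k *: x.
Proof.
move=> ck /lcs_cvgP fx; apply/lcs_cvgP => i e e0.
have [C HC] := fnls_bounded i x.
pose D := `|C| + 1.
have D0 : 0 < D by rewrite ltr_wpDl.
have K0 : 0 < `|k| + 1 by rewrite ltr_wpDl.
near=> t => l il.
have -> : c t *: f t - k *: x = c t *: (f t - x) + (c t - k) *: x.
  by rewrite scalerBr scalerBl addrA subrK.
rewrite (fnlD il) !(fnlZ il) (le_trans (ler_normD _ _))// !normrM.
rewrite [leRHS]splitr lerD//.
- rewrite (@le_trans _ _ ((`|k| + 1) * (e / 2 / (`|k| + 1))))//; last first.
    by rewrite mulrC divfK// gt_eqF.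
  apply: ler_pM => //.
    rewrite -lerBlDl (le_trans (lerB_dist _ _))//; near: t.
    by apply: cvgr_distC_le.
  by move: l il; near: t; apply: fx; rewrite !divr_gt0.
- rewrite (@le_trans _ _ ((e / 2 / D) * D))//; last first.
    by rewrite divfK// gt_eqF.
  apply: ler_pM => //.
    near: t; apply: cvgr_distC_le => //; by rewrite !divr_gt0.
  by rewrite (le_trans (HC _ il))// /D (le_trans (ler_norm _))// lerDl.
Unshelve. all: by end_near. Qed.

End Limits.

Lemma lcs_cvg_unique E (G : set_system E) (x y : E) : ProperFilter G ->
  G --> x -> G --> y -> x = y.
Proof.
move=> PG /fnls_cvg Gx /fnls_cvg Gy; apply/eqP; rewrite -subr_eq0; apply/eqP.
apply: (@fnls_separated R E) => i l il; apply/eqP; rewrite -normr_le0.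
apply/ler_addgt0Pl => e e0; rewrite addr0.
have e20 : 0 < e / 2 by rewrite divr_gt0.
have [z [/(_ _ il) zx /(_ _ il) zy]] := filter_ex (filterI (Gx i _ e20) (Gy i _ e20)).
have -> : x - y = (z - y) - (z - x) by rewrite opprB [RHS]addrC addrA subrK.
by rewrite (fnlB il) (le_trans (ler_normB _ _))// [leRHS]splitr lerD.
Qed.

End LcsTheory.

Section LcsInstances.
Variable R : realType.

Lemma fnls_cvg_real (G : set_system R) (x : R) : Filter G ->
  (G --> x <-> forall (i : unit) (e : R), 0 < e ->
      \forall y \near G, forall l, [set (id : R -> R)] l -> `|l (y - x)| <= e).
Proof.
move=> FG; split=> [Gx _ e e0|Gx].
  by near=> y => l ->; near: y; apply: (@cvgr_distC_le _ _ _ _ _ id).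
apply/(@cvgrPdistC_le _ R _ _ _ id) => e e0.
by apply: filterS (Gx tt e e0) => y /(_ id erefl).
Unshelve. all: by end_near. Qed.

Lemma fnls_linear_real (i : unit) (l : R -> R) : [set (id : R -> R)] l ->
  forall (c x y : R), l (c *: x + y) = c * l x + l y.
Proof. by move=> ->. Qed.
Lemma fnls_bounded_real (i : unit) (x : R) : exists C, forall l : R -> R, [set id] l -> `|l x| <= C.
Proof. by exists `|x| => l ->. Qed.
Lemma fnls_separated_real (x : R) :
  (forall (i : unit) l, [set (id : R -> R)] l -> l x = 0) -> x = 0.
Proof. exact. Qed.

HB.instance Definition _ := hasSeminormingFunctionals.Build R (R : Type)
  fnls_linear_real fnls_bounded_real fnls_separated_real fnls_cvg_real.

Variables E F : Lcs.type R.

Definition prod_fnls (k : @seminorm_index R E + @seminorm_index R F) :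
    set (E * F -> R) :=
  match k with
  | inl i => [set l \o fst | l in fnls i]
  | inr j => [set l \o snd | l in fnls j]
  end.

Lemma fnls_linear_prod k l : prod_fnls k l -> forall (c : R) x y,
  l (c *: x + y) = c * l x + l y.
Proof. by case: k => i [m im <-] c x y /=; exact: (fnls_linear im). Qed.

Lemma fnls_bounded_prod k x : exists C, forall l, prod_fnls k l -> `|l x| <= C.
Proof.
case: k => i; [have [C HC] := fnls_bounded i x.1|have [C HC] := fnls_bounded i x.2];
  by exists C => l [m im <-]; exact: HC.
Qed.

Lemma fnls_separated_prod x : (forall k l, prod_fnls k l -> l x = 0) -> x = 0.
Proof.
case: x => x y xy0; congr pair; apply: fnls_separated => i l il.
  by apply: (xy0 (inl i) (l \o fst)); exists l.
by apply: (xy0 (inr i) (l \o snd)); exists l.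
Qed.

Lemma fnls_cvg_prod (G : set_system (E * F)) x : Filter G ->
  (G --> x <-> forall k (e : R), 0 < e ->
    \forall y \near G, forall l, prod_fnls k l -> `|l (y - x)| <= e).
Proof.
move=> FG; split=> [Gx [i|i] e e0|Gx].
- have : fst @ G --> x.1 by apply: cvg_trans (cvg_app fst Gx) _; exact: cvg_fst.
  by move=> /lcs_cvgP /(_ i e e0); apply: filterS => y H _ [l il <-]; exact: H.
- have : snd @ G --> x.2 by apply: cvg_trans (cvg_app snd Gx) _; exact: cvg_snd.
  by move=> /lcs_cvgP /(_ i e e0); apply: filterS => y H _ [l il <-]; exact: H.
suff : (fun z : E * F => (z.1, z.2)) @ G --> (x.1, x.2).
  have -> : (fun z : E * F => (z.1, z.2)) = id by apply/funext => -[].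
  by have -> : (x.1, x.2) = x by case: (x).
apply: cvg_pair => /=.
- apply/lcs_cvgP => i e e0; apply: filterS (Gx (inl i) e e0) => y H l il.
  by apply: (H (l \o fst)); exists l.
- apply/lcs_cvgP => i e e0; apply: filterS (Gx (inr i) e e0) => y H l il.
  by apply: (H (l \o snd)); exists l.
Qed.

HB.instance Definition _ := hasSeminormingFunctionals.Build R (E * F)%type
  fnls_linear_prod fnls_bounded_prod fnls_separated_prod fnls_cvg_prod.

End LcsInstances.

(** * Directional derivatives and smooth maps *)

Section Calculus.
Variable R : realType.
Implicit Types E F G : Lcs.type R.

(** The sets on which the calculus relative to the direction space T works:
    convexity keeps segments in U for the mean value theorem, and closedness of T
    keeps derivatives of U-valued maps in T. Openness is only asked along lines,
    since directional derivatives see nothing else. *)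
Record admissible E (U T : set E) : Prop := Admissible {
  adm0 : T 0;
  admP : forall (c : R) x y, T x -> T y -> T (c *: x + y);
  adm_closed : forall (H : set_system E) x, ProperFilter H -> H --> x -> H T -> T x;
  adm_sub : forall x y, U x -> U y -> T (x - y);
  adm_open : forall x h, U x -> T h -> \forall t \near (0 : R), U (x + t *: h);
  adm_convex : forall x h (t : R), U x -> U (x + h) -> 0 <= t <= 1 -> U (x + t *: h)
}.

Lemma admD E (U T : set E) : admissible U T -> forall x y, T x -> T y -> T (x + y).
Proof. by move=> aU x y Tx Ty; rewrite -[x]scale1r; apply: (admP aU). Qed.

Lemma admZ E (U T : set E) : admissible U T -> forall c x, T x -> T (c *: x).
Proof. by move=> aU c x Tx; rewrite -[_ *: _]addr0; apply: (admP aU) (adm0 aU). Qed.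

Lemma adm_setT E : admissible (@setT E) setT.
Proof. by split=> // x h _ _; apply: (@nearW _ (nbhs (0 : R))). Qed.

Lemma adm_tangent E (U T : set E) : admissible U T -> admissible T T.
Proof.
move=> aU; split.
- exact: (adm0 aU).
- exact: (admP aU).
- exact: (adm_closed aU).
- by move=> x y Tx Ty; rewrite addrC -scaleN1r; exact: (admP aU).
- by move=> x h Tx Th; apply: (@nearW _ (nbhs (0 : R))) => t; rewrite addrC; exact: (admP aU).
- move=> x h t Tx Txh _; rewrite addrC; apply: (admP aU) => //.
  by rewrite -[h](addKr x) -scaleN1r; exact: (admP aU).
Qed.

Lemma adm_prod E F (U T : set E) (V S : set F) : admissible U T ->
  admissible V S -> admissible (U `*` V) (T `*` S).
Proof.
move=> aU aV; split.
- by split; [exact: (adm0 aU)|exact: (adm0 aV)].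
- move=> c x y [Tx Sx] [Ty Sy].
  by split; [exact: (admP aU)|exact: (admP aV)].
- move=> H x PH Hx HT; split.
  + apply: (@adm_closed _ _ _ aU (fst @ H)).
      by apply: cvg_trans (cvg_app fst Hx) _; exact: cvg_fst.
    by apply: (@filterS _ H) HT => z [].
  + apply: (@adm_closed _ _ _ aV (snd @ H)).
      by apply: cvg_trans (cvg_app snd Hx) _; exact: cvg_snd.
    by apply: (@filterS _ H) HT => z [].
- by move=> x y [? ?] [? ?]; split; [apply: (adm_sub aU)|apply: (adm_sub aV)].
- move=> x h [Ux Vx] [Th Sh].
  by apply: filterS2 (adm_open aU Ux Th) (adm_open aV Vx Sh) => t.
- move=> x h t [Ux Vx] [Uh Vh] t01.
  by split; [apply: (adm_convex aU)|apply: (adm_convex aV)].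
Qed.

Lemma has_dderiv_unique E F (f : E -> F) x h d d' :
  has_dderiv f x h d -> has_dderiv f x h d' -> d = d'.
Proof. by move=> fd fd'; exact: (lcs_cvg_unique _ fd fd'). Qed.

Lemma dderivP E F (f : E -> F) x h :
  (exists d, has_dderiv f x h d) -> has_dderiv f x h (dderiv f x h).
Proof. by case=> d fd; apply: (@xgetPex _ 0 [set d | has_dderiv f x h d]); exists d. Qed.

Lemma dderivE E F (f : E -> F) x h d : has_dderiv f x h d -> dderiv f x h = d.
Proof. by move=> fd; apply: has_dderiv_unique (fd); apply: dderivP; exists d. Qed.

Lemma near_has_dderiv E F (f g : E -> F) x h d :
  f x = g x -> (\forall t \near (0 : R)^', f (x + t *: h) = g (x + t *: h)) ->
  has_dderiv f x h d -> has_dderiv g x h d.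
Proof.
move=> fgx fg; apply: cvg_trans; apply: near_eq_cvg.
by apply: filterS fg => t; rewrite /diff_quot fgx => ->.
Qed.

Lemma adm_near E (U T : set E) x h : admissible U T -> U x -> T h ->
  \forall t \near (0 : R)^', U (x + t *: h).
Proof. by move=> aU Ux Th; apply: cvg_within; exact: (adm_open aU). Qed.

Lemma eq_has_dderiv E F (U T : set E) (f g : E -> F) x h d :
  admissible U T -> (forall y, U y -> f y = g y) -> U x -> T h ->
  has_dderiv f x h d -> has_dderiv g x h d.
Proof.
move=> aU fg Ux Th; apply: near_has_dderiv; first exact: fg.
by apply: filterS (adm_near aU Ux Th) => t; exact: fg.
Qed.

Lemma eq_dderiv E F (U T : set E) (f g : E -> F) x h :
  admissible U T -> (forall y, U y -> f y = g y) -> U x -> T h ->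
  dderiv f x h = dderiv g x h.
Proof.
move=> aU fg Ux Th; rewrite /dderiv; congr (xget 0 _).
apply/funext => d; apply/propext; split; apply: (eq_has_dderiv aU) => // y Uy.
exact/esym/fg.
Qed.

Lemma within_cvg E F (U : set E) (f : E -> F) : {within U, continuous f} ->
  forall S (H : set_system S) (g : S -> E) x, Filter H -> U x -> g @ H --> x ->
  (\forall s \near H, U (g s)) -> f (g s) @[s --> H] --> f x.
Proof.
move=> /subspace_continuousP cf S H g x FH Ux gx Ug; apply: cvg_comp (cf x Ux).
move=> A; rewrite /within/= => /gx; apply: (@filterS2 _ H) Ug => s Us; exact.
Qed.

Lemma eq_within_continuous E F (U : set E) (f g : E -> F) :
  (forall y, U y -> f y = g y) ->
  {within U, continuous f} -> {within U, continuous g}.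
Proof.
move=> fg cf; apply/subspace_continuousP => x Ux.
rewrite /from_subspace -(fg _ Ux); apply: cvg_trans; last first.
  by move/subspace_continuousP: cf => /(_ x Ux); apply.
apply: near_eq_cvg; rewrite near_withinE.
by apply: (@nearW _ (nbhs x)) => y Uy; exact: fg.
Qed.

Lemma eq_Ck k E F (U T : set E) (f g : E -> F) :
  admissible U T -> (forall y, U y -> f y = g y) -> Ck k U T f -> Ck k U T g.
Proof.
elim: k E F U T f g => [|k IH] E F U T f g aU fg /= [cf]; split.
- exact: eq_within_continuous cf.
- by [].
- exact: eq_within_continuous cf.
- case: b => df Cdf; split.
    move=> x h Ux Th; have [d fd] := df x h Ux Th.
    by exists d; exact: (eq_has_dderiv aU fg).
  apply: IH Cdf; first by apply: adm_prod => //; exact: adm_tangent aU.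
  by move=> [x h] [Ux Th]; exact: (eq_dderiv aU).
Qed.

Lemma has_dderivZ E F (f : E -> F) x h d c :
  has_dderiv f x h d -> has_dderiv f x (c *: h) (c *: d).
Proof.
have [->|c0] := eqVneq c 0.
  move=> _; rewrite /has_dderiv !scale0r.
  rewrite (_ : diff_quot f x 0 = fun=> 0); first exact: cvg_cst.
  by apply/funext => t; rewrite /diff_quot scaler0 addr0 subrr scaler0.
move=> fd.
have ct : (fun t : R => t * c) @ 0^' --> (0 : R)^'.
  move=> A; rewrite !near_simpl !near_withinE => HA.
  have : (fun t : R => t * c) @ 0 --> (0 : R).
    by rewrite -[X in _ --> X](mul0r c); apply: cvgM => //; exact: cvg_cst.
  move=> /(_ _ HA); apply: (@filterS _ (nbhs (0 : R))) => t /= At t0.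
  by apply: At; rewrite mulf_neq0.
have : (fun t => c *: diff_quot f x h (t * c)) @ 0^' --> c *: d.
  apply: lcs_cvgZ; first exact: cvg_cst.
  exact: cvg_comp ct fd.
apply: cvg_trans; apply: near_eq_cvg.
apply: (@nearW _ 0^') => t.
by rewrite /diff_quot !scalerA invfM mulrCA mulfV// mulr1.
Qed.

Lemma fnl_cvg E i (l : E -> R) S (H : set_system S) (f : S -> E) x :
  Filter H -> fnls i l -> f @ H --> x -> l (f s) @[s --> H] --> l x.
Proof.
move=> FH il /lcs_cvgP fx; apply/lcs_cvgP => j e e0.
by apply: filterS (fx i e e0) => s /(_ l il) + _ -> /=; rewrite (fnlB il).
Qed.

Section StrictDerivative.
Variables (E F : Lcs.type R) (U T : set E) (f : E -> F).
Hypothesis aU : admissible U T.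
Hypothesis dfU : forall x h, U x -> T h -> exists d, has_dderiv f x h d.
Hypothesis cdf : {within U `*` T, continuous (fun z : E * E => dderiv f z.1 z.2)}.

(** The mean value theorem on the segment from y to y + t h, for each functional of
    the target: the derivative at the intermediate point is near the one at x by
    joint continuity, in a neighbourhood that serves all functionals of a family.
    Base point and direction move with s; this is what the chain rule and
    additivity in the direction need. *)
Lemma strict_dderiv S (H : set_system S) (y h : S -> E) (t : S -> R) x k :
  Filter H -> U x -> T k -> y @ H --> x -> h @ H --> k -> t @ H --> (0 : R) ->
  (\forall s \near H, [/\ U (y s), T (h s), U (y s + t s *: h s) & t s != 0]) ->
  (t s)^-1 *: (f (y s + t s *: h s) - f (y s)) @[s --> H] --> dderiv f x k.
Proof.
move=> FH Ux Tk yx hk t0 near_in; apply/lcs_cvgP => i e e0.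
move: cdf => /subspace_continuousP /(_ (x, k) (conj Ux Tk)) /lcs_cvgP /(_ i e e0).
rewrite near_withinE => nearQ.
have zx : (fun p : S * R => (y p.1 + p.2 *: h p.1, h p.1))
    @ filter_prod H (nbhs (0 : R)) --> (x, k).
  rewrite -[x]addr0 -(scale0r k); apply: cvg_pair => /=.
    apply: lcs_cvgD; first exact: cvg_comp cvg_fst yx.
    apply: lcs_cvgZ; first exact: cvg_snd.
    exact: cvg_comp cvg_fst hk.
  exact: cvg_comp cvg_fst hk.
have [[A B] /= [HA /nbhs_ballP[dl /= dl0 HB]] AB] := zx _ nearQ.
near=> s => l il.
have [Uy Th Uyth ts0] : [/\ U (y s), T (h s), U (y s + t s *: h s) & t s != 0].
  by near: s.
have As : A s by near: s.
have ts : `|t s| < dl by near: s; exact: cvgr0_norm_lt.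
pose z (a : R) := y s + (a * t s) *: h s.
have Uz (a : R) : 0 <= a <= 1 -> U (z a).
  by move=> a01; rewrite /z -scalerA; exact: (adm_convex aU).
pose psi (a : R) : R := l ((t s)^-1 *: f (z a) - a *: dderiv f x k).
pose psi' (a : R) : R := l (dderiv f (z a) (h s) - dderiv f x k).
have dpsi (a : R) : 0 <= a <= 1 -> is_derive a 1 psi (psi' a).
  move=> a01.
  have : h^-1 *: ((psi \o shift a) (h *: 1) - psi a) @[h --> 0^'] --> psi' a.
    have fd := @has_dderivZ _ _ _ _ _ _ (t s) (dderivP (dfU (Uz _ a01) Th)).
    have : l ((t s)^-1 *: diff_quot f (z a) (t s *: h s) b - dderiv f x k)
        @[b --> (0 : R)^'] --> psi' a.
      apply: (fnl_cvg _ il).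
      apply: lcs_cvgD; last exact: cvg_cst.
      rewrite -[X in _ --> X]scale1r -(mulVf ts0) -scalerA.
      by apply: lcs_cvgZ => //; exact: cvg_cst.
    apply: cvg_trans; apply: near_eq_cvg; near=> b.
    have b0 : b != 0 by near: b; exact: nbhs_dnbhs_neq.
    rewrite /psi /= -(fnlB il) -[RHS](fnlZ il); congr l.
    have -> : z (b *: 1 + a) = z a + b *: (t s *: h s).
      by rewrite /z [b *: 1]mulr1 mulrDl scalerDl scalerA addrA addrAC.
    rewrite /diff_quot; set P := f (_ + _); set Q := f (z a).
    rewrite [b *: 1]mulr1 scalerDl opprD opprB !addrA subrK.
    transitivity (b^-1 *: ((t s)^-1 *: (P - Q) - b *: dderiv f x k)).
      by rewrite [RHS]scalerBr !scalerA mulVf// scale1r (mulrC b^-1).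
    by congr (_ *: _); rewrite scalerBr addrAC.
  move=> dl_; apply: DeriveDef; first by apply/cvg_ex; exists (psi' a).
  exact: cvg_lim dl_.
have [||a a01] := @MVT_segment R psi psi' 0 1 ler01.
- by move=> a /itvP a01; apply: dpsi; rewrite !a01.
- apply: derivable_within_continuous => a /itvP a01.
  by have [] := dpsi a; rewrite ?a01.
rewrite subr0 mulr1 /psi -(fnlB il) /z !mul1r !mul0r !scale0r subr0 addr0 scale1r.
rewrite addrAC -scalerBr => ->; rewrite /psi'.
move: a01; rewrite in_itv/= => a01.
apply: (AB (s, a * t s) _ _ l il); last by split; [exact: Uz|].
split => //=; apply: HB; rewrite /ball/= sub0r normrN normrM.
rewrite (le_lt_trans _ ts)// ger0_norm ?(andP a01).1//.
by rewrite ler_piMl// (andP a01).2.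
Unshelve. all: by end_near. Qed.

End StrictDerivative.

Lemma Ck1_strict_dderiv E F (U T : set E) (f : E -> F) : admissible U T ->
  Ck 1 U T f -> forall S (H : set_system S) (y h : S -> E) (t : S -> R) (x k : E),
  Filter H -> U x -> T k -> y @ H --> x -> h @ H --> k -> t @ H --> (0 : R) ->
  (\forall s \near H, [/\ U (y s), T (h s), U (y s + t s *: h s) & t s != 0]) ->
  (t s)^-1 *: (f (y s + t s *: h s) - f (y s)) @[s --> H] --> dderiv f x k.
Proof. by move=> aU [_ [df [cdf _]]]; exact: strict_dderiv. Qed.

Lemma Ck1_has_dderiv E F (U T : set E) (f : E -> F) x h :
  Ck 1 U T f -> U x -> T h -> has_dderiv f x h (dderiv f x h).
Proof. by move=> [_ [df _]] Ux Th; apply: dderivP; exact: df. Qed.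

Lemma cvg_id0 : (fun t : R => t) @ 0^' --> (0 : R).
Proof. by apply: cvg_within; exact: cvg_id. Qed.

(** The difference quotients lie in S and S is closed. *)
Lemma has_dderiv_in E F (U T : set E) (V S : set F) (f : E -> F) x h d :
  admissible U T -> admissible V S -> (forall y, U y -> V (f y)) ->
  U x -> T h -> has_dderiv f x h d -> S d.
Proof.
move=> aU aV UV Ux Th fd; apply: (adm_closed aV) fd _.
apply: (@filterS _ 0^') (adm_near aU Ux Th) => t Ut.
by apply: (admZ aV); apply: (adm_sub aV); exact: UV.
Qed.

(** The value g (f (x + t h)) is g (f x + t q), where the difference quotient q of
    f tends to d; so the difference quotient of g \o f is one of g in a moving
    direction. *)
Lemma has_dderiv_comp E F G (U T : set E) (V S : set F) (f : E -> F) (g : F -> G) x h d :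
  admissible U T -> admissible V S -> (forall y, U y -> V (f y)) ->
  Ck 1 V S g -> U x -> T h -> has_dderiv f x h d ->
  has_dderiv (g \o f) x h (dderiv g (f x) d).
Proof.
move=> aU aV UV Cg Ux Th fd.
have Sd := has_dderiv_in aU aV UV Ux Th fd.
have t0 : \forall t \near (0 : R)^', t != 0 by exact: nbhs_dnbhs_neq.
have quotE t : t != 0 -> f x + t *: diff_quot f x h t = f (x + t *: h).
  by move=> tn0; rewrite /diff_quot scalerA mulfV// scale1r addrC subrK.
have : (t^-1 *: (g (f x + t *: diff_quot f x h t) - g (f x)))
    @[t --> (0 : R)^'] --> dderiv g (f x) d.
  apply: (Ck1_strict_dderiv aV Cg) => //; first exact: UV.
  - exact: cvg_cst.
  - exact: cvg_id0.
  - near=> t; have tn0 : t != 0 by near: t.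
    have Ut : U (x + t *: h) by near: t; exact: adm_near aU Ux Th.
    split=> //; first exact: UV.
      by apply: (admZ aV); apply: (adm_sub aV); exact: UV.
    by rewrite quotE//; exact: UV.
apply: cvg_trans; apply: near_eq_cvg; near=> t.
by rewrite quotE//; near: t.
Unshelve. all: by end_near. Qed.

(** The increment along h + k is the increment along h followed by one along k with
    base point x + t h, which [strict_dderiv] allows to move. *)
Lemma dderivD E F (U T : set E) (f : E -> F) x h k : admissible U T ->
  Ck 1 U T f -> U x -> T h -> T k ->
  dderiv f x (h + k) = dderiv f x h + dderiv f x k.
Proof.
move=> aU Cf Ux Th Tk; apply: dderivE.
have Thk := admD aU Th Tk.
have fh := Ck1_has_dderiv Cf Ux Th.
have : (fun t => t^-1 *: (f ((x + t *: h) + t *: k) - f (x + t *: h)))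
    @ (0 : R)^' --> dderiv f x k.
  apply: (Ck1_strict_dderiv aU Cf) => //.
  - rewrite -[X in _ --> X]addr0 -(scale0r h).
    apply: lcs_cvgD; first exact: cvg_cst.
    by apply: lcs_cvgZ; [exact: cvg_id0|exact: cvg_cst].
  - exact: cvg_cst.
  - exact: cvg_id0.
  - near=> t; split=> //.
    + by near: t; exact: adm_near aU Ux Th.
    + by rewrite -addrA -scalerDr; near: t; exact: adm_near aU Ux Thk.
    + by near: t; exact: nbhs_dnbhs_neq.
move=> /(lcs_cvgD fh); apply: cvg_trans; apply: near_eq_cvg.
apply: (@nearW _ (0 : R)^') => t.
rewrite /diff_quot -scalerDr addrC addrA subrK; congr (_ *: (f _ - _)).
by rewrite scalerDr addrA.
Unshelve. all: by end_near. Qed.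

Lemma dderivZ E F (U T : set E) (f : E -> F) x h (c : R) : 
  Ck 1 U T f -> U x -> T h -> dderiv f x (c *: h) = c *: dderiv f x h.
Proof.
by move=> Cf Ux Th; apply/dderivE/has_dderivZ; exact: Ck1_has_dderiv Cf Ux Th.
Qed.

Lemma Ck_pred k E F (U T : set E) (f : E -> F) : Ck k.+1 U T f -> Ck k U T f.
Proof.
elim: k E F U T f => [|k IH] E F U T f; first by case.
by move=> [cf [df Cdf]]; split=> //; split=> //; exact: IH.
Qed.

Lemma Ck_Ck1 k E F (U T : set E) (f : E -> F) : Ck k.+1 U T f -> Ck 1 U T f.
Proof. by elim: k => // k IH /Ck_pred. Qed.

Definition clinear E F (L : E -> F) : Prop :=
  (forall (c : R) x y, L (c *: x + y) = c *: L x + L y) /\ continuous L.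

Lemma clinear_has_dderiv E F (L : E -> F) x h : clinear L -> has_dderiv L x h (L h).
Proof.
move=> [lL _]; apply: cvg_trans (cvg_cst (L h) : _ @ (0 : R)^' --> _).
apply: near_eq_cvg; near=> t.
have t0 : t != 0 by near: t; exact: nbhs_dnbhs_neq.
by rewrite /diff_quot [x + _]addrC lL addrK scalerA mulVf// scale1r.
Unshelve. all: by end_near. Qed.

Lemma clinear_comp E F G (L : E -> F) (N : F -> G) :
  clinear L -> clinear N -> clinear (N \o L).
Proof.
move=> [lL cL] [lN cN]; split; first by move=> c x y /=; rewrite lL lN.
by move=> x; apply: continuous_comp; [exact: cL|exact: cN].
Qed.

Lemma clinear_fst E F : clinear (fst : E * F -> E).
Proof. by split => // x; exact: cvg_fst. Qed.

Lemma clinear_snd E F : clinear (snd : E * F -> F).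
Proof. by split => // x; exact: cvg_snd. Qed.

Lemma clinear_id E : clinear (id : E -> E).
Proof. by split => // x; exact: cvg_id. Qed.

Lemma clinear_add E : clinear (fun z : E * E => z.1 + z.2).
Proof.
split=> [c x y|x] /=; first by rewrite scalerDr addrACA.
by apply: lcs_cvgD; [exact: cvg_fst|exact: cvg_snd].
Qed.

Lemma clinear_scale E (k : R) : clinear (fun z : E => k *: z).
Proof.
split=> [c x y|x] /=; first by rewrite scalerDr !scalerA mulrC.
by apply: lcs_cvgZ; [exact: cvg_cst|exact: cvg_id].
Qed.

Lemma Ck_clinear k E F (U T : set E) (L : E -> F) : clinear L -> Ck k U T L.
Proof.
elim: k E F U T L => [|k IH] E F U T L lL /=.
  by split=> //; apply: continuous_subspaceT; exact: lL.2.
split; first by apply: continuous_subspaceT; exact: lL.2.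
split; first by move=> x h _ _; exists (L h); exact: clinear_has_dderiv.
have -> : (fun z : E * E => dderiv L z.1 z.2) = L \o snd.
  by apply/funext => z; apply: dderivE; exact: clinear_has_dderiv.
by apply: IH; apply: clinear_comp lL; exact: clinear_snd.
Qed.

Lemma has_dderiv_cst E F (c : F) (x h : E) : has_dderiv (fun=> c) x h 0.
Proof.
rewrite /has_dderiv (_ : diff_quot _ x h = fun=> 0); first exact: cvg_cst.
by apply/funext => t; rewrite /diff_quot subrr scaler0.
Qed.

Lemma Ck_cst k E F (U T : set E) (c : F) : Ck k U T (fun=> c).
Proof.
elim: k E F U T c => [|k IH] E F U T c /=.
  by split=> //; apply: continuous_subspaceT => x; exact: cvg_cst.
split; first by apply: continuous_subspaceT => x; exact: cvg_cst.
split; first by move=> x h _ _; exists 0; exact: has_dderiv_cst.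
have -> : (fun z : E * E => dderiv (fun=> c) z.1 z.2) = fun=> 0 by
  apply/funext => z; apply: dderivE; exact: has_dderiv_cst.
exact: IH.
Qed.

Lemma within_continuous_pair E F G (U : set E) (f : E -> F) (g : E -> G) :
  {within U, continuous f} -> {within U, continuous g} ->
  {within U, continuous (fun x => (f x, g x))}.
Proof.
move=> /subspace_continuousP cf /subspace_continuousP cg.
apply/subspace_continuousP => x Ux.
by apply: cvg_pair; [exact: cf|exact: cg].
Qed.

Lemma has_dderiv_pair E F G (f : E -> F) (g : E -> G) x h d d' :
  has_dderiv f x h d -> has_dderiv g x h d' ->
  has_dderiv (fun y => (f y, g y)) x h (d, d').
Proof. by move=> fd gd; exact: (cvg_pair fd gd). Qed.

Lemma Ck_pair k E F G (U T : set E) (f : E -> F) (g : E -> G) :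
  admissible U T -> Ck k U T f -> Ck k U T g -> Ck k U T (fun x => (f x, g x)).
Proof.
elim: k E F G U T f g => [|k IH] E F G U T f g aU /= [cf df] [cg dg].
  by split=> //; exact: within_continuous_pair.
case: df dg => [df Cdf] [dg Cdg].
split; first exact: within_continuous_pair.
split.
  move=> x h Ux Th; have [d fd] := df x h Ux Th; have [d' gd] := dg x h Ux Th.
  by exists (d, d'); exact: has_dderiv_pair.
have aUT := adm_prod aU (adm_tangent aU).
apply: (eq_Ck aUT _ (IH _ _ _ _ _ _ _ aUT Cdf Cdg)) => z [Uz Tz] /=.
apply/esym/dderivE/has_dderiv_pair; apply: dderivP; [exact: df|exact: dg].
Qed.

Lemma within_continuous_comp E F G (U : set E) (V : set F) (f : E -> F) (g : F -> G) :
  (forall x, U x -> V (f x)) ->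
  {within U, continuous f} -> {within V, continuous g} ->
  {within U, continuous (g \o f)}.
Proof.
move=> UV /subspace_continuousP cf cg; apply/subspace_continuousP => x Ux.
have cfx : f y @[y --> within U (nbhs x)] --> f x := cf x Ux.
have Vf : \forall y \near within U (nbhs x), V (f y).
  by rewrite near_withinE; apply: (@nearW _ (nbhs x)).
have HH := @within_cvg _ _ V g cg E (within U (nbhs x)) f (f x) _ (UV _ Ux) cfx Vf.
exact: HH.
Qed.

(** The derivative of g \o f is the derivative of g composed with
    (x, h) |-> (f x, dderiv f x h), so the induction on k is over all spaces and
    maps at once. *)
Lemma Ck_comp k E F G (U T : set E) (V S : set F) (f : E -> F) (g : F -> G) :
  admissible U T -> admissible V S -> (forall x, U x -> V (f x)) ->
  Ck k U T f -> Ck k V S g -> Ck k U T (g \o f).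
Proof.
elim: k E F G U T V S f g => [|k IH] E F G U T V S f g aU aV UV Cf Cg.
  case: Cf Cg => [cf _] [cg _]; split=> //.
  exact: within_continuous_comp cf cg.
have Cf1 := Ck_Ck1 Cf; have Cg1 := Ck_Ck1 Cg.
case: (Cf) (Cg) => [cf [df Cdf]] [cg [dg Cdg]]; split.
  exact: within_continuous_comp cf cg.
have dcomp x h : U x -> T h ->
    has_dderiv (g \o f) x h (dderiv g (f x) (dderiv f x h)).
  move=> Ux Th; apply: (has_dderiv_comp aU aV UV Cg1 Ux Th).
  exact: Ck1_has_dderiv Cf1 Ux Th.
split; first by move=> x h Ux Th; eexists; exact: dcomp.
have aUT := adm_prod aU (adm_tangent aU).
have aVS := adm_prod aV (adm_tangent aV).
pose p (z : E * E) := (f z.1, dderiv f z.1 z.2).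
have Cp : Ck k (U `*` T) (T `*` T) p.
  apply: Ck_pair => //.
  apply: (IH _ _ _ _ _ U T fst f aUT aU) => //; first by move=> z [].
    by apply: Ck_clinear; exact: clinear_fst.
  exact: Ck_pred.
have pVS z : (U `*` T) z -> (V `*` S) (p z).
  move=> [Uz Tz]; split; first exact: UV.
  exact: (has_dderiv_in aU aV UV Uz Tz (Ck1_has_dderiv Cf1 Uz Tz)).
apply: (eq_Ck aUT _ (IH _ _ _ _ _ _ _ _ _ aUT aVS pVS Cp Cdg)) => z [Uz Tz].
by apply/esym/dderivE; exact: dcomp.
Qed.

Record cbilinear E F G (B : E -> F -> G) : Prop := CBilinear {
  cbil_l : forall (c : R) x y z, B (c *: x + y) z = c *: B x z + B y z;
  cbil_r : forall (c : R) x y z, B z (c *: x + y) = c *: B z x + B z y;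
  cbil_continuous : continuous (fun z : E * F => B z.1 z.2)
}.

Lemma cbilinear_has_dderiv E F G (B : E -> F -> G) (z h : E * F) :
  cbilinear B -> has_dderiv (fun z => B z.1 z.2) z h (B h.1 z.2 + B z.1 h.2).
Proof.
move=> bB; have B0 y : B 0 y = 0.
  have := cbil_l bB (-1) 0 0 y.
  by rewrite scaler0 addr0 scaleN1r addNr.
have : B h.1 z.2 + B z.1 h.2 + t *: B h.1 h.2 @[t --> (0 : R)^']
    --> B h.1 z.2 + B z.1 h.2 + 0 *: B h.1 h.2.
  apply: lcs_cvgD; first exact: cvg_cst.
  by apply: lcs_cvgZ; [exact: cvg_id0|exact: cvg_cst].
rewrite scale0r addr0; apply: cvg_trans; apply: near_eq_cvg.
near=> t; have t0 : t != 0 by near: t; exact: nbhs_dnbhs_neq.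
rewrite /diff_quot /= [z.1 + _]addrC [z.2 + _]addrC (cbil_l bB) !(cbil_r bB).
rewrite addrA addrK -scalerDr scalerA mulVf// scale1r.
by rewrite [LHS]addrC addrA.
Unshelve. all: by end_near. Qed.

(** The derivative of B at z along h is B h.1 z.2 + B z.1 h.2, which is B again
    between linear maps; this closes the induction. *)
Lemma Ck_cbilinear k E F G (B : E -> F -> G) : cbilinear B ->
  Ck k setT setT (fun z : E * F => B z.1 z.2).
Proof.
move=> bB; elim: k => [|k IH] /=.
  by split=> //; apply: continuous_subspaceT; exact: (cbil_continuous bB).
split; first by apply: continuous_subspaceT; exact: (cbil_continuous bB).
split; first by move=> z h _ _; eexists; exact: cbilinear_has_dderiv.
have -> : (fun z : (E * F) * (E * F) => dderiv (fun z => B z.1 z.2) z.1 z.2) =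
    (fun z : G * G => z.1 + z.2) \o (fun z => (B z.2.1 z.1.2, B z.1.1 z.2.2)).
  by apply/funext => z; apply: dderivE; exact: cbilinear_has_dderiv.
have aT E' := @adm_setT E'.
have aTT : admissible ([set: E * F] `*` [set: E * F]) ([set: E * F] `*` [set: E * F]).
  exact: adm_prod.
apply: (Ck_comp aTT (aT (G * G)%type)) => //; last first.
  by apply: Ck_clinear; exact: clinear_add.
apply: Ck_pair => //.
  apply: (Ck_comp (f := fun z : (E * F) * (E * F) => (z.2.1, z.1.2)) aTT (aT _) _ _ IH) => //.
  apply: Ck_clinear; split=> // z; apply: cvg_pair.
    by apply: cvg_comp; [exact: cvg_snd|exact: cvg_fst].
  by apply: cvg_comp; [exact: cvg_fst|exact: cvg_snd].
apply: (Ck_comp (f := fun z : (E * F) * (E * F) => (z.1.1, z.2.2)) aTT (aT _) _ _ IH) => //.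
apply: Ck_clinear; split=> // z; apply: cvg_pair.
  by apply: cvg_comp; [exact: cvg_fst|exact: cvg_fst].
by apply: cvg_comp; [exact: cvg_snd|exact: cvg_snd].
Qed.

End Calculus.

(** * Smooth functions on an open subset of R^n and convergence of their derivatives *)

Section SmoothFunctions.
Variables (R : realType) (n : nat) (U : set 'rV[R]_n).
Hypothesis U_open : open U.
Implicit Types f g : 'rV[R]_n -> R.

Lemma partials_rcons (s : seq 'I_n) (i : 'I_n) f :
  partials (rcons s i) f = partials s (partial i f).
Proof. by rewrite /partials foldr_rcons. Qed.

Lemma near_open (P : 'rV[R]_n -> Prop) x : U x -> (forall y, U y -> P y) ->
  \forall y \near x, P y.
Proof. by move=> Ux UP; apply: filterS (open_nbhs_nbhs (conj U_open Ux)). Qed.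

Lemma eq_partial (i : 'I_n) f g : (forall x, U x -> f x = g x) ->
  forall x, U x -> partial i f x = partial i g x.
Proof.
by move=> fg x Ux; rewrite /partial; apply: near_eq_derive; exact: near_open.
Qed.

Definition smooth1 f := forall x, U x ->
  {for x, continuous f} /\ forall i, derivable f x (delta_mx ord0 i).

(** Finite-order form of [smooth_on]. The derivative of a product involves the
    factors as well as their derivatives, so closure under products goes by
    induction on the order rather than on the sequence of partial derivatives. *)
Fixpoint smoothk (k : nat) f : Prop :=
  smooth1 f /\ if k is k'.+1 then forall i, smoothk k' (partial i f) else True.

Lemma smooth_onP f : smooth_on U f <-> forall k, smoothk k f.
Proof.
split=> [fU k|fU s].
  elim: k f fU => [|k IH] f fU /=; split=> //; try exact: (fU [::]).
  by move=> i; apply: IH => s x Ux; rewrite -partials_rcons; exact: fU.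
elim/last_ind: s f fU => [|s i IH] f fU x Ux; first exact: (fU 0%N).1.
by rewrite partials_rcons; apply: IH => // k; exact: (fU k.+1).2.
Qed.

Lemma smooth_on_partial f i : smooth_on U f -> smooth_on U (partial i f).
Proof. by move=> /smooth_onP fU; apply/smooth_onP => k; exact: (fU k.+1).2. Qed.

Lemma smooth_on_smooth1 f : smooth_on U f -> smooth1 f.
Proof. by move=> /smooth_onP /(_ 0%N) []. Qed.

Lemma eq_smooth1 f g : (forall x, U x -> f x = g x) -> smooth1 f -> smooth1 g.
Proof.
move=> fg fU x Ux; have [cf df] := fU x Ux.
have nfg : {near x, f =1 g} by exact: near_open.
split=> [|i]; last exact: near_eq_derivable (df i).
by apply: cvg_trans (near_eq_cvg nfg) _; rewrite -fg.
Qed.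

Lemma eq_smoothk k f g : (forall x, U x -> f x = g x) -> smoothk k f -> smoothk k g.
Proof.
elim: k f g => [|k IH] f g fg /= [f1 fk]; split=> //; try exact: eq_smooth1 f1.
by move=> i; apply: IH (fk i); exact: eq_partial.
Qed.

Lemma eq_smooth_on f g : (forall x, U x -> f x = g x) -> smooth_on U f -> smooth_on U g.
Proof. by move=> fg /smooth_onP fU; apply/smooth_onP => k; exact: eq_smoothk (fU k). Qed.

Lemma smoothk_pred k f : smoothk k.+1 f -> smoothk k f.
Proof.
elim: k f => [|k IH] f /= [f1 fk]; split=> //.
by move=> i; apply: IH; exact: fk.
Qed.

Lemma smooth1D f g : smooth1 f -> smooth1 g -> smooth1 (fun x => f x + g x).
Proof.
move=> fU gU x Ux; have [cf df] := fU x Ux; have [cg dg] := gU x Ux.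
by split=> [|i]; [exact: (cvgD cf cg)|exact: (derivableD (df i) (dg i))].
Qed.

Lemma partialD f g i : smooth1 f -> smooth1 g -> forall x, U x ->
  partial i (fun x => f x + g x) x = partial i f x + partial i g x.
Proof.
move=> fU gU x Ux; have [_ df] := fU x Ux; have [_ dg] := gU x Ux.
exact: (deriveD (df i) (dg i)).
Qed.

Lemma smooth1M f g : smooth1 f -> smooth1 g -> smooth1 (fun x => f x * g x).
Proof.
move=> fU gU x Ux; have [cf df] := fU x Ux; have [cg dg] := gU x Ux.
by split=> [|i]; [exact: (cvgM cf cg)|exact: (derivableM (df i) (dg i))].
Qed.

Lemma partialM f g i : smooth1 f -> smooth1 g -> forall x, U x ->
  partial i (fun x => f x * g x) x = f x * partial i g x + g x * partial i f x.
Proof.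
move=> fU gU x Ux; have [_ df] := fU x Ux; have [_ dg] := gU x Ux.
exact: (deriveM (df i) (dg i)).
Qed.

Lemma smooth1V f : (forall x, U x -> f x != 0) -> smooth1 f ->
  smooth1 (fun x => (f x)^-1).
Proof.
move=> f0 fU x Ux; have [cf df] := fU x Ux.
by split=> [|i]; [exact: (cvgV (f0 x Ux) cf)|exact: (derivableV (f0 x Ux) (df i))].
Qed.

(** Written with products only, for the closure under products to give the closure
    under inverses. *)
Lemma partialV f i : (forall x, U x -> f x != 0) -> smooth1 f -> forall x, U x ->
  partial i (fun x => (f x)^-1) x = - 1 * ((f x)^-1 * ((f x)^-1 * partial i f x)).
Proof.
move=> f0 fU x Ux; have [_ df] := fU x Ux; rewrite [LHS](deriveV (f0 x Ux) (df i)).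
by rewrite mulN1r mulrA -invfM -expr2 -scaleNr.
Qed.

Lemma smoothk_cst k (c : R) : smoothk k (fun=> c).
Proof.
apply: (@eq_smoothk k (c \*: (fun=> 1))) => [x _ /=|]; first exact: mulr1.
elim: k c => [|k IH] c /=.
  split=> // x Ux; split=> [|i]; last exact: derivable_cst.
  exact: cst_continuous.
split=> [x Ux|i].
  by split=> [|i]; [exact: cst_continuous|exact: derivable_cst].
apply: (eq_smoothk _ (IH 0)) => x Ux /=; rewrite scale0r /partial.
by rewrite derive_cst.
Qed.

Lemma smoothkD k f g : smoothk k f -> smoothk k g -> smoothk k (fun x => f x + g x).
Proof.
elim: k f g => [|k IH] f g /= [f1 fk] [g1 gk]; split=> //; try exact: smooth1D.
move=> i; apply: (eq_smoothk _ (IH _ _ (fk i) (gk i))) => x Ux.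
by rewrite partialD.
Qed.

Lemma smoothkM k f g : smoothk k f -> smoothk k g -> smoothk k (fun x => f x * g x).
Proof.
elim: k f g => [|k IH] f g fU gU; first by case: fU gU => [? _] [? _]; split; [exact: smooth1M|].
case: (fU) (gU) => [f1 fk] [g1 gk]; split; first exact: smooth1M.
move=> i; have fg' := smoothkD (IH _ _ (smoothk_pred fU) (gk i)) (IH _ _ (smoothk_pred gU) (fk i)).
by apply: (eq_smoothk _ fg') => x Ux; rewrite partialM.
Qed.

Lemma smoothkV k f : (forall x, U x -> f x != 0) ->
  smoothk k f -> smoothk k (fun x => (f x)^-1).
Proof.
move=> f0; elim: k => [|k IH] fU; first by case: fU => [? _]; split; [exact: smooth1V|].
case: (fU) => [f1 fk]; split; first exact: smooth1V.
move=> i; have fV := IH (smoothk_pred fU).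
apply: (eq_smoothk _ (smoothkM (smoothk_cst k (-1)) (smoothkM fV (smoothkM fV (fk i))))).
by move=> x Ux; rewrite partialV.
Qed.

Lemma smooth_onM f g : smooth_on U f -> smooth_on U g ->
  smooth_on U (fun x => f x * g x).
Proof.
by move=> /smooth_onP fU /smooth_onP gU; apply/smooth_onP => k; exact: smoothkM.
Qed.

Lemma smooth_onV f : (forall x, U x -> f x != 0) -> smooth_on U f ->
  smooth_on U (fun x => (f x)^-1).
Proof. by move=> f0 /smooth_onP fU; apply/smooth_onP => k; exact: smoothkV. Qed.

Section UniformConvergence.
Variable K : set 'rV[R]_n.
Hypotheses (K_compact : compact K) (KU : K `<=` U).
Variables (I : Type) (H : set_system I).
Context {FH : Filter H}.
Implicit Types u v : I -> 'rV[R]_n -> R.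

Definition ucvg u f := forall e : R, 0 < e ->
  \forall t \near H, forall x, K x -> `|u t x - f x| <= e.

(** Uniform convergence on K of the derivatives up to order k, with the recursion of
    [smoothk]. *)
Fixpoint ucvgk (k : nat) u f : Prop :=
  ucvg u f /\
  if k is k'.+1 then forall i, ucvgk k' (fun t => partial i (u t)) (partial i f)
  else True.

Lemma ucvgkP u f :
  (forall s, ucvg (fun t => partials s (u t)) (partials s f)) <->
  forall k, ucvgk k u f.
Proof.
split=> [uf k|uf s].
  elim: k u f uf => [|k IH] u f uf /=; split=> //; try exact: (uf [::]).
  move=> i; apply: IH => s; have := uf (rcons s i); rewrite partials_rcons.
  by move=> + e e0 => /(_ e e0); apply: filterS => t; rewrite partials_rcons.
elim/last_ind: s u f uf => [|s i IH] u f uf; first exact: (uf 0%N).1.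
move=> e e0; rewrite partials_rcons.
have /IH/(_ e e0) : forall k, ucvgk k (fun t => partial i (u t)) (partial i f).
  by move=> k; exact: (uf k.+1).2.
by apply: filterS => t; rewrite partials_rcons.
Qed.

Lemma eq_ucvg u v f g : (\forall t \near H, forall x, U x -> u t x = v t x) ->
  (forall x, U x -> f x = g x) -> ucvg u f -> ucvg v g.
Proof.
move=> uv fg uf e e0; apply: filterS2 uv (uf e e0) => t uvt ut x Kx.
by rewrite -uvt -?fg; [exact: ut|exact: KU|exact: KU].
Qed.

Lemma eq_ucvgk k u v f g : (\forall t \near H, forall x, U x -> u t x = v t x) ->
  (forall x, U x -> f x = g x) -> ucvgk k u f -> ucvgk k v g.
Proof.
elim: k u v f g => [|k IH] u v f g uv fg /= [uf ufk]; split=> //; try exact: eq_ucvg uf.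
move=> i; apply: IH (ufk i); last exact: eq_partial.
by apply: filterS uv => t uvt; exact: eq_partial.
Qed.

Lemma ucvgk_pred k u f : ucvgk k.+1 u f -> ucvgk k u f.
Proof.
elim: k u f => [|k IH] u f /= [uf ufk]; split=> //.
by move=> i; apply: IH; exact: ufk.
Qed.

Lemma smooth1_bounded f : smooth1 f -> exists2 C : R, 0 < C & forall x, K x -> `|f x| <= C.
Proof.
move=> fU; have cf : {within K, continuous (fun x => `|f x|)}.
  apply: continuous_in_subspaceT => x /[!inE] Kx.
  apply: (@continuous_comp _ _ _ f (fun y : R => `|y|)); last exact: norm_continuous.
  exact: (fU x (KU Kx)).1.
have [[x0 Kx0]|K0] := pselect (K !=set0); last first.
  by exists 1 => // x Kx; case: K0; exists x.
have [c cK fc] := @compact_EVT_max _ R _ K (ex_intro _ x0 Kx0) K_compact cf.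
exists (`|f c| + 1); first by rewrite ltr_wpDl.
by move=> x Kx; rewrite (le_trans (fc x _)) ?inE// lerDl.
Qed.

Lemma smooth1_lbounded f : smooth1 f -> (forall x, U x -> f x != 0) ->
  exists2 d : R, 0 < d & forall x, K x -> d <= `|f x|.
Proof.
move=> fU f0; have [C C0 HC] := smooth1_bounded (smooth1V f0 fU).
exists C^-1; first by rewrite invr_gt0.
move=> x Kx; have fx0 : 0 < `|f x| by rewrite normr_gt0 f0//; exact: KU.
by rewrite -[leRHS]invrK lef_pV2 ?posrE ?invr_gt0// -normfV HC.
Qed.

Lemma ucvg_cst f : ucvg (fun=> f) f.
Proof. by move=> e e0; apply: nearW => t x _; rewrite subrr normr0 ltW. Qed.

Lemma ucvgD u v f g : ucvg u f -> ucvg v g ->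
  ucvg (fun t x => u t x + v t x) (fun x => f x + g x).
Proof.
move=> uf vg e e0; have e20 : 0 < e / 2 by rewrite divr_gt0.
apply: filterS2 (uf _ e20) (vg _ e20) => t ut vt x Kx.
rewrite opprD addrACA (le_trans (ler_normD _ _))// [leRHS]splitr.
by rewrite lerD ?ut ?vt.
Qed.

Lemma ucvgM u v f g : smooth1 f -> smooth1 g -> ucvg u f -> ucvg v g ->
  ucvg (fun t x => u t x * v t x) (fun x => f x * g x).
Proof.
move=> fU gU uf vg e e0.
have [C C0 HC] := smooth1_bounded fU; have [D D0 HD] := smooth1_bounded gU.
have S0 : 0 < C + D + 1 by rewrite ltr_wpDl// addr_ge0// ltW.
(* uv - fg = (u - f)(v - g) + f (v - g) + (u - f) g, and d <= 1 bounds the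
   quadratic term by d. *)
pose d := Num.min 1 (e / (C + D + 1)).
have d0 : 0 < d by rewrite lt_min ltr01 divr_gt0.
apply: filterS2 (uf _ d0) (vg _ d0) => t ut vt x Kx.
have -> : u t x * v t x - f x * g x =
    (u t x - f x) * (v t x - g x) + f x * (v t x - g x) + (u t x - f x) * g x.
  by ring.
have [du dv] := (ut x Kx, vt x Kx).
rewrite (@le_trans _ _ (1 * d + C * d + d * D))//.
  rewrite (le_trans (ler_normD _ _))// lerD//.
    rewrite (le_trans (ler_normD _ _))// lerD// normrM ler_pM ?HC//.
    by rewrite (le_trans du)// ge_min lexx.
  by rewrite normrM ler_pM// HD.
have -> : 1 * d + C * d + d * D = (C + D + 1) * d by ring.
by rewrite mulrC -ler_pdivlMr// ge_min lexx orbT.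
Qed.

Lemma ucvgV u f : (forall x, U x -> f x != 0) -> smooth1 f -> ucvg u f ->
  ucvg (fun t x => (u t x)^-1) (fun x => (f x)^-1).
Proof.
move=> f0 fU uf e e0; have [d d0 Hd] := smooth1_lbounded fU f0.
(* d / 2 keeps |u| above d / 2; the other bound makes |f - u| / |f u| <= e. *)
pose b := Num.min (d / 2) (e * (d * (d / 2))).
have b0 : 0 < b by rewrite lt_min !mulr_gt0 ?divr_gt0.
apply: filterS (uf _ b0) => t ut x Kx; have du := ut x Kx.
have fx0 : f x != 0 by apply: f0; exact: KU.
have dx := Hd x Kx.
have dx2 : d / 2 <= `|u t x|.
  rewrite -(lerD2r (b)).
  rewrite (@le_trans _ _ d)//.
    by rewrite [leRHS]splitr lerD2l ge_min lexx.
  rewrite (le_trans dx)// -lerBlDl (le_trans (lerB_dist _ _))// distrC//.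
have ux0 : u t x != 0.
  by rewrite -normr_gt0 (lt_le_trans _ dx2)// divr_gt0.
have -> : (u t x)^-1 - (f x)^-1 = (f x - u t x) / (f x * u t x).
  by field; rewrite ?ux0 ?fx0.
rewrite normrM normfV ler_pdivrMr ?normr_gt0 ?mulf_neq0// distrC (le_trans du)//.
rewrite /b ge_min; apply/orP; right.
by rewrite ler_wpM2l ?(ltW e0)// normrM ler_pM ?divr_ge0// ltW.
Qed.

Lemma ucvgkD k u v f g :
  (\forall t \near H, smoothk k (u t)) -> (\forall t \near H, smoothk k (v t)) ->
  smoothk k f -> smoothk k g ->
  ucvgk k u f -> ucvgk k v g ->
  ucvgk k (fun t x => u t x + v t x) (fun x => f x + g x).
Proof.
elim: k u v f g => [|k IH] u v f g us vs /= [f1 fk] [g1 gk] [uf ufk] [vg vgk];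
  split=> //; try exact: ucvgD.
move=> i; apply: (@eq_ucvgk k (fun t x => partial i (u t) x + partial i (v t) x)
  _ (fun x => partial i f x + partial i g x)).
- apply: filterS2 us vs => t [u1 _] [v1 _] x Ux; by rewrite partialD.
- by move=> x Ux; rewrite partialD.
- apply: IH => //.
  + by apply: filterS us => t [_]; exact.
  + by apply: filterS vs => t [_]; exact.
Qed.

Lemma ucvgkM k u v f g :
  (\forall t \near H, smoothk k (u t)) -> (\forall t \near H, smoothk k (v t)) ->
  smoothk k f -> smoothk k g ->
  ucvgk k u f -> ucvgk k v g ->
  ucvgk k (fun t x => u t x * v t x) (fun x => f x * g x).
Proof.
elim: k u v f g => [|k IH] u v f g us vs fs gs uc vc.
  by case: fs gs uc vc => [? _] [? _] [? _] [? _]; split; [exact: ucvgM|].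
case: (fs) (gs) (uc) (vc) => [f1 fk] [g1 gk] [uf ufk] [vg vgk].
have us' : \forall t \near H, smoothk k (u t) by apply: filterS us => t /smoothk_pred.
have vs' : \forall t \near H, smoothk k (v t) by apply: filterS vs => t /smoothk_pred.
have pus i : \forall t \near H, smoothk k (partial i (u t)) by apply: filterS us => t [_]; exact.
have pvs i : \forall t \near H, smoothk k (partial i (v t)) by apply: filterS vs => t [_]; exact.
split; first exact: ucvgM.
move=> i; apply: (@eq_ucvgk k (fun t x => u t x * partial i (v t) x + v t x * partial i (u t) x)
  _ (fun x => f x * partial i g x + g x * partial i f x)).
- by apply: filterS2 us vs => t [u1 _] [v1 _] x Ux; rewrite partialM.
- by move=> x Ux; rewrite partialM.
apply: ucvgkD.
- by apply: filterS2 us' (pvs i) => t; exact: smoothkM.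
- by apply: filterS2 vs' (pus i) => t; exact: smoothkM.
- exact: smoothkM (smoothk_pred fs) (gk i).
- exact: smoothkM (smoothk_pred gs) (fk i).
- exact: IH us' (pvs i) (smoothk_pred fs) (gk i) (ucvgk_pred uc) (vgk i).
- exact: IH vs' (pus i) (smoothk_pred gs) (fk i) (ucvgk_pred vc) (ufk i).
Qed.

Lemma ucvgk_cst k f : ucvgk k (fun=> f) f.
Proof. by elim: k f => [|k IH] f /=; split=> //; exact: ucvg_cst. Qed.

Lemma ucvgkV k u f : (forall x, U x -> f x != 0) ->
  (\forall t \near H, forall x, U x -> u t x != 0) ->
  (\forall t \near H, smoothk k (u t)) -> smoothk k f -> ucvgk k u f ->
  ucvgk k (fun t x => (u t x)^-1) (fun x => (f x)^-1).
Proof.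
move=> f0 u0; elim: k => [|k IH] us fs uc.
  by case: fs uc => [? _] [? _]; split; [exact: ucvgV|].
case: (fs) (uc) => [f1 fk] [uf ufk].
have us' : \forall t \near H, smoothk k (u t) by apply: filterS us => t /smoothk_pred.
have pus i : \forall t \near H, smoothk k (partial i (u t)) by apply: filterS us => t [_]; exact.
have fs' := smoothk_pred fs.
have uc' := IH us' fs' (ucvgk_pred uc).
have uV : \forall t \near H, smoothk k (fun x => (u t x)^-1).
  by apply: filterS2 u0 us' => t; exact: smoothkV.
have fV := smoothkV f0 fs'.
split; first exact: ucvgV.
move=> i; apply: (@eq_ucvgk k
    (fun t x => - 1 * ((u t x)^-1 * ((u t x)^-1 * partial i (u t) x)))
  _ (fun x => - 1 * ((f x)^-1 * ((f x)^-1 * partial i f x)))).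
- by apply: filterS2 u0 us => t ut0 [u1 _] x Ux; rewrite partialV.
- by move=> x Ux; rewrite partialV.
have uVp : \forall t \near H, smoothk k (fun x => (u t x)^-1 * partial i (u t) x).
  by apply: filterS2 uV (pus i) => t; exact: smoothkM.
apply: ucvgkM.
- by apply: nearW => t; exact: smoothk_cst.
- by apply: filterS2 uV uVp => t; exact: smoothkM.
- exact: smoothk_cst.
- exact: smoothkM fV (smoothkM fV (fk i)).
- exact: ucvgk_cst.
exact: ucvgkM uV uVp fV (smoothkM fV (fk i)) uc'
  (ucvgkM uV (pus i) fV (fk i) uc' (ufk i)).
Qed.

End UniformConvergence.
End SmoothFunctions.

(** * The Frechet space of forms of top degree *)

Lemma cvg_initial (S : choiceType) (T : topologicalType) (f : S -> T)
    (G : set_system S) (x : S) : Filter G ->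
  G --> (x : initial_topology f) <-> f @ G --> f x.
Proof.
move=> FG; split=> [Gx|Gfx].
  by move=> A /(@initial_continuous S T f x) /Gx.
move=> A; rewrite nbhsE => -[_ [[B oB <-] Bx] BA].
apply: filterS BA _; apply: Gfx; exact: open_nbhs_nbhs.
Qed.

Lemma cvg_prod_topology (I : Type) (T : I -> topologicalType)
    (G : set_system (forall i, T i)) (x : forall i, T i) : Filter G ->
  G --> (x : prod_topology T) <-> forall i, (fun f => f i) @ G --> x i.
Proof.
by move=> FG; split=> [/cvg_sup Gx i|Gx];
  [apply/cvg_initial; exact: Gx|apply/cvg_sup => i; apply/cvg_initial; exact: Gx].
Qed.

Lemma uniform_cvgrP (R : realType) (X : choiceType) (A : set X) (G : set_system (X -> R))
    (f : X -> R) : Filter G ->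
  {uniform A, G --> f} <-> forall e : R, 0 < e ->
    \forall g \near G, forall x, A x -> `|g x - f x| <= e.
Proof.
move=> FG; split=> [Gf e e0|Gf].
  have : nbhs (f : {uniform` A -> R}) [set h | forall y, A y -> ball (f y) e (h y)].
    apply/uniform_nbhs; exists [set z : R * R | ball z.1 e z.2]; split=> //.
    rewrite -entourage_ballE; by exists e.
  move=> /Gf; apply: filterS => g gf x Ax.
  by rewrite distrC ltW//; exact: gf.
move=> B /uniform_nbhs [E [entE EB]].
move: entE; rewrite -entourage_ballE => -[e /= e0 eE].
have e20 : 0 < e / 2 by rewrite divr_gt0.
apply: filterS (Gf _ e20) => g gf; apply: EB => x Ax; apply: eE => /=.
rewrite /ball/= distrC (le_lt_trans (gf x Ax))//.
by rewrite ltr_pdivrMr// ltr_pMr// ltr1n.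
Qed.

Section Forms.
Variables (R : realType) (n : nat) (M : closedOrientedManifold R n).
Implicit Types (a b mu : nform M) (i : Defs.index M) (p : M).

Notation img i := (@phi _ _ M i @` dom i).
Definition loc a i : 'rV[R]_n -> R := a i \o phinv i.

Lemma phinv_dom i x : img i x -> dom i (phinv i x).
Proof. by move=> [p pi <-]; rewrite phiK. Qed.

Lemma phi_phinv i x : img i x -> phi i (phinv i x) = x.
Proof. by move=> [p pi <-]; rewrite phiK. Qed.

Lemma formP a : is_nform (a : Defs.index M -> M -> R).
Proof. by have /asboolP := coefP a. Qed.

Lemma form_smooth a i : smooth_on (img i) (loc a i).
Proof. by have [+ _ _] := formP a; apply. Qed.

Lemma form_trans a i j p : dom i p -> dom j p ->
  a i p = a j p * \det (jac_mx (phi j \o phinv i) (phi i p)).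
Proof. by have [_ + _] := formP a; exact. Qed.

Lemma form_off a i p : ~ dom i p -> a i p = 0.
Proof. by have [_ _ +] := formP a; exact. Qed.

Lemma form_eq a b : (forall i p, dom i p -> a i p = b i p) -> a = b.
Proof.
move=> ab; apply/val_inj/funext => i; apply/funext => p.
have [pi|pi] := pselect (dom i p); first exact: ab.
by rewrite /= !form_off.
Qed.

Lemma nformD a b i p : (a + b) i p = a i p + b i p.
Proof. by []. Qed.

Lemma nformZ c a i p : (c *: a) i p = c * a i p.
Proof. by []. Qed.

Lemma nformN a i p : (- a) i p = - a i p.
Proof. by rewrite -scaleN1r nformZ mulN1r. Qed.

Lemma nform0 i p : (0 : nform M) i p = 0.
Proof. by []. Qed.

Lemma loc_linear c a b i : loc (c *: a + b) i = c \*: loc a i + loc b i.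
Proof. by []. Qed.

Lemma nform_cvgP (G : set_system (nform M)) a : Filter G ->
  G --> a <-> forall i K, chart_compacts i K -> forall s (e : R), 0 < e ->
    \forall b \near G, forall x, K x ->
      `|partials s (loc b i) x - partials s (loc a i) x| <= e.
Proof.
move=> FG; rewrite (_ : (G --> a) = (G --> (a : initial_topology (@jets R n M))))//.
rewrite cvg_initial cvg_prod_topology; split=> [Ga i K iK s e e0|Ga [i s]].
  have /fam_cvgP/(_ K iK)/uniform_cvgrP/(_ e e0) := Ga (i, s).
  exact.
by apply/fam_cvgP => K iK; apply/uniform_cvgrP => e e0; exact: Ga.
Qed.

Definition form_index : Type := Defs.index M * set 'rV[R]_n * seq 'I_n.

(** Evaluations, at the points of a compact subset of a chart, of one iterated
    derivative of the local coefficient: their supremum is one of the seminorms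
    defining the topology of forms. *)
Definition form_fnls (k : form_index) : set (nform M -> R) :=
  [set l | chart_compacts k.1.1 k.1.2 /\
    exists2 x, k.1.2 x & l = fun a => partials k.2 (loc a k.1.1) x].

Lemma partials_smooth_on (U : set 'rV[R]_n) s (f : 'rV[R]_n -> R) : open U ->
  smooth_on U f -> smooth_on U (partials s f).
Proof.
move=> oU; elim/last_ind: s f => //= s i IH f fU.
by rewrite partials_rcons; apply: IH; exact: smooth_on_partial.
Qed.

Lemma form_fnls_linear k l : form_fnls k l -> forall (c : R) a b,
  l (c *: a + b) = c * l a + l b.
Proof.
case: k => [[i K] s] [[/= Kc KU] [x Kx ->]] c a b /=; rewrite loc_linear.
rewrite (@partials_linear _ _ (img i))//; first exact: phi_open.
- exact: form_smooth.
- exact: form_smooth.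
- exact: KU.
Qed.

Lemma form_fnls_bounded k a : exists C : R, forall l, form_fnls k l -> `|l a| <= C.
Proof.
case: k => [[i K] s]; have [[Kc KU]|nK] := pselect (chart_compacts i K); last first.
  by exists 0 => l [].
have [C _ HC] : exists2 C : R, 0 < C & forall x, K x -> `|partials s (loc a i) x| <= C.
  apply: (@smooth1_bounded _ _ (img i)) => //.
  apply: smooth_on_smooth1; apply: partials_smooth_on; [exact: phi_open|exact: form_smooth].
by exists C => l [_ [x Kx ->]]; exact: HC.
Qed.

Lemma chart_compacts1 i x : img i x -> chart_compacts i [set x].
Proof. by move=> ix; split; [exact: compact_set1|move=> y ->]. Qed.

Lemma form_fnls_separated a : (forall k l, form_fnls k l -> l a = 0) -> a = 0.
Proof.
move=> a0; apply: form_eq => i p pi; rewrite nform0.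
have ipx : img i (phi i p) by exists p.
have := a0 (i, [set phi i p], [::]) _
  (conj (chart_compacts1 ipx) (ex_intro2 _ _ (phi i p) erefl erefl)).
by rewrite /loc/= phiK.
Qed.

Lemma form_fnls_cvg (G : set_system (nform M)) a : Filter G ->
  (G --> a <-> forall k (e : R), 0 < e ->
      \forall b \near G, forall l, form_fnls k l -> `|l (b - a)| <= e).
Proof.
move=> FG; rewrite nform_cvgP; split=> [Ga [[i K] s] e e0|Ga i K iK s e e0].
  have [[Kc KU]|nK] := pselect (chart_compacts i K); last first.
    by apply: nearW => b l [].
  apply: filterS (Ga i K (conj Kc KU) s e e0) => b H l il.
  have [_ [x Kx lE]] := il.
  by rewrite addrC -scaleN1r (form_fnls_linear il) mulN1r addrC lE; exact: H.
apply: filterS (Ga (i, K, s) e e0) => b H x Kx.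
have il : form_fnls (i, K, s) (fun a => partials s (loc a i) x).
  by split=> //; exists x.
have := H _ il.
by rewrite addrC -scaleN1r (form_fnls_linear il) mulN1r addrC.
Qed.

HB.instance Definition _ := hasSeminormingFunctionals.Build R (nform M)
  form_fnls_linear form_fnls_bounded form_fnls_separated form_fnls_cvg.

Lemma nform_ucvgkP T (H : set_system T) (u : T -> nform M) a : Filter H ->
  u @ H --> a <-> forall i K, chart_compacts i K ->
    forall k, ucvgk K H k (fun t => loc (u t) i) (loc a i).
Proof.
move=> FH; rewrite nform_cvgP; split=> [ua i K iK|ua i K iK s e e0].
  by apply/ucvgkP => s e e0; exact: ua.
by have /ucvgkP/(_ s e e0) := ua i K iK.
Qed.

Lemma smooth_fmulE (f : M -> R) a i p : smooth_fun f -> fmul f a i p = f p * a i p.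
Proof.
move=> fs; rewrite /fmul; set w := fun i p => f p * a i p.
have wf : w \in @nform_pred R n M.
  apply/asboolP; split.
  - by move=> j; apply: smooth_onM; [exact: phi_open|exact: fs|exact: form_smooth].
  - by move=> j k q qj qk; rewrite /w (form_trans a qj qk) mulrA.
  - by move=> j q qj; rewrite /w form_off// mulr0.
by rewrite -[LHS]/(val (insubd (0 : nform M) w) i p) insubdK.
Qed.

Lemma Dens_gt0 mu i p : Dens mu -> dom i p -> 0 < mu i p.
Proof. exact. Qed.

Lemma Dens_neq0 mu i p : Dens mu -> dom i p -> mu i p != 0.
Proof. by move=> mu0 pi; rewrite gt_eqF// Dens_gt0. Qed.

Lemma chart_atP p : dom (chart_at p) p.
Proof. by rewrite /chart_at; case: cid. Qed.

(** Both coefficients are multiplied by the same nonzero Jacobian when the chart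
    changes. *)
Lemma RNE a mu i p : Dens mu -> dom i p -> RN a mu p = a i p / mu i p.
Proof.
move=> mu0 pi; have pj := chart_atP p; rewrite /RN.
rewrite (form_trans a pi pj) (form_trans mu pi pj).
have d0 := transition_oriented pi pj.
have := Dens_neq0 mu0 pj; move: d0 => /gt_eqF/negbT; set d := \det _ => d0 m0.
by rewrite invfM mulrACA mulfV// mulr1.
Qed.

Lemma RN_smooth a mu : Dens mu -> smooth_fun (RN a mu).
Proof.
move=> mu0 i; apply: (@eq_smooth_on _ _ _ (@phi_open _ _ M i) (fun x => loc a i x * (loc mu i x)^-1)).
  by move=> x ix; rewrite /= (RNE a mu0 (phinv_dom ix)).
apply: smooth_onM; [exact: phi_open|exact: form_smooth|].
apply: smooth_onV; [exact: phi_open| |exact: form_smooth].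
by move=> x ix; apply: Dens_neq0 => //; exact: phinv_dom.
Qed.

(** For a fixed density mu this is a commutative and associative product on forms,
    with unit mu. The connection and the metrics are all expressed by it, which
    keeps every computation within the vector space of forms. *)
Definition qprod a mu b : nform M := fmul (RN a mu) b.

Lemma qprodE a mu b i p : Dens mu -> dom i p ->
  qprod a mu b i p = a i p / mu i p * b i p.
Proof. by move=> mu0 pi; rewrite smooth_fmulE ?(RNE a mu0 pi)//; exact: RN_smooth. Qed.

Section Algebra.
Variable lambda : nform M.
Hypothesis lambda0 : Dens lambda.

Lemma loc_qprod a b i x : img i x ->
  loc (qprod a lambda b) i x = (loc lambda i x)^-1 * (loc a i x * loc b i x).
Proof.
by move=> ix; rewrite /loc/= qprodE//; [rewrite [RHS]mulrA [_^-1 * _]mulrC|exact: phinv_dom].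
Qed.

Lemma qprod_cvg T (H : set_system T) (u v : T -> nform M) a b : Filter H ->
  u @ H --> a -> v @ H --> b -> qprod (u t) lambda (v t) @[t --> H] --> qprod a lambda b.
Proof.
move=> FH /nform_ucvgkP ua /nform_ucvgkP vb; apply/nform_ucvgkP => i K iK k.
have [Kc KU] := iK; have oU := @phi_open _ _ M i.
have sm c : smoothk (img i) k (loc c i) by have /smooth_onP := @form_smooth c i; exact.
have sV : smoothk (img i) k (fun x => (loc lambda i x)^-1).
  apply: smoothkV => // x ix; apply: Dens_neq0 => //; exact: phinv_dom.
apply: (@eq_ucvgk _ _ (img i) oU K KU _ _ _ k
  (fun t x => (loc lambda i x)^-1 * (loc (u t) i x * loc (v t) i x)) _
  (fun x => (loc lambda i x)^-1 * (loc a i x * loc b i x))).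
- by apply: nearW => t x ix; rewrite loc_qprod.
- by move=> x ix; rewrite loc_qprod.
apply: (@ucvgkM _ _ (img i)) => //.
- exact: nearW.
- by apply: nearW => t; exact: smoothkM.
- exact: smoothkM.
- exact: ucvgk_cst.
apply: (@ucvgkM _ _ (img i)) => //; try exact: nearW.
- exact: ua.
- exact: vb.
Qed.

Lemma qprod_cbilinear : cbilinear (fun a b => qprod a lambda b).
Proof.
split=> [c a b d|c a b d|z].
- by apply: form_eq => i p pi; rewrite nformD nformZ !qprodE// nformD nformZ; ring.
- by apply: form_eq => i p pi; rewrite nformD nformZ !qprodE// nformD nformZ; ring.
- by apply: qprod_cvg; [exact: cvg_fst|exact: cvg_snd].
Qed.

(** The inverse of mu for the product a, b |-> (a / lambda) b of unit lambda. *)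
Definition qinv mu : nform M := qprod lambda mu lambda.

Lemma qinv_cvg T (H : set_system T) (u : T -> nform M) mu : Filter H ->
  Dens mu -> (\forall t \near H, Dens (u t)) -> u @ H --> mu ->
  qinv (u t) @[t --> H] --> qinv mu.
Proof.
move=> FH mu0 u0 /nform_ucvgkP um; apply/nform_ucvgkP => i K iK k.
have [Kc KU] := iK; have oU := @phi_open _ _ M i.
have sm c : smoothk (img i) k (loc c i) by have /smooth_onP := @form_smooth c i; exact.
have nz c : Dens c -> forall x, img i x -> loc c i x != 0.
  by move=> c0 x ix; apply: Dens_neq0 => //; exact: phinv_dom.
have qinvE c : Dens c -> forall x, img i x ->
    (loc lambda i x * loc lambda i x) * (loc c i x)^-1 = loc (qinv c) i x.
  by move=> c0 x ix; rewrite /loc/= qprodE//; [ring|exact: phinv_dom].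
apply: (@eq_ucvgk _ _ (img i) oU K KU _ _ _ k
  (fun t x => (loc lambda i x * loc lambda i x) * (loc (u t) i x)^-1) _
  (fun x => (loc lambda i x * loc lambda i x) * (loc mu i x)^-1)).
- by apply: filterS u0 => t; exact: qinvE.
- exact: qinvE.
have s2 : smoothk (img i) k (fun x => loc lambda i x * loc lambda i x) by exact: smoothkM.
apply: (@ucvgkM _ _ (img i)) => //.
- exact: nearW.
- by apply: filterS u0 => t ut0; apply: smoothkV => //; exact: nz.
- by apply: smoothkV => //; exact: nz.
- exact: ucvgk_cst.
apply: (@ucvgkV _ _ (img i)) => //.
- exact: nz.
- by apply: filterS u0 => t ut0; exact: nz.
- exact: nearW.
- exact: um.
Qed.

(** The nonlinear dependence on mu is concentrated in [qinv]; the rest is a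
    continuous bilinear product relative to the fixed lambda. *)
Lemma qprod_qinv a mu b : Dens mu ->
  qprod a mu b = qprod (qprod a lambda (qinv mu)) lambda b.
Proof.
move=> mu0; apply: form_eq => i p pi; rewrite !qprodE//.
have l0 := Dens_neq0 lambda0 pi; have m0 := Dens_neq0 mu0 pi.
by field; rewrite l0 m0.
Qed.

Definition dqinv mu h : nform M := (- 1) *: qprod (qinv mu) lambda (qprod (qinv mu) lambda h).

Lemma qinv_has_dderiv mu h : Dens mu ->
  (\forall t \near (0 : R)^', Dens (mu + t *: h)) ->
  has_dderiv qinv mu h (dqinv mu h).
Proof.
move=> mu0 muh; rewrite /has_dderiv.
have cv : (- 1) *: qprod (qinv (mu + t *: h)) lambda (qprod (qinv mu) lambda h)
    @[t --> (0 : R)^'] --> dqinv mu h.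
  apply: lcs_cvgZ; first exact: cvg_cst.
  apply: qprod_cvg; last exact: cvg_cst.
  apply: qinv_cvg => //.
  rewrite -[X in _ --> X]addr0 -(scale0r h); apply: lcs_cvgD; first exact: cvg_cst.
  by apply: lcs_cvgZ; [exact: cvg_id0|exact: cvg_cst].
apply: cvg_trans cv; apply: near_eq_cvg; near=> t.
have t0 : t != 0 by near: t; exact: nbhs_dnbhs_neq.
have mt0 : Dens (mu + t *: h) by near: t.
apply: form_eq => i p pi; rewrite /diff_quot !nformZ nformD nformN !qprodE//.
rewrite !nformD !nformZ.
have := Dens_neq0 lambda0 pi; have := Dens_neq0 mu0 pi.
have := Dens_neq0 mt0 pi; rewrite nformD nformZ => ? ? ?.
by field; apply/and4P.
Unshelve. all: by end_near. Qed.

Hypothesis Dens_adm : admissible (@Dens R n M) setT.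

(** The derivative of [qinv] is a polynomial in [qinv] itself, and linear in the
    direction, so that regularity of order k passes to order k + 1. *)
Lemma Ck_qinv k : Ck k (@Dens R n M) setT qinv.
Proof.
have cf : {within @Dens R n M, continuous qinv}.
  apply/subspace_continuousP => mu mu0; apply: qinv_cvg => //.
    by rewrite near_withinE; apply: (@nearW _ (nbhs mu)).
  by apply: cvg_within; exact: cvg_id.
have dfE mu h : Dens mu -> has_dderiv qinv mu h (dqinv mu h).
  by move=> mu0; apply: qinv_has_dderiv => //; exact: (adm_near Dens_adm).
elim: k => [|k IH] /=; split=> //; split.
  by move=> mu h mu0 _; exists (dqinv mu h); exact: dfE.
have aDT := adm_prod Dens_adm (@adm_setT R (nform M)).
have aTT : admissible ([set: nform M] `*` [set: nform M]) ([set: nform M] `*` [set: nform M]).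
  by apply: adm_prod; exact: adm_setT.
have aT := @adm_setT R.
have CB := @Ck_cbilinear R k _ _ _ _ qprod_cbilinear.
have Cf : Ck k (@Dens R n M `*` [set: nform M]) ([set: nform M] `*` setT) (qinv \o fst).
  apply: (Ck_comp aDT Dens_adm) => //; first by move=> z [].
  by apply: Ck_clinear; exact: clinear_fst.
have Cs : Ck k (@Dens R n M `*` [set: nform M]) ([set: nform M] `*` setT) (snd : nform M * nform M -> nform M).
  by apply: Ck_clinear; exact: clinear_snd.
have C1 := Ck_comp aDT (aT _) (fun _ _ => I) (Ck_pair aDT Cf Cs) CB.
have C2 := Ck_comp aDT (aT _) (fun _ _ => I) (Ck_pair aDT Cf C1) CB.
have C3 := Ck_comp aDT (aT _) (fun _ _ => I) C2 (@Ck_clinear _ k _ _ _ _ _ (clinear_scale (nform M) (-1))).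
apply: (eq_Ck aDT _ C3) => -[mu h] [/= mu0 _].
by apply/esym/dderivE; exact: dfE.
Qed.

End Algebra.
End Forms.

(** * Iterated integrals of continuous functions with support in a cube *)

Section LineIntegral.
Variables (R : realType) (B : R).
Hypothesis B0 : 0 <= B.
Local Notation lebesgue := (@lebesgue_measure R).
Implicit Types g h : R -> R.

Definition supp_itv g := continuous g /\ forall t, ~~ (- B <= t <= B) -> g t = 0.

Lemma supp_itv_restrict g : supp_itv g -> g = g \_ `[- B, B].
Proof.
move=> [_ g0]; apply/funext => t; rewrite patchE; case: ifPn => // tB.
by apply: g0; apply: contra tB; rewrite inE/= in_itv.
Qed.

Lemma integrable_patch_itv g a b : {within `[a, b], continuous g} ->
  lebesgue.-integrable setT (EFin \o (g \_ `[a, b])).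
Proof.
move=> cg; have gi := continuous_compact_integrable (@segment_compact R a b) cg.
have -> : EFin \o (g \_ `[a, b]) = (EFin \o g) \_ `[a, b].
  by apply/funext => t; rewrite /= !patchE; case: ifP.
by rewrite -integrable_mkcond.
Qed.

Lemma supp_itv_integrable g : supp_itv g -> lebesgue.-integrable setT (EFin \o g).
Proof.
move=> gB; rewrite (supp_itv_restrict gB); apply: integrable_patch_itv.
by apply: continuous_subspaceT; exact: gB.1.
Qed.

Lemma supp_itv_int_linear c g h : supp_itv g -> supp_itv h ->
  \int[lebesgue]_t (c * g t + h t) = c * \int[lebesgue]_t g t + \int[lebesgue]_t h t.
Proof.
move=> gB hB; have gi := supp_itv_integrable gB; have hi := supp_itv_integrable hB.
rewrite RintegralD//; first by rewrite RintegralZl.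
have := @integrableZl _ _ _ lebesgue _ measurableT c (EFin \o g) gi.
by apply: eq_integrable.
Qed.

Lemma fine_lebesgue_itv (a b : R) : a <= b -> fine (lebesgue `[a, b]) = b - a.
Proof.
move=> ab; rewrite lebesgue_measure_itv/= lte_fin.
by case: ltgtP ab => // -> _; rewrite subrr.
Qed.

Lemma supp_itv_int_bound g C : supp_itv g -> (forall t, `|g t| <= C) ->
  `|\int[lebesgue]_t g t| <= C * (2 * B).
Proof.
move=> gB metricC; rewrite (supp_itv_restrict gB) -Rintegral_mkcond.
have gi : lebesgue.-integrable `[- B, B] (EFin \o g).
  by apply: (integrableS measurableT) => //; exact: supp_itv_integrable.
apply: (le_trans (le_normr_Rintegral _ gi)) => //.
have -> : C * (2 * B) = \int[lebesgue]_(t in `[- B, B]) C.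
  rewrite Rintegral_cst//= fine_lebesgue_itv; first by rewrite opprK mulr2n mulrDl mul1r.
  by rewrite -subr_ge0 opprK addr_ge0.
apply: le_Rintegral => //.
- exact: (integrable_norm gi).
- by apply: continuous_compact_integrable; [exact: segment_compact|
    apply: continuous_subspaceT => t; exact: cvg_cst].
Qed.

Lemma supp_itv_int_gt0 g t0 : supp_itv g -> (forall t, 0 <= g t) -> 0 < g t0 ->
  0 < \int[lebesgue]_t g t.
Proof.
move=> gB g0 gt0; have c0 : 0 < g t0 / 2 by rewrite divr_gt0.
have /cvgrPdist_lt/(_ _ c0)/nbhs_ballP[d /= d0 Hd] : g t @[t --> t0] --> g t0 := gB.1 t0.
pose J := `[t0 - d / 2, t0 + d / 2]%classic : set R.
have gJ : {within J, continuous (fun=> g t0 / 2)}.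
  by apply: continuous_subspaceT => t; exact: cvg_cst.
apply: (@lt_le_trans _ _ (\int[lebesgue]_t ((fun=> g t0 / 2) \_ J) t)).
  rewrite -Rintegral_mkcond Rintegral_cst; last exact: measurable_itv.
  rewrite [fine _]fine_lebesgue_itv.
    by rewrite mulr_gt0// opprD opprK addrACA subrr add0r -splitr.
  by rewrite lerD2l (@le_trans _ _ 0)// ?oppr_le0 divr_ge0// ltW.
apply: le_Rintegral => //.
- exact: integrable_patch_itv.
- exact: supp_itv_integrable.
- move=> t _; rewrite patchE; case: ifPn => // tJ.
  suff /Hd H : ball t0 d t.
    have := ler_norm (g t0 - g t); set x := g t0 in H *; set y := g t in H *.
    by lra.
  have : t \in `[t0 - d / 2, t0 + d / 2] by move: tJ; rewrite inE.
  rewrite in_itv/= => /andP[t1 t2].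
  move: (t : R) t1 t2 => u t1 t2.
  by rewrite /ball/= ltr_distl; apply/andP; split; lra.
Qed.

End LineIntegral.

Section IteratedIntegral.
Variables (R : realType) (B : R).
Hypothesis B0 : 0 <= B.

Definition cube n : set 'rV[R]_n := [set x | forall i, `[- B, B]%classic (x ord0 i)].

Definition supp_cube n (f : 'rV[R]_n -> R) :=
  continuous f /\ forall x, ~ cube x -> f x = 0.

Lemma cube_compact n : compact (@cube n).
Proof. by apply: (@rV_compact R n (fun=> `[- B, B]%classic)) => i; exact: segment_compact. Qed.

Local Notation cons_rV t x := (row_mx ((t : R)%:M : 'rV[R]_1) x).

Lemma cons_rV_cvg n T (H : set_system T) (u : T -> R) (v : T -> 'rV[R]_n) t x :
  Filter H -> u @ H --> t -> v @ H --> x -> cons_rV (u s) (v s) @[s --> H] --> cons_rV t x.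
Proof.
move=> FH /cvg_ballP ut /cvg_ballP vx; apply/cvg_ballP => e e0.
apply: filterS2 (ut e e0) (vx e e0) => s us [_ vs]; split=> // i j.
rewrite !mxE; case: splitP => k _; last by rewrite ord1; exact: vs.
by rewrite !mxE !ord1 eqxx !mulr1n.
Qed.

Lemma cube_cons n t (x : 'rV[R]_n) : cube (cons_rV t x) ->
  (- B <= t <= B) /\ cube x.
Proof.
move=> tx; split.
  have := tx (lshift n ord0); rewrite /= row_mxEl mxE eqxx mulr1n.
  by rewrite in_itv.
by move=> i; have := tx (rshift 1 i); rewrite row_mxEr.
Qed.

Lemma supp_cube_slice n (f : 'rV[R]_n.+1 -> R) t : supp_cube f ->
  supp_cube (fun x : 'rV[R]_n => f (cons_rV t x)).
Proof.
move=> [cf f0]; split=> [x|x nx]; last by apply: f0 => /cube_cons [].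
have H : (fun y => cons_rV t y) @ nbhs x --> cons_rV t x.
  exact: (@cons_rV_cvg _ _ (nbhs x) _ _ _ _ _ (cvg_cst t) cvg_id).
exact: (@cvg_comp _ _ _ (fun x => cons_rV t x) f _ _ _ H (cf _)).
Qed.

Lemma supp_cubeD n c (f g : 'rV[R]_n -> R) : supp_cube f -> supp_cube g ->
  supp_cube (fun x => c * f x + g x).
Proof.
move=> [cf f0] [cg g0]; split=> [x|x nx]; last by rewrite f0// g0// mulr0 addr0.
apply: (cvgD _ (cg x)); apply: (cvgM _ (cf x)); exact: cvg_cst.
Qed.

(** Compactness of the cube makes continuity in the first coordinate uniform in the
    others. *)
Lemma slice_near n (f : 'rV[R]_n.+1 -> R) t0 (e : R) : supp_cube f -> 0 < e ->
  \forall t \near t0, forall x, `|f (cons_rV t x) - f (cons_rV t0 x)| <= e.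
Proof.
move=> [cf f0] e0.
have /compact_near_coveringP nc := @cube_compact n.
have : \forall t \near t0, @cube n `<=`
    [set x | `|f (cons_rV t x) - f (cons_rV t0 x)| <= e].
  apply: (nc R (nbhs t0) (fun t x => `|f (cons_rV t x) - f (cons_rV t0 x)| <= e)) => x _.
  have e20 : 0 < e / 2 by rewrite divr_gt0.
  pose H := filter_prod (nbhs x) (nbhs t0).
  have H1 : (fun z => cons_rV z.2 z.1) @ H --> cons_rV t0 x.
    exact: (@cons_rV_cvg _ _ H _ _ _ _ _ cvg_snd cvg_fst).
  have H2 : (fun z => cons_rV t0 z.1) @ H --> cons_rV t0 x.
    exact: (@cons_rV_cvg _ _ H _ _ _ _ _ (cvg_cst t0) cvg_fst).
  have /cvgrPdist_le/(_ _ e20) near1 := cvg_comp _ _ H1 (cf (cons_rV t0 x)).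
  have /cvgrPdist_le/(_ _ e20) near2 := cvg_comp _ _ H2 (cf (cons_rV t0 x)).
  apply: filterS2 near1 near2 => -[y t] /= d1 d2.
  have -> : f (cons_rV t y) - f (cons_rV t0 y) =
    (f (cons_rV t0 x) - f (cons_rV t0 y)) - (f (cons_rV t0 x) - f (cons_rV t y)) by ring.
  by rewrite (le_trans (ler_normB _ _))// [leRHS]splitr lerD.
apply: filterS => t Ht x; have [/Ht//|nx] := pselect (cube x).
by rewrite !f0 ?subrr ?normr0 ?ltW// => /cube_cons [].
Qed.

Lemma iter_int0 n : iter_int (fun _ : 'rV[R]_n => 0) = 0.
Proof.
by elim: n => //= n ->; rewrite Rintegral_cst// mul0r.
Qed.

Lemma iter_int_ge0 n (f : 'rV[R]_n -> R) : (forall x, 0 <= f x) -> 0 <= iter_int f.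
Proof.
elim: n f => [|n IH] f f0 /=; first exact: f0.
by apply: Rintegral_ge0 => t _; exact: IH.
Qed.

Definition iter_int_slice n (f : 'rV[R]_n.+1 -> R) (t : R) :=
  iter_int (fun x : 'rV[R]_n => f (cons_rV t x)).

(** The inner integral is again a continuous function supported in the interval,
    hence can be integrated. Linearity and the bound are hypotheses because the
    three facts are proved by one induction on the dimension. *)
Lemma iter_int_slice_supp n (f : 'rV[R]_n.+1 -> R) :
  (forall (c : R) (g h : 'rV[R]_n -> R), supp_cube g -> supp_cube h ->
    iter_int (fun x => c * g x + h x) = c * iter_int g + iter_int h) ->
  (forall (g : 'rV[R]_n -> R) (C : R), supp_cube g -> (forall x, `|g x| <= C) ->
    `|iter_int g| <= C * (2 * B) ^+ n) ->
  supp_cube f -> supp_itv B (iter_int_slice f).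
Proof.
move=> lin bnd fB; split=> [t0|t nt]; last first.
  rewrite /iter_int_slice (_ : (fun=> _) = fun=> 0) ?iter_int0//.
  by apply/funext => x; apply: fB.2 => /cube_cons [tB _]; rewrite tB in nt.
apply/cvgrPdist_le => e e0.
pose D := (2 * B) ^+ n + 1.
have D0 : 0 < D by rewrite ltr_wpDl// exprn_ge0// mulr_ge0.
have eD : 0 < e / D by rewrite divr_gt0.
apply: filterS (slice_near t0 fB eD) => t Ht.
have -> : iter_int_slice f t0 - iter_int_slice f t =
    iter_int (fun x : 'rV[R]_n => (- 1) * f (cons_rV t x) + f (cons_rV t0 x)).
  by rewrite lin ?mulN1r 1?addrC//; exact: supp_cube_slice.
apply: le_trans (bnd _ (e / D) _ _) _.
- by apply: supp_cubeD; exact: supp_cube_slice.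
- by move=> x; rewrite mulN1r addrC distrC; exact: Ht.
by rewrite mulrAC ler_pdivrMr// ler_pM2l// lerDl.
Qed.

Lemma iter_int_linear_bound n :
  (forall (c : R) (g h : 'rV[R]_n -> R), supp_cube g -> supp_cube h ->
    iter_int (fun x => c * g x + h x) = c * iter_int g + iter_int h) /\
  (forall (g : 'rV[R]_n -> R) (C : R), supp_cube g -> (forall x, `|g x| <= C) ->
    `|iter_int g| <= C * (2 * B) ^+ n).
Proof.
elim: n => [|n [lin bnd]].
  by split=> // g C _ metricC; rewrite /= expr0 mulr1.
split=> [c g h gB hB|g C gB metricC] /=.
  have -> : (fun t : R => iter_int (fun x : 'rV[R]_n =>
      c * g (cons_rV t x) + h (cons_rV t x))) =
      fun t => c * iter_int_slice g t + iter_int_slice h t.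
    by apply/funext => t; rewrite lin//; exact: supp_cube_slice.
  exact: (@supp_itv_int_linear _ B c _ _ (iter_int_slice_supp lin bnd gB)
    (iter_int_slice_supp lin bnd hB)).
rewrite exprSr mulrA.
apply: (@supp_itv_int_bound _ _ B0 (iter_int_slice g)); first exact: (iter_int_slice_supp lin bnd).
by move=> t; apply: bnd; [exact: supp_cube_slice|move=> x; exact: metricC].
Qed.

Lemma iter_int_linear n c (g h : 'rV[R]_n -> R) : supp_cube g -> supp_cube h ->
  iter_int (fun x => c * g x + h x) = c * iter_int g + iter_int h.
Proof. exact: (iter_int_linear_bound n).1. Qed.

Lemma iter_int_bound n (g : 'rV[R]_n -> R) C : supp_cube g ->
  (forall x, `|g x| <= C) -> `|iter_int g| <= C * (2 * B) ^+ n.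
Proof. exact: (iter_int_linear_bound n).2. Qed.

(** The inner integral is continuous, nonnegative, and positive at the first
    coordinate of x0. *)
Lemma iter_int_gt0 n (f : 'rV[R]_n -> R) x0 : supp_cube f ->
  (forall x, 0 <= f x) -> 0 < f x0 -> 0 < iter_int f.
Proof.
elim: n f x0 => [|n IH] f x0 fB f0 fx0 /=; first by rewrite -(thinmx0 x0).
have [lin bnd] := iter_int_linear_bound n.
pose x1 : 'rV[R]_(1 + n) := x0; pose t0 := lsubmx x1 ord0 ord0.
apply: (@supp_itv_int_gt0 R B (iter_int_slice f) t0 (iter_int_slice_supp lin bnd fB)) => [t|].
  by apply: iter_int_ge0 => x; exact: f0.
apply: (IH _ (rsubmx x1)); first exact: supp_cube_slice.
- by move=> x; exact: f0.
- by rewrite /t0 -mx11_scalar hsubmxK.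
Qed.

End IteratedIntegral.

Lemma compact_sub_cube (R : realType) n (K : set 'rV[R]_n) : compact K ->
  exists2 B : R, 0 <= B & K `<=` @cube R B n.
Proof.
move=> /compact_bounded[N [Nreal KN]]; exists (`|N| + 1); first by rewrite addr_ge0.
move=> x Kx i /=.
have xN : `|x| <= `|N| + 1 by apply: KN => //; rewrite (le_lt_trans (ler_norm _))// ltrDl.
suff : `|x ord0 i : R| <= `|N| + 1 by rewrite ler_norml in_itv.
apply: le_trans xN.
have /mapP[j Hj ->] : `|x ord0 i| \in [seq `|x y.1 y.2| | y : 'I_1 * 'I_n].
  by apply/mapP; exists (ord0, i) => //=; rewrite mem_enum.
by rewrite [leRHS]/Num.norm /= mx_normrE; apply/bigmax_geP; right => /=; exists j.
Qed.

(** * The integral of forms *)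

Section Integral.
Variables (R : realType) (n : nat) (M : closedOrientedManifold R n).
Implicit Types (a b mu : nform M) (i : Defs.index M) (p : M).

Local Notation img i := (@phi _ _ M i @` dom i).
Local Notation pu := (partition_of_unity M).

Lemma smooth_fun_continuous (f : M -> R) : smooth_fun f -> continuous f.
Proof.
move=> fs p; have pi := chart_atP p; set i := chart_at p in pi.
have dp : nbhs p (dom i) by apply: open_nbhs_nbhs; split=> //; exact: dom_open.
have cphi : phi i q @[q --> p] --> phi i p.
  have /subspace_continuousP/(_ p pi) := @phi_continuous _ _ M i.
  by rewrite within_interior//; exact: dp.
have cf : {for phi i p, continuous (f \o phinv i)}.
  have ip : img i (phi i p) by exists p.
  by have [] := fs i [::] _ ip.
have := cvg_comp _ _ cphi cf.
rewrite /= phiK//; apply: cvg_trans; apply: near_eq_cvg.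
by apply: filterS dp => q qi /=; rewrite phiK.
Qed.

Lemma smooth_fun_bounded (f : M -> R) : smooth_fun f ->
  exists2 C : R, 0 < C & forall p, `|f p| <= C.
Proof.
move=> fs; have cf : {within [set: M], continuous (fun p => `|f p|)}.
  apply: continuous_subspaceT => p.
  by apply: (@continuous_comp _ _ _ f (fun y : R => `|y|));
    [exact: smooth_fun_continuous|exact: norm_continuous].
have [[p0 _]|M0] := pselect ([set: M] !=set0); last first.
  by exists 1 => // p; case: M0; exists p.
have [c _ fc] := @compact_EVT_max _ R _ [set: M] (ex_intro _ p0 I) (@carrier_compact _ _ M) cf.
exists (`|f c| + 1); first by rewrite ltr_wpDl.
by move=> p; rewrite (le_trans (fc p _)) ?inE// lerDl.
Qed.

Definition chart_supp i (r : M -> R) : set 'rV[R]_n := phi i @` closure [set p | r p != 0].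

(** The integrands in the integral of a form; the cut-off r makes the extension by
    zero continuous. *)
Definition chart_ext i (r : M -> R) (w : 'rV[R]_n -> R) : 'rV[R]_n -> R :=
  (fun x => r (phinv i x) * w x) \_ (img i).

Lemma chart_extE i r w x : img i x -> chart_ext i r w x = r (phinv i x) * w x.
Proof. by move=> ix; rewrite /chart_ext patchE mem_set. Qed.

Lemma chart_ext_out i r w x : ~ img i x -> chart_ext i r w x = 0.
Proof. by move=> ix; rewrite /chart_ext patchE memNset. Qed.

Section ChartExtension.
Variables (i : Defs.index M) (r : M -> R).
Hypothesis r_smooth : smooth_fun r.
Hypothesis r_supp : closure [set p | r p != 0] `<=` dom i.

Lemma chart_supp_compact : compact (chart_supp i r).
Proof.
apply: continuous_compact.
  by apply: continuous_subspaceW r_supp _; exact: phi_continuous.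
apply: (subclosed_compact _ (@carrier_compact _ _ M)) => //.
exact: closed_closure.
Qed.

Lemma chart_supp_img : chart_supp i r `<=` img i.
Proof. by move=> _ [p pr <-]; exists p => //; exact: r_supp. Qed.

Lemma chart_ext_off w x : ~ chart_supp i r x -> chart_ext i r w x = 0.
Proof.
move=> xK; rewrite /chart_ext patchE; case: ifPn => // /set_mem ix.
have [->|r0] := eqVneq (r (phinv i x)) 0; first by rewrite mul0r.
by exfalso; apply: xK; exists (phinv i x); [exact: subset_closure|rewrite phi_phinv].
Qed.

(** R^n is covered by two open sets: the image of the chart, where the extension is
    a product of continuous functions, and the complement of the compact set
    [chart_supp i r], where it vanishes. *)
Lemma chart_ext_continuous w : (forall x, img i x -> {for x, continuous w}) ->
  continuous (chart_ext i r w).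
Proof.
move=> cw x; have [ix|nix] := pselect (img i x).
  have nx : nbhs x (img i) by apply: open_nbhs_nbhs; split=> //; exact: phi_open.
  have cr : {for x, continuous (r \o phinv i)} by have [] := r_smooth [::] ix.
  have crw : (fun y => r (phinv i y) * w y) @ nbhs x --> r (phinv i x) * w x.
    exact: (cvgM cr (cw x ix)).
  have e : {near x, (fun y => r (phinv i y) * w y) =1 chart_ext i r w}.
    by apply: (@filterS _ (nbhs x)) nx => y iy; rewrite chart_extE.
  by apply: cvg_trans (near_eq_cvg e) _; rewrite chart_extE.
have xK : ~ chart_supp i r x by move=> /chart_supp_img xi; exact: nix.
have nx : nbhs x (~` chart_supp i r).
  apply: open_nbhs_nbhs; split=> //; apply: closed_openC.
  by apply: compact_closed; [exact: norm_hausdorff|exact: chart_supp_compact].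
rewrite /continuous_at chart_ext_off//.
have e : {near x, (fun=> 0) =1 chart_ext i r w}.
  by apply: (@filterS _ (nbhs x)) nx => y yK; rewrite chart_ext_off.
exact: cvg_trans (near_eq_cvg e) (cvg_cst (0 : R)).
Qed.

Lemma chart_ext_supp (B : R) w : chart_supp i r `<=` @cube R B n ->
  (forall x, img i x -> {for x, continuous w}) -> supp_cube B (chart_ext i r w).
Proof.
move=> KB cw; split; first exact: chart_ext_continuous.
by move=> x xB; apply: chart_ext_off => /KB.
Qed.

End ChartExtension.

Lemma loc_continuous a i x : img i x -> {for x, continuous (loc a i)}.
Proof. by move=> ix; have [] := @form_smooth _ _ M a i [::] _ ix. Qed.

Lemma integral_formE a :
  integral_form a = \sum_(k <- pu) iter_int (chart_ext k.1 k.2 (loc a k.1)).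
Proof. by []. Qed.

(** When no partition of unity exists, the one chosen by default is empty and every
    integral is an empty sum. *)
Lemma integral_neq0_partition a : integral_form a != 0 -> is_partition_of_unity pu.
Proof.
rewrite /integral_form /partition_of_unity; case: xgetP => [s _ //|_].
by rewrite big_nil eqxx.
Qed.

Section Partition.
Hypothesis pu_ok : is_partition_of_unity pu.

Lemma pu_smooth k : k \in pu -> smooth_fun k.2.
Proof. by move=> kp; have [+ _] := pu_ok; move=> /(_ k kp) []. Qed.
Lemma pu_ge0 k p : k \in pu -> 0 <= k.2 p.
Proof. by move=> kp; have [+ _] := pu_ok; move=> /(_ k kp) []. Qed.
Lemma pu_supp k : k \in pu -> closure [set p | k.2 p != 0] `<=` dom k.1.
Proof. by move=> kp; have [+ _] := pu_ok; move=> /(_ k kp) []. Qed.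

Lemma pu_cube k : k \in pu ->
  exists2 B : R, 0 <= B & forall a, supp_cube B (chart_ext k.1 k.2 (loc a k.1)).
Proof.
move=> kp; have [B B0 KB] := compact_sub_cube (chart_supp_compact (pu_supp kp)).
exists B => // a; apply: chart_ext_supp => //.
- exact: pu_smooth.
- exact: pu_supp.
- by move=> x ix; exact: loc_continuous.
Qed.

Lemma integral_form_linear (c : R) a b :
  integral_form (c *: a + b) = c * integral_form a + integral_form b.
Proof.
rewrite !integral_formE mulr_sumr -big_split; apply: eq_big_seq => k kp /=.
have [B B0 KB] := pu_cube kp.
rewrite -(iter_int_linear B0 _ (KB a) (KB b)); congr iter_int.
apply/funext => x; have [ix|nix] := pselect (img k.1 x); last first.
  by rewrite !chart_ext_out// mulr0 addr0.
rewrite !chart_extE// (_ : loc (c *: a + b) k.1 x = c * loc a k.1 x + loc b k.1 x)//.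
by ring.
Qed.

Lemma integral_form0 : integral_form (0 : nform M) = 0.
Proof.
have := integral_form_linear (-1) 0 0.
by rewrite scaler0 addr0 mulN1r addNr.
Qed.

Lemma integral_formD a b : integral_form (a + b) = integral_form a + integral_form b.
Proof. by rewrite -[a in LHS]scale1r integral_form_linear mul1r. Qed.

Lemma integral_formZ (c : R) a : integral_form (c *: a) = c * integral_form a.
Proof. by rewrite -[c *: a]addr0 integral_form_linear integral_form0 addr0. Qed.

Lemma integral_formB a b : integral_form (a - b) = integral_form a - integral_form b.
Proof. by rewrite integral_formD -scaleN1r integral_formZ mulN1r. Qed.

(** Some function of the partition is positive at a point where a is not zero, and
    a is still not zero there in the chart carrying that function, as changes of
    charts multiply coefficients by nonzero determinants. *)
Lemma integral_form_gt0 a : (forall i p, dom i p -> 0 <= a i p) -> a != 0 ->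
  0 < integral_form a.
Proof.
move=> a0 an0.
have ext0 k x : k \in pu -> 0 <= chart_ext k.1 k.2 (loc a k.1) x.
  move=> kp; rewrite /chart_ext patchE; case: ifPn => // /set_mem ix.
  by rewrite mulr_ge0 ?pu_ge0// a0//; exact: phinv_dom.
have term0 k : k \in pu -> 0 <= iter_int (chart_ext k.1 k.2 (loc a k.1)).
  by move=> kp; apply: iter_int_ge0 => x; exact: ext0.
have [[i [p [pi aip]]]|noip] := pselect (exists i p, dom i p /\ a i p != 0); last first.
  exfalso; move/negP: an0; apply; apply/eqP/form_eq => i p pi.
  by apply: contra_notP noip => /eqP ?; exists i, p.
have [k kp kp0] : exists2 k, k \in pu & k.2 p != 0.
  apply: contrapT => nok.
  have := pu_ok.2 p; rewrite big_seq big1; first by move/esym/eqP; rewrite oner_eq0.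
  by move=> k kp; apply: contra_notP nok => /eqP k0; exists k.
have pk : dom k.1 p by apply: (pu_supp kp); apply: subset_closure.
have akp : 0 < a k.1 p.
  rewrite lt_neqAle a0// andbT eq_sym; apply: contra aip => /eqP ak0.
  by rewrite (form_trans a pi pk) ak0 mul0r.
rewrite integral_formE (big_rem k)//= ltr_pwDl//; last first.
  rewrite big_seq sumr_ge0// => l /mem_rem; exact: term0.
have [B B0 KB] := pu_cube kp.
apply: (iter_int_gt0 B0 (x0 := phi k.1 p) (KB a)) => [x|]; first exact: ext0.
rewrite /chart_ext patchE mem_set/=; last by exists p.
by rewrite /loc/= phiK// mulr_gt0// lt_neqAle eq_sym kp0 pu_ge0.
Qed.

Lemma pu_le1 k p : k \in pu -> k.2 p <= 1.
Proof.
move=> kp; rewrite -(pu_ok.2 p) (big_rem k)//= lerDl big_seq sumr_ge0// => l /mem_rem.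
exact: pu_ge0.
Qed.

(** Each term is bounded by the volume of a cube times the supremum of a coefficient
    over the compact [chart_supp], which is a seminorm of the space of forms. *)
Lemma integral_form_clinear : clinear (@integral_form R n M : nform M -> R).
Proof.
split; first exact: integral_form_linear.
move=> a; rewrite /continuous_at integral_formE.
have -> : @integral_form R n M = fun b => \sum_(k <- pu) iter_int (chart_ext k.1 k.2 (loc b k.1)) by [].
have -> : (fun b : nform M => \sum_(k <- pu) iter_int (chart_ext k.1 k.2 (loc b k.1))) =
    fun b => \sum_(k <- pu | k \in pu) iter_int (chart_ext k.1 k.2 (loc b k.1)).
  by apply/funext => b; rewrite big_seq.
rewrite [X in _ --> X]big_seq.
apply: (@cvg_big R _ _ _ _ (@add_continuous R) _ (nbhs a) pu
  (fun k b => iter_int (chart_ext k.1 k.2 (loc b k.1)))) => k kp.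
have [B B0 KB] := pu_cube kp.
apply/cvgrPdist_le => e e0.
pose D := (2 * B) ^+ n + 1.
have D0 : 0 < D by rewrite ltr_wpDl// exprn_ge0// mulr_ge0.
have eD : 0 < e / D by rewrite divr_gt0.
have Kk : chart_compacts k.1 (chart_supp k.1 k.2).
  split; [exact: chart_supp_compact (pu_supp kp)|exact: chart_supp_img (pu_supp kp)].
have /nform_cvgP/(_ _ _ Kk [::] _ eD) := (@cvg_id _ (nbhs a)).
apply: (@filterS _ (nbhs a)) => b ab.
have -> : iter_int (chart_ext k.1 k.2 (loc a k.1)) - iter_int (chart_ext k.1 k.2 (loc b k.1)) =
  iter_int (fun x => (- 1) * chart_ext k.1 k.2 (loc b k.1) x + chart_ext k.1 k.2 (loc a k.1) x).
  by rewrite (iter_int_linear B0)// mulN1r addrC.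
apply: le_trans (@iter_int_bound _ _ B0 _ _ (e / D) _ _) _.
- exact: supp_cubeD.
- move=> x; have [xK|xK] := pselect (chart_supp k.1 k.2 x); last first.
    by rewrite !chart_ext_off ?(pu_supp kp)// mulr0 addr0 normr0 ltW//; exact: (pu_supp kp).
  rewrite /chart_ext !patchE mem_set; last exact: chart_supp_img (pu_supp kp) _ xK.
  rewrite mulN1r addrC -mulrBr normrM distrC -[leRHS]mul1r ler_pM//.
    by rewrite ger0_norm ?pu_ge0// pu_le1.
  exact: ab.
by rewrite mulrAC ler_pdivrMr// ler_pM2l// lerDl.
Qed.

(** A function of the partition, read in its chart and extended by zero, is
    continuous. Along a coordinate ray from a point where it is positive it leaves
    its support, so it takes all smaller positive values. *)
Lemma smooth_fun_interval : (1 <= n)%N ->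
  [set: M] !=set0 ->
  exists2 f : M -> R, smooth_fun f &
    exists2 c : R, 0 < c & forall y, 0 < y < c -> exists p, f p = y.
Proof.
move=> n1 [p _].
have [k kp kp0] : exists2 k, k \in pu & k.2 p != 0.
  apply: contrapT => nok.
  have := pu_ok.2 p; rewrite big_seq big1; first by move/esym/eqP; rewrite oner_eq0.
  by move=> k kp; apply: contra_notP nok => /eqP k0; exists k.
have pk : dom k.1 p by apply: (pu_supp kp); apply: subset_closure.
exists k.2; first exact: pu_smooth.
exists (k.2 p); first by rewrite lt_neqAle eq_sym kp0 pu_ge0.
move=> y /andP[y0 yc].
have [B B0 KB] := compact_sub_cube (chart_supp_compact (pu_supp kp)).
have [ch h0] : supp_cube B (chart_ext k.1 k.2 (fun=> 1)).
  apply: chart_ext_supp => //; [exact: pu_smooth|exact: pu_supp|].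
  by move=> x _; exact: cst_continuous.
pose x0 := phi k.1 p; pose i0 := Ordinal n1.
pose g t := chart_ext k.1 k.2 (fun=> 1) (x0 + t *: delta_mx ord0 i0).
have g0 : g 0 = k.2 p.
  rewrite /g scale0r addr0 /chart_ext patchE mem_set; last by exists p.
  by rewrite mulr1 phiK.
(* x0 lies in the cube of radius B, so a step of 2 B + 1 leaves the cube. *)
have g1 : g (2 * B + 1) = 0.
  apply: h0 => /(_ i0); rewrite /= !mxE !eqxx mulr1 in_itv/= => /andP[_].
  have : cube B x0 by apply: KB; exists p => //; exact: subset_closure.
  by move=> /(_ i0); rewrite /= in_itv/= => /andP[]; lra.
have cg : continuous g.
  move=> t; apply: (@continuous_comp _ _ _ (fun t : R => x0 + t *: delta_mx ord0 i0)); last exact: ch.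
  by apply: cvgD; [exact: cvg_cst|apply: cvgZr_tmp; exact: cvg_id].
have B1 : 0 <= 2 * B + 1 by lra.
have [|t _ gt] := @IVT _ g 0 (2 * B + 1) y B1 (continuous_subspaceT cg).
  by rewrite g0 g1 ge_min le_max (ltW y0) (ltW yc) orbT.
exists (phinv k.1 (x0 + t *: delta_mx ord0 i0)).
move: gt; rewrite /g /chart_ext patchE; case: ifP; first by rewrite mulr1.
by move=> _ y00; move: y0; rewrite -y00 ltxx.
Qed.

(** By compactness h / mu is bounded, so mu + t h is positive for small t. *)
Lemma Dens_admissible : admissible (@Dens R n M) [set: nform M].
Proof.
split=> //.
- move=> mu h mu0 _; have [C C0 HC] := smooth_fun_bounded (RN_smooth h mu0).
  have C1 : 0 < C^-1 by rewrite invr_gt0.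
  have nt : nbhs (0 : R) [set t | `|t| < C^-1].
    by apply/nbhs_ballP; exists C^-1 => //= t; rewrite /ball/= sub0r normrN.
  apply: (@filterS _ (nbhs (0 : R))) nt => t /= tC i p pi.
  rewrite nformD nformZ; have m0 := mu0 i p pi.
  have := HC p; rewrite (RNE h mu0 pi) normrM normfV ler_pdivrMr ?normr_gt0 ?gt_eqF//.
  rewrite (gtr0_norm m0) => hC.
  have : `|t * h i p| < mu i p.
    rewrite normrM; have [->|t0] := eqVneq t 0; first by rewrite normr0 mul0r.
    rewrite (le_lt_trans (ler_wpM2l _ hC))// mulrA -ltr_pdivlMr// divff ?gt_eqF//.
    by rewrite -ltr_pdivlMr// div1r.
  by rewrite ltr_norml => /andP[+ _]; lra.
- move=> mu h t mu0 muh0 /andP[t0 t1] i p pi.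
  have m0 := mu0 i p pi; have := muh0 i p pi; rewrite !nformD nformZ => mh0.
  have -> : mu i p + t * h i p = (1 - t) * mu i p + t * (mu i p + h i p) by ring.
  have [->|tn0] := eqVneq t 0; first by rewrite subr0 mul1r mul0r addr0.
  have tgt0 : 0 < t by rewrite lt_neqAle eq_sym tn0.
  by apply: ltr_wpDl; [rewrite mulr_ge0 ?subr_ge0// ltW|rewrite mulr_gt0].
Qed.

Lemma Prob_admissible : admissible (@Prob R n M) (@Tan R n M).
Proof.
have aD := Dens_admissible; rewrite /Prob /Tan; split.
- exact: integral_form0.
- by move=> c a b /= a0 b0; rewrite integral_form_linear a0 b0 mulr0 addr0.
- move=> H a PH Ha HT /=.
  have Ia := cvg_comp _ _ Ha (integral_form_clinear.2 a).
  apply: (@lcs_cvg_unique R R _ _ _ _ Ia).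
  apply: cvg_trans (cvg_cst (0 : R) : _ @ H --> _).
  by apply: near_eq_cvg; apply: filterS HT => b /= ->.
- by move=> a b [_ a1] [_ b1] /=; rewrite integral_formB a1 b1 subrr.
- move=> mu h [mu0 mu1] /= h0.
  apply: (@filterS _ (nbhs (0 : R)) _ _ _ _ (adm_open aD mu0 (I : setT h))) => t mut.
  by split=> //; rewrite integral_formD integral_formZ h0 mulr0 addr0.
- move=> mu h t [mu0 mu1] [muh0 muh1] t01; split; first exact: (adm_convex aD).
  have h0 : integral_form h = 0.
    by move: muh1; rewrite integral_formD mu1; lra.
  by rewrite integral_formD integral_formZ h0 mulr0 addr0.
Qed.

End Partition.
End Integral.

(** * Rules of differentiation and the symmetry of second derivatives *)

Section DerivativeRules.
Variable R : realType.
Implicit Types E F G : Lcs.type R.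

Lemma scale_cbilinear F : cbilinear (fun (k : R) (v : F) => k *: v).
Proof.
split=> [c x y z|c x y z|z].
- by rewrite scalerDl scalerA.
- by rewrite scalerDr !scalerA mulrC.
- by apply: lcs_cvgZ; [exact: cvg_fst|exact: cvg_snd].
Qed.

Lemma has_dderiv_clinear E F G (L : F -> G) (f : E -> F) x h d :
  clinear L -> has_dderiv f x h d -> has_dderiv (fun y => L (f y)) x h (L d).
Proof.
move=> lL fd.
have := has_dderiv_comp (@adm_setT R E) (@adm_setT R F) (fun _ _ => I)
  (@Ck_clinear R 1 F G setT setT L lL) I I fd.
by rewrite (dderivE (@clinear_has_dderiv _ _ _ L _ _ lL)).
Qed.

Lemma has_dderiv_bilinear E F F' G (B : F -> F' -> G) (f : E -> F) (g : E -> F') x h d d' :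
  cbilinear B -> has_dderiv f x h d -> has_dderiv g x h d' ->
  has_dderiv (fun y => B (f y) (g y)) x h (B d (g x) + B (f x) d').
Proof.
move=> bB fd gd.
have := has_dderiv_comp (@adm_setT R E) (@adm_setT R (F * F')%type) (fun _ _ => I)
  (@Ck_cbilinear R 1 _ _ _ _ bB) I I (has_dderiv_pair fd gd).
by rewrite (dderivE (@cbilinear_has_dderiv _ _ _ _ B _ _ bB)).
Qed.

Lemma has_dderivD E F (f g : E -> F) x h d d' :
  has_dderiv f x h d -> has_dderiv g x h d' ->
  has_dderiv (fun y => f y + g y) x h (d + d').
Proof.
by move=> fd gd; exact: (has_dderiv_clinear (clinear_add F) (has_dderiv_pair fd gd)).
Qed.

Lemma has_dderivZl E F (f : E -> F) x h d (k : R) :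
  has_dderiv f x h d -> has_dderiv (fun y => k *: f y) x h (k *: d).
Proof. by move=> fd; exact: (has_dderiv_clinear (clinear_scale F k) fd). Qed.

Lemma has_dderivB E F (f g : E -> F) x h d d' :
  has_dderiv f x h d -> has_dderiv g x h d' ->
  has_dderiv (fun y => f y - g y) x h (d - d').
Proof.
move=> fd gd; have := has_dderivD fd (@has_dderivZl _ _ _ _ _ _ (-1) gd).
rewrite scaleN1r; apply: cvg_trans; apply: near_eq_cvg.
by apply: (@nearW _ (0 : R)^') => t; rewrite /diff_quot !scaleN1r.
Qed.

Lemma has_dderivM E (f g : E -> R) x h (d d' : R) :
  has_dderiv f x h d -> has_dderiv g x h d' ->
  has_dderiv (fun y => f y * g y) x h (d * g x + f x * d').
Proof. by move=> fd gd; exact: (has_dderiv_bilinear (scale_cbilinear R) fd gd). Qed.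

Lemma has_dderiv_id E (x h : E) : has_dderiv id x h h.
Proof. exact: (@clinear_has_dderiv _ _ _ id _ _ (clinear_id E)). Qed.

Section Smooth.
Variables (E : Lcs.type R) (U T : set E).
Hypothesis aU : admissible U T.

Lemma Ck_app_clinear k F G (L : F -> G) (f : E -> F) : clinear L -> Ck k U T f ->
  Ck k U T (fun x => L (f x)).
Proof.
move=> lL Cf.
exact: (Ck_comp aU (@adm_setT R F) (fun _ _ => I) Cf (@Ck_clinear R k _ _ _ _ L lL)).
Qed.

Lemma Ck_app_cbilinear k F F' G (B : F -> F' -> G) (f : E -> F) (g : E -> F') :
  cbilinear B -> Ck k U T f -> Ck k U T g -> Ck k U T (fun x => B (f x) (g x)).
Proof.
move=> bB Cf Cg.
exact: (Ck_comp aU (@adm_setT R (F * F')%type) (fun _ _ => I) (Ck_pair aU Cf Cg)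
  (@Ck_cbilinear R k _ _ _ B bB)).
Qed.

Lemma CkD k F (f g : E -> F) : Ck k U T f -> Ck k U T g -> Ck k U T (fun x => f x + g x).
Proof.
by move=> Cf Cg; exact: (Ck_app_clinear (clinear_add F) (Ck_pair aU Cf Cg)).
Qed.

Lemma CkZ k F (c : R) (f : E -> F) : Ck k U T f -> Ck k U T (fun x => c *: f x).
Proof. exact: Ck_app_clinear (clinear_scale F c). Qed.

Lemma CkB k F (f g : E -> F) : Ck k U T f -> Ck k U T g -> Ck k U T (fun x => f x - g x).
Proof.
move=> Cf Cg; apply: (eq_Ck aU _ (CkD Cf (CkZ (-1) Cg))) => x _.
by rewrite scaleN1r.
Qed.

Lemma Ck_scale k F (s : E -> R) (f : E -> F) : Ck k U T s -> Ck k U T f ->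
  Ck k U T (fun x => s x *: f x).
Proof. exact: Ck_app_cbilinear (scale_cbilinear F). Qed.

Lemma Ck_id k : Ck k U T id.
Proof. exact: Ck_clinear (clinear_id E). Qed.

Lemma Ck_dderiv_along k F (f : E -> F) (a : E -> E) :
  (forall x, U x -> T (a x)) -> Ck k.+1 U T f -> Ck k U T a ->
  Ck k U T (fun x => dderiv f x (a x)).
Proof.
move=> Ta [_ [_ Cdf]] Ca.
apply: (Ck_comp aU (adm_prod aU (adm_tangent aU)) _ (Ck_pair aU (Ck_id k) Ca) Cdf) => x Ux.
by split=> //; exact: Ta.
Qed.

End Smooth.

Lemma line_is_derive E (f : E -> R) (x h : E) (s d : R) :
  has_dderiv f (x + s *: h) h d -> is_derive s 1 (fun s => f (x + s *: h)) d.
Proof.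
move=> fd.
have dl : u^-1 *: (((fun s => f (x + s *: h)) \o shift s) (u *: 1) - f (x + s *: h))
    @[u --> (0 : R)^'] --> d.
  apply: cvg_trans fd; apply: near_eq_cvg; apply: (@nearW _ (0 : R)^') => u.
  by rewrite /diff_quot /= [u *: 1]mulr1 scalerDl addrA addrAC.
apply: DeriveDef; first by apply/cvg_ex; exists d.
exact: cvg_lim dl.
Qed.

Section Schwarz.
Variables (E : Lcs.type R) (U T : set E) (f : E -> R).
Hypothesis aU : admissible U T.
Hypothesis Cf : Csmooth U T f.

Lemma Ck_partial k (a : E) : T a -> Ck k U T (fun x => dderiv f x a).
Proof.
by move=> Ta; apply: (Ck_dderiv_along aU (a := fun=> a)) => //; exact: Ck_cst.
Qed.

Definition diff2 (x a b : E) (t : R) :=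
  f (x + t *: a + t *: b) - f (x + t *: a) - f (x + t *: b) + f x.

(** Openness along lines does not give a parallelogram at once; convexity does, as
    x + s a + t b is the midpoint of x + 2 s a and x + 2 t b. *)
Lemma adm_near2 x a b : U x -> T a -> T b ->
  \forall t \near (0 : R)^'+, forall s, 0 <= s <= t ->
    U (x + s *: a) /\ U (x + s *: a + t *: b).
Proof.
move=> Ux Ta Tb.
have Ua := adm_open aU Ux Ta; have Ub := adm_open aU Ux Tb.
move/nbhs_ballP: Ua => [d1 /= d10 Ua]; move/nbhs_ballP: Ub => [d2 /= d20 Ub].
near=> t => s /andP[s0 st].
have t0 : 0 < t by near: t; exact: nbhs_right_gt.
have td1 : t < d1 / 2 by near: t; apply: nbhs_right_lt; rewrite divr_gt0.
have td2 : t < d2 / 2 by near: t; apply: nbhs_right_lt; rewrite divr_gt0.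
have U1 r : 0 <= r < d1 -> U (x + r *: a).
  by move=> /andP[r0 r1]; apply: Ua; rewrite /ball/= sub0r normrN ger0_norm.
have U2 : U (x + (2 * t) *: b).
  by apply: Ub; rewrite /ball/= sub0r normrN ger0_norm; lra.
split; first by apply: U1; lra.
have U1' : U (x + (2 * s) *: a) by apply: U1; lra.
have -> : x + s *: a + t *: b =
    (x + (2 * s) *: a) + 2^-1 *: ((2 * t) *: b - (2 * s) *: a).
  rewrite scalerBr !scalerA !mulKf ?pnatr_eq0//.
  have -> : (2 * s) *: a = s *: a + s *: a by rewrite -scalerDl; congr (_ *: _); ring.
  by rewrite [_ *: b - _]addrC !addrA addrK.
apply: (adm_convex aU) => //; last by lra.
by rewrite addrACA subrr addr0.
Unshelve. all: by end_near. Qed.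

(** The mean value theorem for s |-> f (x + t b + s a) - f (x + s a) turns diff2
    into t times an increment along t b of y |-> dderiv f y a, based at a point
    x + th t *: a that tends to x; strict differentiability gives the limit. *)
Lemma diff2_cvg x a b : U x -> T a -> T b ->
  (t ^+ 2)^-1 * diff2 x a b t @[t --> (0 : R)^'+] --> dderiv (fun y => dderiv f y a) x b.
Proof.
move=> Ux Ta Tb; have C1 := Cf 1.
pose P (t s : R) := 0 <= s <= t /\
  diff2 x a b t = t * (dderiv f (x + s *: a + t *: b) a - dderiv f (x + s *: a) a).
pose th (t : R) : R := xget 0 (P t).
have near_th : \forall t \near (0 : R)^'+, P t (th t).
  near=> t; have t0 : 0 < t by near: t; exact: nbhs_right_gt.
  have Ut : forall s, 0 <= s <= t -> U (x + s *: a) /\ U (x + s *: a + t *: b).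
    by near: t; exact: adm_near2.
  apply: xgetPex.
  pose g (s : R) : R := f ((x + t *: b) + s *: a) - f (x + s *: a).
  pose g' (s : R) : R := dderiv f (x + s *: a + t *: b) a - dderiv f (x + s *: a) a.
  have dg (s : R) : 0 <= s <= t -> is_derive s 1 g (g' s).
    move=> st; have [U1 U2] := Ut s st.
    apply: is_deriveB; apply: line_is_derive.
      by rewrite addrAC; exact: Ck1_has_dderiv C1 U2 Ta.
    exact: Ck1_has_dderiv C1 U1 Ta.
  have [||s st] := @MVT_segment R g g' 0 t (ltW t0).
  - by move=> s /itvP st; apply: dg; rewrite !st.
  - apply: derivable_within_continuous => s /itvP st.
    by have [] := dg s; rewrite ?st.
  rewrite subr0 => E1; exists s; split; first by move: st; rewrite in_itv.
  rewrite mulrC -/(g' s) -E1 /g /diff2 !scale0r !addr0 opprB addrA addrAC.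
  by rewrite [x + t *: b + _]addrAC.
have th0 : th t @[t --> (0 : R)^'+] --> (0 : R).
  apply/cvgrPdist_le => e e0; near=> t.
  have [/andP[s0 st] _] : P t (th t) by near: t.
  rewrite sub0r normrN ger0_norm// (le_trans st)//; near: t.
  exact: nbhs_right_le.
have C1a : Ck 1 U T (fun y => dderiv f y a) by exact: Ck_partial.
have tid : (fun t : R => t) @ (0 : R)^'+ --> (0 : R) by apply: cvg_within; exact: cvg_id.
have : t^-1 *: (dderiv f ((x + th t *: a) + t *: b) a - dderiv f (x + th t *: a) a)
    @[t --> (0 : R)^'+] --> dderiv (fun y => dderiv f y a) x b.
  apply: (Ck1_strict_dderiv aU C1a) => //.
  - rewrite -[X in _ --> X]addr0 -(scale0r a).
    by apply: lcs_cvgD; [exact: cvg_cst|apply: lcs_cvgZ => //; exact: cvg_cst].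
  - exact: cvg_cst.
  - near=> t; have t0 : 0 < t by near: t; exact: nbhs_right_gt.
    have [st _] : P t (th t) by near: t.
    have Ut : forall s, 0 <= s <= t -> U (x + s *: a) /\ U (x + s *: a + t *: b).
      by near: t; exact: adm_near2.
    have [U1 U2] := Ut _ st.
    by split=> //; rewrite gt_eqF.
apply: cvg_trans; apply: near_eq_cvg; near=> t.
have t0 : 0 < t by near: t; exact: nbhs_right_gt.
have [_ ->] : P t (th t) by near: t.
by rewrite expr2 invfM -mulrA mulKf ?gt_eqF.
Unshelve. all: by end_near. Qed.

(** The second difference is symmetric in a and b. *)
Lemma dderiv_sym x a b : U x -> T a -> T b ->
  dderiv (fun y => dderiv f y a) x b = dderiv (fun y => dderiv f y b) x a.
Proof.
move=> Ux Ta Tb; have A := diff2_cvg Ux Ta Tb.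
have B : (t ^+ 2)^-1 * diff2 x a b t @[t --> (0 : R)^'+] --> dderiv (fun y => dderiv f y b) x a.
  have -> : diff2 x a b = diff2 x b a; last exact: diff2_cvg.
  apply/funext => t; rewrite /diff2 [x + _ + _]addrAC; congr (_ + _).
  by rewrite [LHS]addrAC.
exact: (@lcs_cvg_unique R R _ _ _ _ A B).
Qed.

End Schwarz.
End DerivativeRules.

(** * The connection and the three compatible metrics *)

Section Connection.
Variables (R : realType) (n : nat) (M : closedOrientedManifold R n).
Variable lambda : nform M.
Hypothesis lambda_prob : Prob lambda.
Implicit Types (a b c : nform M -> nform M) (mu u v w : nform M).

Local Notation J := (@integral_form R n M).

Lemma Prob_Dens mu : Prob mu -> Dens mu. Proof. by case. Qed.
Lemma Prob_int mu : Prob mu -> J mu = 1. Proof. by case. Qed.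

Lemma lambda_dens : Dens lambda. Proof. exact: Prob_Dens. Qed.

Lemma pu_ok : is_partition_of_unity (partition_of_unity M).
Proof.
by apply: (@integral_neq0_partition _ _ _ lambda); rewrite (Prob_int lambda_prob) oner_eq0.
Qed.

Let aD := Dens_admissible M.
Let aP : admissible (@Prob R n M) (@Tan R n M) := Prob_admissible pu_ok.
Let J_lin := integral_form_clinear pu_ok.
Let JD := integral_formD pu_ok.
Let JZ := integral_formZ pu_ok.
Let JB := integral_formB pu_ok.
Let bil := qprod_cbilinear lambda_dens.

Lemma qprodC u m v : Dens m -> qprod u m v = qprod v m u.
Proof. by move=> m0; apply: form_eq => i p pi; rewrite !qprodE//; ring. Qed.

Lemma qprodDl u v m w : Dens m -> qprod (u + v) m w = qprod u m w + qprod v m w.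
Proof. by move=> m0; apply: form_eq => i p pi; rewrite nformD !qprodE// nformD; ring. Qed.

Lemma qprodZl (k : R) u m w : Dens m -> qprod (k *: u) m w = k *: qprod u m w.
Proof. by move=> m0; apply: form_eq => i p pi; rewrite nformZ !qprodE// nformZ; ring. Qed.

Lemma qprodDr u v m w : Dens m -> qprod w m (u + v) = qprod w m u + qprod w m v.
Proof. by move=> m0; rewrite !(qprodC w)// qprodDl. Qed.

Lemma qprodZr (k : R) u m w : Dens m -> qprod w m (k *: u) = k *: qprod w m u.
Proof. by move=> m0; rewrite !(qprodC w)// qprodZl. Qed.

Lemma qprodBl u v m w : Dens m -> qprod (u - v) m w = qprod u m w - qprod v m w.
Proof. by move=> m0; rewrite -scaleN1r qprodDl// qprodZl// scaleN1r. Qed.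

Lemma qprodBr u v m w : Dens m -> qprod w m (u - v) = qprod w m u - qprod w m v.
Proof. by move=> m0; rewrite !(qprodC w)// qprodBl. Qed.

Lemma qprod_idl m w : Dens m -> qprod m m w = w.
Proof.
move=> m0; apply: form_eq => i p pi; rewrite qprodE// divff ?mul1r//.
exact: Dens_neq0.
Qed.

Lemma qprod_idr m w : Dens m -> qprod w m m = w.
Proof. by move=> m0; rewrite qprodC// qprod_idl. Qed.

Lemma qprod_gt0 u m : Dens m -> u != 0 -> 0 < J (qprod u m u).
Proof.
move=> m0 u0; apply: (integral_form_gt0 pu_ok).
  move=> i p pi; rewrite qprodE// mulrAC -expr2 mulr_ge0 ?sqr_ge0//.
  by rewrite invr_ge0 ltW// Dens_gt0.
apply: contra u0 => /eqP E0; apply/eqP/form_eq => i p pi.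
have : qprod u m u i p = 0 by rewrite E0.
rewrite qprodE// mulrAC => /eqP; rewrite mulf_eq0 invr_eq0 (negbTE (Dens_neq0 m0 pi)) orbF.
by rewrite -expr2 sqrf_eq0 => /eqP.
Qed.

Lemma fmul_RN u m : Dens m -> fmul (RN u m) m = u.
Proof. exact: qprod_idr. Qed.

Lemma RN_qprod u m v m' : Dens m -> Dens m' ->
  (fun p => RN u m p * RN v m' p) = RN (qprod u m v) m'.
Proof.
move=> m0 m0'; apply/funext => p.
by rewrite /RN qprodE ?mulrA//; exact: chart_atP.
Qed.

Lemma integral_wrt_RN u m : Dens m -> integral_wrt (RN u m) m = J u.
Proof. by move=> m0; rewrite /integral_wrt fmul_RN. Qed.

Section SmoothMaps.
Variables (E : Lcs.type R) (U T : set E).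
Hypothesis aU : admissible U T.

Lemma Ck_qprod k (f m g : E -> nform M) : (forall x, U x -> Dens (m x)) ->
  Ck k U T f -> Ck k U T m -> Ck k U T g -> Ck k U T (fun x => qprod (f x) (m x) (g x)).
Proof.
move=> m0 Cf Cm Cg.
have Cfm : Ck k U T (fun x => qinv lambda (m x)).
  exact: (Ck_comp aU aD m0 Cm (Ck_qinv lambda_dens aD k)).
have C1 := Ck_app_cbilinear aU bil (Ck_app_cbilinear aU bil Cf Cfm) Cg.
apply: (eq_Ck aU _ C1) => x Ux.
by rewrite -(qprod_qinv lambda_dens)//; exact: m0.
Qed.

Lemma Ck_int k (f : E -> nform M) : Ck k U T f -> Ck k U T (fun x => J (f x)).
Proof. exact: Ck_app_clinear. Qed.

End SmoothMaps.

(** The quotient rule. The denominator m takes values in densities only along the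
    line through x in the direction h, not on an admissible set, so strict
    differentiability of [qinv] replaces the chain rule. *)
Lemma has_dderiv_qprod (f m g : nform M -> nform M) x h df dm dg :
  Dens (m x) ->
  has_dderiv f x h df -> has_dderiv m x h dm -> has_dderiv g x h dg ->
  (\forall t \near (0 : R)^', Dens (m (x + t *: h))) ->
  has_dderiv (fun y => qprod (f y) (m y) (g y)) x h
    (qprod df (m x) (g x) + qprod (f x) (m x) dg
     - qprod (qprod (f x) (m x) dm) (m x) (g x)).
Proof.
move=> m0 hf hm hg mt.
have hfin : has_dderiv (fun y => qinv lambda (m y)) x h (dqinv lambda (m x) dm).
  have C1 := Ck_qinv lambda_dens aD 1.
  have Df : has_dderiv (qinv lambda) (m x) dm (dqinv lambda (m x) dm).
    by apply: (qinv_has_dderiv lambda_dens m0); exact: (adm_near aD m0 (I : [set: nform M] dm)).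
  have quotE t : t != 0 -> m x + t *: diff_quot m x h t = m (x + t *: h).
    by move=> tn0; rewrite /diff_quot scalerA mulfV// scale1r addrC subrK.
  have : t^-1 *: (qinv lambda (m x + t *: diff_quot m x h t) - qinv lambda (m x))
      @[t --> (0 : R)^'] --> dderiv (qinv lambda) (m x) dm.
    apply: (Ck1_strict_dderiv aD C1) => //.
    - exact: cvg_cst.
    - exact: cvg_id0.
    - near=> t; have tn0 : t != 0 by near: t; exact: nbhs_dnbhs_neq.
      split=> //; rewrite quotE//; near: t; exact: mt.
  rewrite (dderivE Df); apply: cvg_trans; apply: near_eq_cvg; near=> t.
  have tn0 : t != 0 by near: t; exact: nbhs_dnbhs_neq.
  by rewrite quotE.
have h1 := has_dderiv_bilinear bil (has_dderiv_bilinear bil hf hfin) hg.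
have : has_dderiv (fun y => qprod (f y) (m y) (g y)) x h
    (qprod (qprod df lambda (qinv lambda (m x)) +
            qprod (f x) lambda (dqinv lambda (m x) dm)) lambda (g x)
     + qprod (qprod (f x) lambda (qinv lambda (m x))) lambda dg).
  apply: near_has_dderiv h1; first by rewrite -(qprod_qinv lambda_dens).
  apply: (@filterS _ (0 : R)^' _ _ _ _ mt) => t mt0.
  by rewrite -(qprod_qinv lambda_dens).
rewrite (_ : _ + _ = qprod df (m x) (g x) + qprod (f x) (m x) dg
  - qprod (qprod (f x) (m x) dm) (m x) (g x))//.
apply: form_eq => i p pi; have l0 := lambda_dens.
rewrite !(nformD, nformN) !qprodE// !(nformD, nformN, nformZ) !qprodE// /dqinv /qinv.
rewrite !(nformD, nformN, nformZ) !qprodE//.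
have ? := Dens_neq0 l0 pi; have ? := Dens_neq0 m0 pi.
by field; apply/andP.
Unshelve. all: by end_near. Qed.

(** The component of (u / mu) v in Tan, for the splitting of the space of forms as
    the sum of Tan and the line of mu. *)
Definition tan_qprod mu u v : nform M := qprod u mu v - J (qprod u mu v) *: mu.

Variable alpha : R.
Local Notation nabla := (@amari_cencov R n M alpha).
Let k := (1 + alpha) / 2.

Lemma amari_cencovE a b mu : Prob mu ->
  nabla a b mu = dderiv b mu (a mu) - k *: tan_qprod mu (a mu) (b mu).
Proof.
move=> [m0 _]; rewrite /amari_cencov RN_qprod// integral_wrt_RN//.
Qed.

Lemma vf_tan a mu : vector_field a -> Prob mu -> Tan (a mu).
Proof. by move=> [+ _]; apply. Qed.

Lemma vf_Ck a j : vector_field a -> Ck j (@Prob R n M) (@Tan R n M) a.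
Proof. by move=> [_]; apply. Qed.

Lemma vf_has_dderiv a mu u : vector_field a -> Prob mu -> Tan u ->
  has_dderiv a mu u (dderiv a mu u).
Proof. by move=> va; exact: (Ck1_has_dderiv (vf_Ck 1 va)). Qed.

Lemma tan_qprod_Tan mu u v : Prob mu -> Tan (tan_qprod mu u v).
Proof. by move=> [m0 m1]; rewrite /Tan /tan_qprod /= JB JZ m1 mulr1 subrr. Qed.

Lemma TanB u v : Tan u -> Tan v -> Tan (u - v).
Proof. by rewrite /Tan/= JB => -> ->; rewrite subrr. Qed.

Lemma TanZ (c : R) u : Tan u -> Tan (c *: u).
Proof. by rewrite /Tan/= JZ => ->; rewrite mulr0. Qed.

Lemma dderiv_tan b mu u : vector_field b -> Prob mu -> Tan u -> Tan (dderiv b mu u).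
Proof.
move=> vb mu0 Tu.
exact: (has_dderiv_in aP (adm_tangent aP) vb.1 mu0 Tu (vf_has_dderiv vb mu0 Tu)).
Qed.

Lemma vector_field_nabla a b : vector_field a -> vector_field b ->
  vector_field (nabla a b).
Proof.
move=> va vb; split=> [mu mu0|j].
  rewrite amari_cencovE//; apply: TanB; last by apply: TanZ; exact: tan_qprod_Tan.
  by apply: dderiv_tan => //; exact: vf_tan.
have Cq : Ck j (@Prob R n M) (@Tan R n M) (fun mu => qprod (a mu) mu (b mu)).
  by apply: (Ck_qprod aP) => //; [exact: Prob_Dens|exact: vf_Ck|exact: Ck_id|exact: vf_Ck].
have C1 : Ck j (@Prob R n M) (@Tan R n M)
    (fun mu => dderiv b mu (a mu) - k *: tan_qprod mu (a mu) (b mu)).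
  apply: (CkB aP).
    by apply: (Ck_dderiv_along aP va.1); exact: vf_Ck.
  apply: (CkZ aP); apply: (CkB aP) => //.
  by apply: (Ck_scale aP); [exact: (Ck_int aP)|exact: Ck_id].
by apply: (eq_Ck aP _ C1) => mu mu0; rewrite amari_cencovE.
Qed.

Lemma tan_qprodDl mu u v w : Dens mu ->
  tan_qprod mu (u + v) w = tan_qprod mu u w + tan_qprod mu v w.
Proof. by move=> m0; rewrite /tan_qprod qprodDl// JD scalerDl opprD addrACA. Qed.

Lemma tan_qprodZl mu (s : R) u w : Dens mu -> tan_qprod mu (s *: u) w = s *: tan_qprod mu u w.
Proof. by move=> m0; rewrite /tan_qprod qprodZl// JZ scalerBr scalerA. Qed.

Lemma tan_qprodC mu u v : Dens mu -> tan_qprod mu u v = tan_qprod mu v u.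
Proof. by move=> m0; rewrite /tan_qprod qprodC. Qed.

Lemma amari_cencov_affine : affine_connection nabla.
Proof.
split.
- exact: vector_field_nabla.
- move=> f a a' b sf va va' vb mu mu0; have m0 := Prob_Dens mu0.
  have Ta := vf_tan va mu0; have Ta' := vf_tan va' mu0.
  rewrite !amari_cencovE// (dderivD aP (vf_Ck 1 vb))//; last exact: TanZ.
  rewrite (dderivZ _ (vf_Ck 1 vb))// tan_qprodDl// tan_qprodZl// [k *: (_ + _)]scalerDr opprD addrACA.
  by congr (_ + _); rewrite [RHS]scalerBr !scalerA mulrC.
- move=> a b b' va vb vb' mu mu0; have m0 := Prob_Dens mu0.
  have Ta := vf_tan va mu0.
  rewrite !amari_cencovE// (dderivE (has_dderivD (vf_has_dderiv vb mu0 Ta) (vf_has_dderiv vb' mu0 Ta))).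
  by rewrite !(tan_qprodC (a mu))// tan_qprodDl// scalerDr opprD addrACA.
- move=> f a b sf va vb mu mu0; have m0 := Prob_Dens mu0.
  have Ta := vf_tan va mu0.
  have hf : has_dderiv f mu (a mu) (dderiv f mu (a mu)) by exact: (Ck1_has_dderiv (sf 1)).
  rewrite !amari_cencovE// (dderivE (has_dderiv_bilinear (scale_cbilinear _) hf (vf_has_dderiv vb mu0 Ta))).
  rewrite !(tan_qprodC (a mu))// tan_qprodZl//; move: (tan_qprod _ _ _) => X.
  by rewrite scalerBr addrA !scalerA (mulrC k).
Qed.

Lemma amari_cencov_torsion_free : torsion_free nabla.
Proof.
move=> a b va vb mu mu0; rewrite !amari_cencovE// (tan_qprodC (a mu)); last exact: Prob_Dens.
by rewrite opprB addrA subrK.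
Qed.

Lemma cst_field u : Tan u -> vector_field (fun=> u).
Proof. by move=> Tu; split=> // j; exact: Ck_cst. Qed.

Let aG := adm_prod aP (adm_prod (adm_tangent aP) (adm_tangent aP)).

Lemma Ck_metric_args k' :
  [/\ Ck k' (@Prob R n M `*` (@Tan R n M `*` @Tan R n M)) (@Tan R n M `*` (@Tan R n M `*` @Tan R n M))
        (fun z : nform M * (nform M * nform M) => z.1),
      Ck k' (@Prob R n M `*` (@Tan R n M `*` @Tan R n M)) (@Tan R n M `*` (@Tan R n M `*` @Tan R n M))
        (fun z : nform M * (nform M * nform M) => z.2.1)
    & Ck k' (@Prob R n M `*` (@Tan R n M `*` @Tan R n M)) (@Tan R n M `*` (@Tan R n M `*` @Tan R n M))
        (fun z : nform M * (nform M * nform M) => z.2.2)].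
Proof.
split.
- by apply: Ck_clinear; exact: clinear_fst.
- by apply: (Ck_clinear _ _ _ (clinear_comp (clinear_snd _ _) (clinear_fst _ _))).
- by apply: (Ck_clinear _ _ _ (clinear_comp (clinear_snd _ _) (clinear_snd _ _))).
Qed.

Lemma Prob_near mu u : Prob mu -> Tan u ->
  \forall t \near (0 : R)^', Dens (mu + t *: u).
Proof.
by move=> mu0 Tu; apply: (@filterS _ (0 : R)^' _ _ _ _ (adm_near aP mu0 Tu)) => t /Prob_Dens.
Qed.

Lemma has_dderiv_fisher b c mu u : vector_field b -> vector_field c ->
  Prob mu -> Tan u ->
  has_dderiv (fun nu => J (qprod (b nu) nu (c nu))) mu u
    (J (qprod (dderiv b mu u) mu (c mu)) + J (qprod (b mu) mu (dderiv c mu u))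
     - J (qprod (qprod (b mu) mu u) mu (c mu))).
Proof.
move=> vb vc mu0 Tu; rewrite -JD -JB; apply: (has_dderiv_clinear J_lin).
apply: (has_dderiv_qprod (m := id)); [exact: Prob_Dens|exact: vf_has_dderiv|
  exact: has_dderiv_id|exact: vf_has_dderiv|exact: Prob_near].
Qed.

Lemma eq_metric_compatible (g g' : nform M -> nform M -> nform M -> R) :
  (forall mu u v, Prob mu -> g mu u v = g' mu u v) ->
  compatible nabla g' -> compatible nabla g.
Proof.
move=> gg cg b c d vb vc vd mu mu0.
rewrite !gg// -cg//; apply: (eq_dderiv aP) => //; last exact: vf_tan.
by move=> nu nu0; rewrite gg.
Qed.

Lemma eq_riemannian (g g' : nform M -> nform M -> nform M -> R) :
  (forall mu u v, Prob mu -> g mu u v = g' mu u v) -> riemannian_metric g' -> riemannian_metric g.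
Proof.
move=> gg [Cg lg sg pg]; split.
- by move=> j; apply: (eq_Ck aG _ (Cg j)) => -[mu [u v]] [/= mu0 _]; rewrite gg.
- by move=> *; rewrite !gg//; exact: lg.
- by move=> *; rewrite !gg//; exact: sg.
- by move=> *; rewrite !gg//; exact: pg.
Qed.

Lemma fisher_rao_mixtureE u v mu : Prob mu ->
  fisher_rao lambda (- 1) mu u v = J (qprod u lambda v).
Proof.
move=> mu0; rewrite /fisher_rao.
have -> : (fun p => RN mu lambda p `^ (- -1 - 1) * RN u lambda p * RN v lambda p) =
    RN (qprod u lambda v) lambda.
  rewrite -(RN_qprod _ _ lambda_dens lambda_dens); apply/funext => p.
  by rewrite opprK subrr powRr0 mul1r.
by rewrite integral_wrt_RN//; exact: lambda_dens.
Qed.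

Lemma fisher_rao_zeroE u v mu : Prob mu ->
  fisher_rao lambda 0 mu u v = J (qprod u mu v).
Proof.
move=> mu0; have m0 := Prob_Dens mu0; rewrite /fisher_rao.
have -> : (fun p => RN mu lambda p `^ (- 0 - 1) * RN u lambda p * RN v lambda p) =
    RN (qprod u mu v) lambda.
  apply/funext => p; rewrite oppr0 sub0r.
  have l0 := lambda_dens; have pi := chart_atP p.
  have := Dens_gt0 l0 pi; have := Dens_gt0 m0 pi => mp lp.
  rewrite powR_inv1; last by rewrite /RN divr_ge0// ltW.
  rewrite /RN qprodE//; field.
  by rewrite !gt_eqF.
by rewrite integral_wrt_RN//; exact: lambda_dens.
Qed.

(** The covariance under lambda of the logarithmic derivatives u / mu and v / mu. *)
Definition log_cov mu u v : R :=
  J (qprod (qprod u mu lambda) mu v) - J (qprod u mu lambda) * J (qprod v mu lambda).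

Lemma GtildeE u v mu : Prob mu -> Gtilde lambda mu u v = log_cov mu u v.
Proof.
move=> mu0; have m0 := Prob_Dens mu0; have l0 := lambda_dens; rewrite /Gtilde /log_cov.
have E1 : (fun p => RN u mu p * RN v mu p) = RN (qprod (qprod u mu lambda) mu v) lambda.
  apply/funext => p; have pi := chart_atP p.
  have := Dens_gt0 l0 pi; have := Dens_gt0 m0 pi => mp lp.
  by rewrite /RN !qprodE//; field; rewrite !gt_eqF.
have E2 w : RN w mu = RN (qprod w mu lambda) lambda.
  apply/funext => p; have pi := chart_atP p.
  have := Dens_gt0 l0 pi; have := Dens_gt0 m0 pi => mp lp.
  by rewrite /RN !qprodE//; field; rewrite !gt_eqF.
by rewrite E1 (E2 u) (E2 v) !integral_wrt_RN.
Qed.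

Lemma mixture_riemannian : riemannian_metric (fun _ u v => J (qprod u lambda v)).
Proof.
have l0 := lambda_dens; split.
- move=> j; have [_ C1 C2] := Ck_metric_args j.
  by apply: (Ck_int aG); apply: (Ck_app_cbilinear aG bil).
- by move=> mu s u v w _ _ _ _; rewrite qprodDl// qprodZl// JD JZ.
- by move=> mu u v _ _ _; rewrite qprodC.
- by move=> mu u _ _; exact: qprod_gt0.
Qed.

Lemma fisher_riemannian : riemannian_metric (fun mu u v => J (qprod u mu v)).
Proof.
split.
- move=> j; have [C0 C1 C2] := Ck_metric_args j.
  apply: (Ck_int aG); apply: (Ck_qprod aG) => //.
  by move=> z [/Prob_Dens].
- by move=> mu s u v w /Prob_Dens m0 _ _ _; rewrite qprodDl// qprodZl// JD JZ.
- by move=> mu u v /Prob_Dens m0 _ _; rewrite qprodC.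
- by move=> mu u /Prob_Dens m0 _; exact: qprod_gt0.
Qed.

(** Positivity: the variance of u / mu is the integral of (u / mu - s)^2 lambda,
    where s is the mean. It vanishes only if u = s mu, and then s = 0, since u
    has integral 0 and mu has integral 1. *)
Lemma log_cov_riemannian : riemannian_metric log_cov.
Proof.
have l0 := lambda_dens; split.
- move=> j; have [C0 C1 C2] := Ck_metric_args j.
  have Cl : Ck j (@Prob R n M `*` (@Tan R n M `*` @Tan R n M)) (@Tan R n M `*` (@Tan R n M `*` @Tan R n M))
        (fun _ : nform M * (nform M * nform M) => lambda) by exact: Ck_cst.
  have m0 (z : nform M * (nform M * nform M)) :
    (@Prob R n M `*` (@Tan R n M `*` @Tan R n M)) z -> Dens z.1 by move=> [/Prob_Dens].
  apply: (CkB aG).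
    by apply: (Ck_int aG); apply: (Ck_qprod aG) => //; exact: (Ck_qprod aG).
  by apply: (Ck_scale (F := R) aG); apply: (Ck_int aG); exact: (Ck_qprod aG).
- move=> mu s u v w /Prob_Dens m0 _ _ _; rewrite /log_cov !(qprodDl, qprodZl)// !(JD, JZ).
  by ring.
- move=> mu u v /Prob_Dens m0 _ _; rewrite /log_cov mulrC qprodC//.
  by congr (J _ - _); apply: form_eq => i p pi; rewrite !qprodE//; ring.
- move=> mu u mu0 Tu u0; have m0 := Prob_Dens mu0.
  set s := J (qprod u mu lambda).
  have -> : log_cov mu u u = J (qprod (qprod (u - s *: mu) mu lambda) mu (u - s *: mu)).
    have -> : qprod (qprod (u - s *: mu) mu lambda) mu (u - s *: mu) =
        qprod (qprod u mu lambda) mu u - (2 * s) *: qprod u mu lambda + (s ^+ 2) *: lambda.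
      apply: form_eq => i p pi.
      rewrite !(nformD, nformN, nformZ) !qprodE// !(nformD, nformN, nformZ).
      have ? := Dens_neq0 m0 pi; by field.
    by rewrite JD JB !JZ (Prob_int lambda_prob) /log_cov -/s; ring.
  set x := u - s *: mu.
  have x0 : x != 0.
    apply: contra u0 => /eqP x0; have E0 : u = s *: mu by apply/eqP; rewrite -subr_eq0 -/x x0.
    have : J u = 0 := Tu.
    by rewrite E0 JZ (Prob_int mu0) mulr1 => ->; rewrite scale0r.
  apply: (integral_form_gt0 pu_ok).
    move=> i p pi; rewrite !qprodE//.
    have -> : x i p / mu i p * lambda i p / mu i p * x i p =
        (x i p / mu i p) ^+ 2 * lambda i p by ring.
    by rewrite mulr_ge0 ?sqr_ge0// ltW// Dens_gt0.
  apply: contra x0 => /eqP E0; apply/eqP/form_eq => i p pi.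
  have : qprod (qprod x mu lambda) mu x i p = 0 by rewrite E0.
  rewrite !qprodE//.
  have -> : x i p / mu i p * lambda i p / mu i p * x i p =
        (x i p / mu i p) ^+ 2 * lambda i p by ring.
  move/eqP; rewrite mulf_eq0 (negbTE (Dens_neq0 l0 pi)) orbF sqrf_eq0 mulf_eq0.
  by rewrite invr_eq0 (negbTE (Dens_neq0 m0 pi)) orbF => /eqP.
Qed.

Lemma mixture_compatible : alpha = -1 -> compatible nabla (fun _ u v => J (qprod u lambda v)).
Proof.
move=> a1 b c d vb vc vd mu mu0; have l0 := lambda_dens.
have Tb := vf_tan vb mu0.
have k0 : k = 0 by rewrite /k a1 subrr mul0r.
rewrite !amari_cencovE// k0 !scale0r !subr0 -JD; apply: dderivE.
apply: (has_dderiv_clinear J_lin).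
by apply: (has_dderiv_bilinear bil); exact: vf_has_dderiv.
Qed.

(** Tangent vectors are orthogonal to mu. *)
Lemma integral_tan_qprod mu u v w : Prob mu -> Tan w ->
  J (qprod (tan_qprod mu u v) mu w) = J (qprod (qprod u mu v) mu w).
Proof.
move=> mu0 Tw; have m0 := Prob_Dens mu0.
rewrite /tan_qprod qprodBl// qprodZl// qprod_idl// JB JZ.
by have -> : J w = 0 by []; rewrite mulr0 subr0.
Qed.

Lemma fisher_compatible : alpha = 0 -> compatible nabla (fun mu u v => J (qprod u mu v)).
Proof.
move=> a0 b c d vb vc vd mu mu0; have m0 := Prob_Dens mu0.
have Tb := vf_tan vb mu0; have Tc := vf_tan vc mu0; have Td := vf_tan vd mu0.
rewrite (dderivE (has_dderiv_fisher vc vd mu0 Tb)) !amari_cencovE//.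
rewrite qprodBl// qprodZl// qprodBr// qprodZr// !JB !JZ (qprodC (c mu) (tan_qprod _ _ _))//.
rewrite (@integral_tan_qprod mu (b mu) (c mu) (d mu) mu0 Td).
rewrite (@integral_tan_qprod mu (b mu) (d mu) (c mu) mu0 Tc).
have E1 : qprod (qprod (b mu) mu (c mu)) mu (d mu) =
    qprod (qprod (c mu) mu (b mu)) mu (d mu) by rewrite (qprodC (b mu)).
have E2 : qprod (qprod (b mu) mu (d mu)) mu (c mu) =
    qprod (qprod (c mu) mu (b mu)) mu (d mu).
  by apply: form_eq => i p pi; rewrite !qprodE//; ring.
by rewrite E1 E2 /k a0; field.
Qed.

(** For k = 1, (nabla_b c) / mu is the derivative of c / mu along b plus the constant
    <b, c>, and adding constants does not change a covariance. In the proof X1, Y1,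
    Y2 are the forms occurring in the derivative of the metric, Z1, Z2, W1, W2 those
    occurring in the terms with nabla, and s, s' the two constants. *)
Lemma log_cov_compatible : alpha = 1 -> compatible nabla log_cov.
Proof.
move=> a1 b c d vb vc vd mu mu0; have m0 := Prob_Dens mu0; have l0 := lambda_dens.
have Tb := vf_tan vb mu0.
have near0 := Prob_near mu0 Tb.
have hb := vf_has_dderiv vc mu0 Tb; have hc := vf_has_dderiv vd mu0 Tb.
set c' := dderiv c mu (b mu) in hb; set d' := dderiv d mu (b mu) in hc.
have hl := has_dderiv_cst lambda mu (b mu).
have hid := @has_dderiv_id R (nform M) mu (b mu).
have h1 (f : nform M -> nform M) w' : has_dderiv f mu (b mu) w' ->
    has_dderiv (fun nu => qprod (f nu) nu lambda) mu (b mu)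
      (qprod w' mu lambda + qprod (f mu) mu 0 - qprod (qprod (f mu) mu (b mu)) mu lambda).
  by move=> hf; exact: (has_dderiv_qprod (m := id) m0 hf hid hl near0).
have h2 := has_dderiv_qprod (m := id) m0 (h1 _ _ hb) hid hc near0.
have h3 := has_dderivB (has_dderiv_clinear J_lin h2)
  (has_dderivM (has_dderiv_clinear J_lin (h1 _ _ hb)) (has_dderiv_clinear J_lin (h1 _ _ hc))).
rewrite (dderivE h3) !amari_cencovE// -/c' -/d' /k a1.
have -> : (1 + 1) / 2 = 1 :> R by field.
rewrite !scale1r /log_cov {h1 h2 h3}.
move: (b mu) (c mu) (d mu) (c' : nform M) (d' : nform M) => u v w v' w'.
set X1 := (X in J X - (_ + _)); set Y1 := (X in J X * J (qprod w mu lambda) + _).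
set Y2 := (X in _ + J (qprod v mu lambda) * J X).
set Z1 := (X in _ = J X - _ * _ + _); set W1 := (X in _ = _ - J X * _ + _).
set Z2 := (X in _ = _ + (J X - _)); set W2 := (X in _ = _ + (_ - _ * J X)).
set C := qprod v mu lambda; set D := qprod w mu lambda.
set s := J (qprod u mu v); set s' := J (qprod u mu w).
have E1 : W1 = Y1 + s *: lambda.
  apply: form_eq => i p pi; have ? := Dens_neq0 m0 pi.
  rewrite /W1 /Y1 nformD nformZ !(nformD, nformN) !qprodE// !(nformD, nformN, nformZ) !qprodE// -/s ?nform0.
  by field.
have E2 : W2 = Y2 + s' *: lambda.
  apply: form_eq => i p pi; have ? := Dens_neq0 m0 pi.
  rewrite /W2 /Y2 nformD nformZ !(nformD, nformN) !qprodE// !(nformD, nformN, nformZ) !qprodE// -/s' ?nform0.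
  by field.
have E3 : Z1 + Z2 = X1 + (s *: D + s' *: C).
  apply: form_eq => i p pi; have ? := Dens_neq0 m0 pi.
  rewrite /Z1 /Z2 /X1 !(nformD, nformN, nformZ) /C /D !qprodE//.
  rewrite !(nformD, nformN, nformZ) !qprodE// ?(nformD, nformN, nformZ) -/s -/s' ?nform0.
  by field.
have J1 : J W1 = J Y1 + s by rewrite E1 JD JZ (Prob_int lambda_prob) mulr1.
have J2 : J W2 = J Y2 + s' by rewrite E2 JD JZ (Prob_int lambda_prob) mulr1.
have J3 : J Z1 + J Z2 = J X1 + (s * J D + s' * J C).
  by rewrite -(JD Z1 Z2) E3 (JD X1 _) (JD (s *: D) _) (JZ s D) (JZ s' C).
clear E1 E2 E3; clearbody s s'; clearbody X1 Y1 Y2 Z1 Z2 W1 W2 C D.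
move: J1 J2 J3; move: (J W1) (J W2) (J Y1) (J Y2) (J Z1) (J Z2) (J X1) (J D) (J C).
move=> jw1 jw2 jy1 jy2 jz1 jz2 jx1 jd jc -> -> J3.
have -> : jx1 = jz1 + jz2 - (s * jd + s' * jc) by rewrite J3 addrK.
by ring.
Qed.

End Connection.

(** * Curvature and the absence of compatible metrics *)

Section Curvature.
Variables (R : realType) (n : nat) (M : closedOrientedManifold R n).
Variable lambda : nform M.
Hypothesis lambda_prob : Prob lambda.
Variable alpha : R.
Implicit Types (a b c : nform M -> nform M) (mu u v w : nform M).

Local Notation J := (@integral_form R n M).
Local Notation nabla := (@amari_cencov R n M alpha).
Let k := (1 + alpha) / 2.

Let pok := pu_ok lambda_prob.
Let aP : admissible (@Prob R n M) (@Tan R n M) := Prob_admissible pok.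
Let J_lin := integral_form_clinear pok.
Let JD := integral_formD pok.
Let JZ := integral_formZ pok.
Let JB := integral_formB pok.

(** Covariant derivatives of constant vector fields suffice for the curvature. *)
Definition cst_nabla u v := nabla (fun=> u) (fun=> v).

Lemma cst_nablaE u v mu : Prob mu -> cst_nabla u v mu = (- k) *: tan_qprod mu u v.
Proof.
move=> mu0; rewrite /cst_nabla amari_cencovE//.
by rewrite (dderivE (has_dderiv_cst _ _ _)) sub0r scaleNr.
Qed.

Lemma cst_nabla_vf u v : Tan u -> Tan v -> vector_field (cst_nabla u v).
Proof. by move=> Tu Tv; apply: (vector_field_nabla lambda_prob); exact: cst_field. Qed.

(** The first summand is symmetric in u and u', so the curvature only sees the
    second one, whose factor k - k^2 vanishes for alpha = -1 and alpha = 1. *)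
Lemma cst_nabla_nabla u u' v mu : Prob mu -> Tan u -> Tan u' -> Tan v ->
  nabla (fun=> u') (cst_nabla u v) mu =
  (k + k ^+ 2) *: (qprod (qprod u mu u') mu v - J (qprod (qprod u mu u') mu v) *: mu)
  + ((k - k ^+ 2) * J (qprod u mu v)) *: u'.
Proof.
move=> mu0 Tu Tu' Tv; have m0 := Prob_Dens mu0.
rewrite amari_cencovE// cst_nablaE//.
set X := qprod (qprod u mu u') mu v.
have hid := @has_dderiv_id R (nform M) mu u'.
have hq : has_dderiv (fun nu => qprod u nu v) mu u' (- X).
  have := has_dderiv_qprod lambda_prob (m := id) m0 (has_dderiv_cst u mu u') hid
    (has_dderiv_cst v mu u') (Prob_near lambda_prob mu0 Tu').
  rewrite (_ : _ + _ - _ = - X)//; apply: form_eq => i p pi.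
  by rewrite /X !(nformD, nformN) !qprodE// !nform0; ring.
have hP : has_dderiv (fun nu => (- k) *: tan_qprod nu u v) mu u'
    ((- k) *: (- X - (J (- X) *: mu + J (qprod u mu v) *: u'))).
  apply: has_dderivZl; apply: has_dderivB => //.
  exact: (has_dderiv_bilinear (scale_cbilinear _) (has_dderiv_clinear J_lin hq) hid).
have -> : dderiv (cst_nabla u v) mu u' =
    (- k) *: (- X - (J (- X) *: mu + J (qprod u mu v) *: u')).
  rewrite -(dderivE hP); apply: (eq_dderiv aP) => // nu nu0; exact: cst_nablaE.
have JX : J (- X) = - J X by rewrite -scaleN1r JZ mulN1r.
have JP : J (qprod u' mu ((- k) *: tan_qprod mu u v)) = (- k) * J X.
  rewrite qprodZr// JZ qprodC// (integral_tan_qprod lambda_prob _ _ mu0 Tu'); congr (_ * J _).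
  by apply: form_eq => i p pi; rewrite /X !qprodE//; ring.
rewrite JX /(tan_qprod mu u' _) JP; apply: form_eq => i p pi.
rewrite !(nformD, nformN, nformZ) qprodE// !(nformD, nformN, nformZ).
have -> : X i p = u i p / mu i p * u' i p / mu i p * v i p by rewrite /X !qprodE.
rewrite qprodE// -/k; have ? := Dens_neq0 m0 pi.
set jx := J X; set s := J _.
by field.
Qed.

Section Metric.
Variable g : nform M -> nform M -> nform M -> R.
Hypothesis g_metric : riemannian_metric g.
Hypothesis g_compat : compatible nabla g.

Let aG := adm_prod aP (adm_prod (adm_tangent aP) (adm_tangent aP)).

Lemma metric_linear mu (s : R) u v w : Prob mu -> Tan u -> Tan v -> Tan w ->
  g mu (s *: u + v) w = s * g mu u w + g mu v w.
Proof. by have [_ + _ _] := g_metric; exact. Qed.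

Lemma metricC mu u v : Prob mu -> Tan u -> Tan v -> g mu u v = g mu v u.
Proof. by have [_ _ + _] := g_metric; exact. Qed.

Lemma Tan0 : Tan (0 : nform M). Proof. exact: (integral_form0 pok). Qed.

Lemma metric0l mu w : Prob mu -> Tan w -> g mu 0 w = 0.
Proof.
move=> mu0 Tw; have := metric_linear (-1) mu0 Tan0 Tan0 Tw.
by rewrite scaler0 addr0 mulN1r addNr.
Qed.

Lemma metricZl mu (s : R) u w : Prob mu -> Tan u -> Tan w -> g mu (s *: u) w = s * g mu u w.
Proof. by move=> mu0 Tu Tw; rewrite -[s *: u]addr0 metric_linear ?metric0l ?addr0//; exact: Tan0. Qed.

Lemma metricDl mu u v w : Prob mu -> Tan u -> Tan v -> Tan w ->
  g mu (u + v) w = g mu u w + g mu v w.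
Proof. by move=> mu0 Tu Tv Tw; rewrite -[u in LHS]scale1r metric_linear// mul1r. Qed.

Lemma metric_smooth b c : vector_field b -> vector_field c ->
  Csmooth (@Prob R n M) (@Tan R n M) (fun nu => g nu (b nu) (c nu)).
Proof.
move=> vb vc j; have [Cg _ _ _] := g_metric.
have Cp : Ck j (@Prob R n M) (@Tan R n M) (fun nu => (nu, (b nu, c nu))).
  by apply: (Ck_pair aP); [exact: Ck_id|apply: (Ck_pair aP); exact: vf_Ck].
apply: (Ck_comp aP aG _ Cp (Cg j)) => nu nu0.
by split=> //; split; exact: vf_tan.
Qed.

Lemma metric_dderiv b c mu u : vector_field b -> vector_field c -> Prob mu -> Tan u ->
  has_dderiv (fun nu => g nu (b nu) (c nu)) mu u
    (g mu (nabla (fun=> u) b mu) (c mu) + g mu (b mu) (nabla (fun=> u) c mu)).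
Proof.
move=> vb vc mu0 Tu; rewrite -(g_compat (cst_field Tu) vb vc mu0).
exact: (Ck1_has_dderiv (metric_smooth vb vc 1)).
Qed.

Hypothesis k_nondeg : k - k ^+ 2 != 0.

(** The second derivatives of g(v, v) along the constant fields u and u' commute.
    Expanding them by compatibility leaves that the curvature of u and u' applied
    to v is g-orthogonal to v. *)
Lemma curvature_identity mu u u' v : Prob mu -> Tan u -> Tan u' -> Tan v ->
  J (qprod u mu v) * g mu u' v = J (qprod u' mu v) * g mu u v.
Proof.
move=> mu0 Tu Tu' Tv; have m0 := Prob_Dens mu0.
have vv := cst_field Tv.
pose H nu := g nu v v.
have dH nu w : Prob nu -> Tan w -> dderiv H nu w = 2 * g nu (cst_nabla w v nu) v.
  move=> nu0 Tw; rewrite (dderivE (metric_dderiv vv vv nu0 Tw)) -/(cst_nabla w v).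
  have TB := vf_tan (cst_nabla_vf Tw Tv) nu0.
  by rewrite (metricC nu0 Tv TB) mulr2n mulrDl mul1r.
have ddH w w' : Tan w -> Tan w' -> dderiv (fun nu => dderiv H nu w) mu w' =
    2 * (g mu (nabla (fun=> w') (cst_nabla w v) mu) v + g mu (cst_nabla w v mu) (cst_nabla w' v mu)).
  move=> Tw Tw'.
  rewrite (eq_dderiv aP (g := fun nu => 2 * g nu (cst_nabla w v nu) v) (fun nu nu0 => dH nu w nu0 Tw) mu0 Tw').
  apply: dderivE; apply: (has_dderivZl (F := R)).
  exact: (metric_dderiv (cst_nabla_vf Tw Tv) vv mu0 Tw').
have := dderiv_sym aP (metric_smooth vv vv) mu0 Tu Tu'.
rewrite (ddH _ _ Tu Tu') (ddH _ _ Tu' Tu).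
have TB := vf_tan (cst_nabla_vf Tu Tv) mu0; have TB' := vf_tan (cst_nabla_vf Tu' Tv) mu0.
rewrite (metricC mu0 TB' TB) => /(mulfI (_ : 2 != 0 :> R)) => /(_ ltac:(by rewrite pnatr_eq0)).
move=> /addIr; rewrite !cst_nabla_nabla// (qprodC u')//.
set Y := _ - _; have TY : Tan Y by exact: (tan_qprod_Tan lambda_prob).
have TZ s w : Tan w -> Tan (s *: w) by exact: (TanZ lambda_prob).
rewrite !(metric_linear _ mu0)//; try exact: TZ.
rewrite !metricZl// => /addrI; rewrite -!mulrA => /(mulfI k_nondeg).
by [].
Qed.

(** At lambda, b and c are orthogonal, hence also g-orthogonal. Differentiating
    <b, b> g(c, b) = <c, b> g(b, b) in the direction a = (b / lambda) c therefore
    only involves the derivatives of g(c, b), on the left, and of <c, b>, on the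
    right. With T = <a, a>, the former gives - 2 k T g(b, b), since each of the two
    terms of compatibility is - k T g(b, b) / <b, b>, and the latter - T g(b, b). *)
Lemma compatible_metric_half (b c : nform M) :
  Tan b -> Tan c -> J (qprod b lambda c) = 0 -> qprod b lambda c != 0 -> 2 * k = 1.
Proof.
move=> Tb Tc bc0 a0; have m0 := lambda_dens lambda_prob.
have mu0 := lambda_prob.
set a := qprod b lambda c in bc0 a0.
have Ta : Tan a := bc0.
have b0 : b != 0.
  apply: contra a0 => /eqP b0; apply/eqP/form_eq => i p pi.
  by rewrite /a b0 qprodE// !nform0; ring.
have c0 : c != 0.
  apply: contra a0 => /eqP c0; apply/eqP/form_eq => i p pi.
  by rewrite /a c0 qprodE// !nform0; ring.
have B0 := qprod_gt0 lambda_prob m0 b0; have C0 := qprod_gt0 lambda_prob m0 c0.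
have T0 := qprod_gt0 lambda_prob m0 a0.
set B := J (qprod b lambda b) in B0; set C := J (qprod c lambda c) in C0.
set T := J (qprod a lambda a) in T0.
have gb0 : 0 < g lambda b b by have [_ _ _ +] := g_metric; apply.
have cb0 : J (qprod c lambda b) = 0 by rewrite qprodC.
have gcb : g lambda c b = 0.
  have := curvature_identity mu0 Tb Tc Tb; rewrite cb0 mul0r -/B => /eqP.
  by rewrite mulf_eq0 gt_eqF//= => /eqP.
have Tbc : Tan (b + c) by move: Tb Tc; rewrite /Tan/= JD => -> ->; rewrite addr0.
(* Polarisation: the curvature identity for b, c against b + c. *)
have gBC : B * g lambda c c = C * g lambda b b.
  have := curvature_identity mu0 Tb Tc Tbc.
  rewrite !qprodDr// !JD bc0 cb0 addr0 add0r -/B -/C.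
  rewrite (metricC mu0 Tc Tbc) (metricC mu0 Tb Tbc) !metricDl// gcb (metricC mu0 Tb Tc) gcb.
  by rewrite add0r addr0.
pose P v := tan_qprod lambda a v.
have TP v : Tan (P v) by exact: (tan_qprod_Tan lambda_prob).
have JPcb : J (qprod (P c) lambda b) = T.
  rewrite (integral_tan_qprod lambda_prob _ _ mu0 Tb); congr J.
  by apply: form_eq => i p pi; rewrite /a !qprodE//; ring.
have JPbc : J (qprod (P b) lambda c) = T.
  rewrite (integral_tan_qprod lambda_prob _ _ mu0 Tc); congr J.
  by apply: form_eq => i p pi; rewrite /a !qprodE//; ring.
have g1 : B * g lambda (P c) b = T * g lambda b b.
  by rewrite /B (curvature_identity mu0 Tb (TP c) Tb) JPcb.
have g2 : B * g lambda (P b) c = T * g lambda b b.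
  have := curvature_identity mu0 Tc (TP b) Tc; rewrite JPbc -/C => gC2.
  apply: (mulfI (_ : C != 0)); first by rewrite gt_eqF.
  by rewrite mulrCA gC2 mulrCA gBC mulrCA.
have vb := cst_field Tb; have vc := cst_field Tc.
have hg v w : Tan v -> Tan w -> has_dderiv (fun nu => g nu v w) lambda a
    (- k * (g lambda (P v) w + g lambda v (P w))).
  move=> Tv Tw.
  have := metric_dderiv (cst_field Tv) (cst_field Tw) mu0 Ta.
  rewrite -/(cst_nabla a v) -/(cst_nabla a w) !cst_nablaE//.
  rewrite -/(P v) -/(P w) (metricZl _ mu0 (TP v) Tw).
  rewrite (metricC mu0 Tv (TanZ lambda_prob _ (TP w))) (metricZl _ mu0 (TP w) Tv).
  by rewrite (metricC mu0 (TP w) Tv) -mulrDr.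
have hJ v w : Tan v -> Tan w -> has_dderiv (fun nu => J (qprod v nu w)) lambda a
    (- J (qprod (qprod v lambda a) lambda w)).
  move=> Tv Tw.
  have := has_dderiv_fisher lambda_prob (cst_field Tv) (cst_field Tw) mu0 Ta.
  rewrite !(dderivE (has_dderiv_cst _ _ _)).
  have -> : qprod 0 lambda w = 0 by apply: form_eq => i p pi; rewrite qprodE// nform0; ring.
  have -> : qprod v lambda 0 = 0 by apply: form_eq => i p pi; rewrite qprodE// nform0; ring.
  by rewrite (integral_form0 pok) add0r sub0r.
have E1 := has_dderivM (hJ _ _ Tb Tb) (hg _ _ Tc Tb).
have E2 := has_dderivM (hJ _ _ Tc Tb) (hg _ _ Tb Tb).
have E12 : forall nu, Prob nu -> J (qprod b nu b) * g nu c b = J (qprod c nu b) * g nu b b.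
  by move=> nu nu0; exact: curvature_identity.
have := eq_has_dderiv aP E12 mu0 Ta E1.
move=> /(has_dderiv_unique E2); rewrite cb0 gcb mulr0 mul0r add0r addr0 -/B.
have -> : J (qprod (qprod c lambda a) lambda b) = T.
  by congr J; apply: form_eq => i p pi; rewrite /a !qprodE//; ring.
rewrite (metricC mu0 Tc (TP b)) mulrCA mulrDr g1 g2 => E.
have Tg : T * g lambda b b != 0 by rewrite mulf_neq0// gt_eqF.
apply: (mulIf Tg); rewrite mul1r; apply: oppr_inj.
by rewrite -[RHS]mulNr E; ring.
Qed.

End Metric.

Lemma manifold_nonempty : [set: M] !=set0.
Proof.
apply: contrapT => M0.
have l0 : lambda = 0 by apply: form_eq => i p; exfalso; apply: M0; exists p.
have := Prob_int lambda_prob; rewrite l0 (integral_form0 pok) => /esym/eqP.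
by rewrite oner_eq0.
Qed.

(** Gram-Schmidt for 1, u, u^2 with the centred function u = f - m: take b = u lambda
    and c = (u^2 - r u - q) lambda, with q and r making c centred and orthogonal to
    b. The product bc vanishes only where u is a root of the cubic
    u (u^2 - r u - q), whereas f takes a whole interval of values. *)
Lemma exists_orthogonal_pair : (1 <= n)%N -> exists b c : nform M,
  [/\ Tan b, Tan c, J (qprod b lambda c) = 0 & qprod b lambda c != 0].
Proof.
move=> n1; have l0 := lambda_dens lambda_prob.
have [f fs [d d0 fd]] := smooth_fun_interval pok n1 manifold_nonempty.
pose phi := fmul f lambda; pose m := J phi; pose b := phi - m *: lambda.
have bE i p : b i p = (f p - m) * lambda i p.
  by rewrite /b nformD nformN nformZ smooth_fmulE// mulrBl.
have Tb : Tan b by rewrite /Tan/= JB JZ (Prob_int lambda_prob) mulr1 subrr.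
have val0 u (h : R -> R) : (forall i p, u i p = h (f p - m) * lambda i p) -> u = 0 ->
    forall y, 0 < y < d -> h (y - m) = 0.
  move=> uE u0 y /fd[p <-]; have pi := chart_atP p.
  have : u (chart_at p) p = 0 by rewrite u0.
  by rewrite uE => /eqP; rewrite mulf_eq0 (negbTE (Dens_neq0 l0 pi)) orbF => /eqP.
have b0 : b != 0.
  apply/eqP => /(val0 b id bE) h.
  have h1 : d / 2 - m = 0 by apply: h; lra.
  have h2 : d / 3 - m = 0 by apply: h; lra.
  by lra.
clearbody b.
have cE (r q : R) i p : dom i p ->
    qprod b lambda (qprod b lambda b - r *: b - q *: lambda) i p =
    (f p - m) * ((f p - m) ^+ 2 - r * (f p - m) - q) * lambda i p.
  move=> pi; have ? := Dens_neq0 l0 pi.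
  by rewrite qprodE// !(nformD, nformN, nformZ) qprodE// !bE; field.
pose q := J (qprod b lambda b); have q0 : 0 < q := qprod_gt0 lambda_prob l0 b0.
pose r := J (qprod b lambda (qprod b lambda b)) / q.
pose c := qprod b lambda b - r *: b - q *: lambda.
exists b, c; split => //.
- rewrite /Tan/= /c !JB !JZ (Prob_int lambda_prob) -/q.
  by have -> : J b = 0 := Tb; ring.
- rewrite /c !qprodBr// !qprodZr// !JB !JZ qprod_idr// -/q /r.
  by have -> : J b = 0 := Tb; field; rewrite gt_eqF.
apply/eqP => E0.
pose P := Poly [:: 0; - q; - r; 1].
have P0 : P != 0.
  apply/eqP => P0; have : P`_3 = 1 by rewrite coef_Poly.
  by rewrite P0 coef0 => /esym/eqP; rewrite oner_eq0.
have rootP y : 0 < y < d -> root P (y - m).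
  move=> /fd[p <-]; have pi := chart_atP p; apply/rootP.
  have : qprod b lambda c (chart_at p) p = 0 by rewrite E0.
  rewrite cE// => /eqP; rewrite mulf_eq0 (negbTE (Dens_neq0 l0 pi)) orbF => /eqP <-.
  by rewrite horner_Poly/=; ring.
(* d / 2, ..., d / 5 are four distinct values of f. *)
pose rs := [seq d / (j.+2)%:R - m | j <- iota 0 4].
have : (size rs < size P)%N.
  apply: max_poly_roots => //.
    apply/allP => _ /mapP[j _ ->]; apply: rootP; rewrite divr_gt0//=.
    by rewrite ltr_pdivrMr// ltr_pMr// ltr1n.
  rewrite map_inj_uniq ?iota_uniq// => i j /addIr/(mulfI (lt0r_neq0 d0))/invr_inj/eqP.
  by rewrite eqr_nat => /eqP[].
rewrite size_map size_iota ltnNge; apply/negP; rewrite negbK.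
exact: size_Poly.
Qed.

End Curvature.

(** * Metrizability of the alpha-connections *)

Lemma no_compatible_metric (R : realType) (n : nat) (n_ge1 : (1 <= n)%N)
    (M : closedOrientedManifold R n) (lambda : nform M) (alpha : R) :
  Prob lambda -> ~ (alpha = -1 \/ alpha = 0 \/ alpha = 1) ->
  ~ (exists g : nform M -> nform M -> nform M -> R,
       riemannian_metric g /\ compatible (amari_cencov alpha) g).
Proof.
move=> lp al [g [gm gc]].
have [b [c [Tb Tc bc0 bcn0]]] := exists_orthogonal_pair lp n_ge1.
have kn : (1 + alpha) / 2 - ((1 + alpha) / 2) ^+ 2 != 0.
  have -> : (1 + alpha) / 2 - ((1 + alpha) / 2) ^+ 2 = (1 + alpha) * (1 - alpha) / 4 by field.
  rewrite !mulf_neq0//; apply/eqP => E; apply: al; [left|right; right]; lra.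
have := compatible_metric_half lp gm gc kn Tb Tc bc0 bcn0.
move=> E; apply: al; right; left; lra.
Qed.

Theorem theorem4p2 (R : realType) (n : nat) (n_ge1 : (1 <= n)%N)
    (M : closedOrientedManifold R n)
    (lambda : nform M) (lambda_prob : Prob lambda) (alpha : R) :
  ((exists g : nform M -> nform M -> nform M -> R,
      riemannian_metric g /\ levi_civita (amari_cencov alpha) g) <->
   (alpha = -1 \/ alpha = 0 \/ alpha = 1)) /\
  ((alpha = -1 \/ alpha = 0) ->
     riemannian_metric (fisher_rao lambda alpha) /\
     levi_civita (amari_cencov alpha) (fisher_rao lambda alpha)) /\
  (alpha = 1 ->
     riemannian_metric (Gtilde lambda) /\
     levi_civita (amari_cencov alpha) (Gtilde lambda)) /\
  (~ (alpha = -1 \/ alpha = 0 \/ alpha = 1) ->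
     affine_connection (@amari_cencov R n M alpha) /\
     ~ (exists g : nform M -> nform M -> nform M -> R,
          riemannian_metric g /\ compatible (amari_cencov alpha) g)).
Proof.
have aff := @amari_cencov_affine R n M lambda lambda_prob.
have tf := @amari_cencov_torsion_free R n M.
have p12 : alpha = -1 \/ alpha = 0 ->
    riemannian_metric (fisher_rao lambda alpha) /\
    levi_civita (amari_cencov alpha) (fisher_rao lambda alpha).
  case=> ->.
    have E := fun mu u v => @fisher_rao_mixtureE R n M lambda lambda_prob u v mu.
    split; first exact: (eq_riemannian lambda_prob E (mixture_riemannian lambda_prob)).
    split=> //.
    exact: (eq_metric_compatible lambda_prob E (mixture_compatible lambda_prob erefl)).
  have E := fun mu u v => @fisher_rao_zeroE R n M lambda lambda_prob u v mu.
  split; first exact: (eq_riemannian lambda_prob E (fisher_riemannian lambda_prob)).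
  split=> //.
  exact: (eq_metric_compatible lambda_prob E (fisher_compatible lambda_prob erefl)).
have p3 : alpha = 1 -> riemannian_metric (Gtilde lambda) /\
    levi_civita (amari_cencov alpha) (Gtilde lambda).
  move=> ->; have E := fun mu u v => @GtildeE R n M lambda lambda_prob u v mu.
  split; first exact: (eq_riemannian lambda_prob E (log_cov_riemannian lambda_prob)).
  split=> //.
  exact: (eq_metric_compatible lambda_prob E (log_cov_compatible lambda_prob erefl)).
split; last first.
  split=> //; split=> // al; split=> //.
  exact: (no_compatible_metric n_ge1 lambda_prob al).
split=> [[g [gm [_ _ gc]]]|[a1|[a0|a1]]].
- apply: contrapT => al; apply: (no_compatible_metric n_ge1 lambda_prob al).
  by exists g.
- by exists (fisher_rao lambda alpha); apply: p12; left.
- by exists (fisher_rao lambda alpha); apply: p12; right.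
- by exists (Gtilde lambda); apply: p3.
Qed.
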